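(* Let $(R,\mathfrak m)$ be a regular local ring with quotient field $F$ and $\dim R\ge 2$, let $\{(R_i,\mathfrak m_i)\}_{i\ge 0}$ be an infinite sequence of local quadratic transforms with $R_0=R$, and let $S=\bigcup_{i\ge 0}R_i$. The following are equivalent: (1) $S$ is a valuation ring; (2) $S$ has only finitely many height $1$ prime ideals; (3) either (a) $\dim S=1$, or (b) $\dim S=2$ and the boundary valuation ring $V$ of $S$ has value group $\mathbb Z\oplus G$, where $G$ is a subgroup of $\mathbb Q$ and the direct sum is ordered lexicographically.
   Context: A local quadratic transform of a regular local ring $(A,\mathfrak n)$ is a local ring $A[\mathfrak n/x]_{\mathfrak q}$ with $x\in\mathfrak n\setminus\mathfrak n^2$ and $\mathfrak q$ a prime ideal of $A[\mathfrak n/x]$ containing $\mathfrak n$. The sequence satisfies: for each $i\ge 0$, $R_{i+1}$ is a local quadratic transform of $R_i$, $R_i\subsetneq R_{i+1}$, and each $R_i$ is a regular local ring of dimension at least $2$ with maximal ideal $\mathfrak m_i$. $\mathrm{ord}_i$ is the order valuation of $R_i$ ($\mathrm{ord}_i(a)=\max\{n:a\in\mathfrak m_i^n\}$ for $0\ne a\in R_i$, extended to $F$ by $\mathrm{ord}_i(a/b)=\mathrm{ord}_i(a)-\mathrm{ord}_i(b)$), with valuation ring $V_i$. The boundary valuation ring of $S$ is the unique valuation ring $V$ with $R\subseteq V\subseteq F$ that is a limit point of $\{V_i\}$ in the patch topology (basic open sets $\{U: G\subseteq U, H\subseteq\mathfrak M_U\}$ for finite $G,H\subseteq F$, $\mathfrak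 M_U$ the maximal ideal of $U$); equivalently $V=\{q\in F:\mathrm{ord}_i(q)\ge 0\text{ for all } i\gg0\}$. *)

(* Defs.v *)
(* All rings are subrings of a fixed field F (the common
   quotient field), represented as predicates F -> Prop. *)
From mathcomp Require Import all_boot all_order all_algebra.
Set Implicit Arguments. Unset Strict Implicit. Unset Printing Implicit Defensive.
Import Order.TTheory GRing.Theory Num.Theory.
Local Open Scope ring_scope.

Section Defs.
Variable F : fieldType.
Implicit Types (A B I P T : F -> Prop).

Definition subset_ A B := forall z, A z -> B z.
Definition seteq A B := forall z, A z <-> B z.
Definition strict_sub A B := subset_ A B /\ exists z, B z /\ ~ A z.

Definition is_subring A :=
  [/\ A 0, A 1, (forall x y, A x -> A y -> A (x - y)) &
      (forall x y, A x -> A y -> A (x * y))].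

Definition is_ideal A I :=
  [/\ subset_ I A, I 0, (forall x y, I x -> I y -> I (x + y)) &
      (forall a x, A a -> I x -> I (a * x))].

Definition is_prime A P :=
  [/\ is_ideal A P, ~ P 1 &
      forall a b, A a -> A b -> P (a * b) -> P a \/ P b].

Definition ideal_gen A T z :=
  forall I, is_ideal A I -> subset_ T I -> I z.

Definition prod_of I (n : nat) y :=
  exists s : seq F, [/\ size s = n, (forall t, t \in s -> I t) &
                        y = \prod_(t <- s) t].

Definition ideal_pow A I (n : nat) := ideal_gen A (prod_of I n).

Definition nonunits A x := A x /\ ~ (exists y, A y /\ x * y = 1).

Definition is_local A := is_subring A /\ is_ideal A (nonunits A).

Definition maxideal A := nonunits A.

Definition noetherian A :=
  forall I, is_ideal A I -> exists s : seq F, seteq I (ideal_gen A (fun z => z \in s)).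

Definition prime_chain A (c : nat -> F -> Prop) (n : nat) :=
  (forall i, (i <= n)%N -> is_prime A (c i)) /\
  (forall i, (i < n)%N -> strict_sub (c i) (c i.+1)).

Definition krull_dim A (d : nat) :=
  (exists c, prime_chain A c d) /\ (forall c m, prime_chain A c m -> (m <= d)%N).

Definition height_one A P :=
  [/\ is_prime A P,
      (exists c, prime_chain A c 1 /\ seteq (c 1%N) P) &
      (forall c m, prime_chain A c m -> seteq (c m) P -> (m <= 1)%N)].

Definition regular_local A :=
  [/\ is_local A, noetherian A &
      exists d, krull_dim A d /\
        exists s : seq F, size s = d /\ (forall t, t \in s -> A t) /\
          seteq (maxideal A) (ideal_gen A (fun z => z \in s))].

Definition quotient_field_of A :=
  forall z, exists a b, [/\ A a, A b, b != 0 & z = a / b].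

Definition gen_subring A T z :=
  forall B, is_subring B -> subset_ A B -> subset_ T B -> B z.

Definition blowup A x := gen_subring A (fun z => exists y, maxideal A y /\ z = y / x).

Definition localize B q z := exists a b, [/\ B a, B b, ~ q b & z = a / b].

Definition local_quadratic_transform A B :=
  exists x, [/\ maxideal A x, ~ ideal_pow A (maxideal A) 2 x &
    exists q, [/\ is_prime (blowup A x) q, subset_ (maxideal A) q &
                  seteq B (localize (blowup A x) q)]].

Definition ord_is A a (n : nat) :=
  ideal_pow A (maxideal A) n a /\ ~ ideal_pow A (maxideal A) n.+1 a.

Definition ord_nonneg A z :=
  exists a b, [/\ A a, A b, b != 0, z = a / b &
    exists na nb, [/\ ord_is A a na, ord_is A b nb & (nb <= na)%N]].

Definition boundary_valuation_ring (Rs : nat -> F -> Prop) z :=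
  exists N, forall i, (N <= i)%N -> ord_nonneg (Rs i) z.

Definition union_ring (Rs : nat -> F -> Prop) z := exists i, Rs i z.

Definition valuation_ring A :=
  is_subring A /\ forall x, x != 0 -> A x \/ A x^-1.

Definition finitely_many_height_one A :=
  exists (n : nat) (P : nat -> F -> Prop),
    forall Q, height_one A Q -> exists k, (k < n)%N /\ seteq Q (P k).

Definition lex_nonneg (v : int * rat) := (0 < v.1) \/ (v.1 = 0 /\ 0 <= v.2).

(* V has value group isomorphic (as ordered group) to Z (+) G lex, G <= Q:
   there is a valuation w : F^* -> Z x Q onto Z x G with valuation ring V. *)
Definition value_group_Z_lex_subQ V :=
  exists (G : rat -> Prop) (w : F -> int * rat),
    (G 0 /\ forall a b, G a -> G b -> G (a - b)) /\
    [/\ (forall x y, x != 0 -> y != 0 ->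
           w (x * y) = ((w x).1 + (w y).1, (w x).2 + (w y).2)),
        (forall n g, G g -> exists x, x != 0 /\ w x = (n, g)),
        (forall x, x != 0 -> G (w x).2) &
        (forall x, x != 0 -> (V x <-> lex_nonneg (w x)))].

End Defs.

(* Main.v *)
(** Write m_i R_{i+1} = x_i R_{i+1} with x_i in m_i but not in m_i^2. Two facts about a single transform carry
    the argument: the order of a regular local ring is multiplicative, and the order of a/x_i^(ord_i a) in
    R_{i+1} is at most ord_i a. The second one holds because a form of degree n over the residue field that
    lies in the (n+1)-st power of the ideal of a point is zero, as one sees by translating to that point.

    V is a valuation ring: write z = a/b in R_i and divide a and b by x_i^(min (ord_i a) (ord_i b)) to get a
    fraction over R_{i+1}; this minimum never increases, and drops whenever the sign of ord_i z changes.

    If S has finitely many height one primes, then by prime avoidance and the principal ideal theorem these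
    are all its nonzero nonmaximal primes, so x_N avoids them for some N, which also forces every x_l, l >= N,
    to become a monomial in later x_j times a unit. Then S is the intersection of V and of the valuation rings
    S_P (regular local rings being completely integrally closed), and a local finite intersection of valuation
    rings is a valuation ring.

    If S is a valuation ring, then V = S, and S_P = (R_i)_(P cap R_i) is noetherian, hence discrete, for every
    nonmaximal prime P, so there is at most one nonzero such P. An element divisible by all products
    x_K ... x_L is infinitely larger than every element of S, because orders of transforms are bounded; this
    excludes such elements outside P and makes the values of S outside P pairwise commensurable. Conversely, if
    V has value group Z + G, the same remark puts every height one prime inside the prime where the Z-component
    is positive. *)
Require Import Defs.
From mathcomp Require Import all_boot all_order all_algebra.
From mathcomp Require Import ring zify.
From mathcomp.multinomials Require Import mpoly.
From mathcomp.classical Require Import boolp.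
From mathcomp.classical Require classical_sets.
Set Implicit Arguments. Unset Strict Implicit. Unset Printing Implicit Defensive.
Import Order.TTheory GRing.Theory Num.Theory.
Local Open Scope ring_scope.

(** * Subrings, ideals and primes as predicates *)

Section Basics.
Variable F : fieldType.
Implicit Types (A B I J P Q T : F -> Prop).

(** All rings and ideals are subsets of [F], so residue rings are not objects here. Whatever
    concerns A/I (Krull's theorems, integral closedness, regular sequences, the graded ring) is
    stated in A with membership in I in place of equality. Forms over the residue field are
    polynomials over [F] with coefficients in A, and vanishing means that all coefficients lie in
    the maximal ideal.

    The prime that defines a transform B of A is an arbitrary point of the exceptional fibre, not
    necessarily closed or rational over the residue field of A. Its coordinates are therefore taken
    in B and the translation is done over B; the conclusion returns to A because the maximal ideal
    of B contracts to that of A.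

    S need not be noetherian. A nonmaximal prime P contains no x_i from some stage N on;
    denominators b with b/x_i^n a unit then lie outside P, and this is why chain conditions at P can
    be imported from R_N. *)

Lemma pred_ext A B : seteq A B -> A = B.
Proof. by move=> h; apply/funext => z; apply/propext; apply: h. Qed.

Lemma sub_antisym A B : subset_ A B -> subset_ B A -> A = B.
Proof. by move=> h1 h2; apply: pred_ext => z; split; [apply: h1|apply: h2]. Qed.

Lemma sub_tr A B T : subset_ A B -> subset_ B T -> subset_ A T.
Proof. by move=> h1 h2 z /h1/h2. Qed.

Lemma strict_subP A B : subset_ A B -> A <> B -> strict_sub A B.
Proof.
move=> h ne; split=> //; apply: contrapT => h2; apply: ne; apply: sub_antisym => // z Bz.
by apply: contrapT => nA; apply: h2; exists z.
Qed.

Lemma strict_sub_ne A B : strict_sub A B -> A <> B.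
Proof. by case=> _ [z [Bz nA]] e; apply: nA; rewrite e. Qed.

Lemma strict_sub_trans A B T : strict_sub A B -> subset_ B T -> strict_sub A T.
Proof. by move=> [h [z [Bz nA]]] h2; split; [apply: sub_tr h2|exists z; split=> //; apply: h2]. Qed.

Section Subring.
Variables (A : F -> Prop) (HA : is_subring A).
Lemma sr0 : A 0. Proof. by case: HA. Qed.
Lemma sr1 : A 1. Proof. by case: HA. Qed.
Lemma srB x y : A x -> A y -> A (x - y). Proof. by case: HA => _ _ h _; apply: h. Qed.
Lemma srN x : A x -> A (- x). Proof. by move=> Ax; rewrite -sub0r; apply: srB => //; exact: sr0. Qed.
Lemma srD x y : A x -> A y -> A (x + y).
Proof. by move=> Ax Ay; rewrite -[y]opprK; apply: srB => //; apply: srN. Qed.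
Lemma srM x y : A x -> A y -> A (x * y). Proof. by case: HA => _ _ _ h; apply: h. Qed.
Lemma srX x n : A x -> A (x ^+ n).
Proof. by move=> Ax; elim: n => [|n ih]; rewrite ?expr0 ?exprS; [exact: sr1|apply: srM]. Qed.
Lemma srMn x n : A x -> A (x *+ n).
Proof. by move=> Ax; elim: n => [|n ih]; rewrite ?mulr0n ?mulrS; [exact: sr0|apply: srD]. Qed.
Lemma sr_sum (K : Type) (r : seq K) (p : pred K) (f : K -> F) :
  (forall i, p i -> A (f i)) -> A (\sum_(i <- r | p i) f i).
Proof. by move=> h; elim/big_rec: _ => [|i x /h fi Ax]; [exact: sr0|exact: srD]. Qed.
Lemma sr_prod (K : Type) (r : seq K) (p : pred K) (f : K -> F) :
  (forall i, p i -> A (f i)) -> A (\prod_(i <- r | p i) f i).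
Proof. by move=> h; elim/big_rec: _ => [|i x /h fi Ax]; [exact: sr1|exact: srM]. Qed.

Section Ideal.
Variables (I : F -> Prop) (HI : is_ideal A I).
Lemma idS x : I x -> A x. Proof. by case: HI => h _ _ _; apply: h. Qed.
Lemma id0 : I 0. Proof. by case: HI. Qed.
Lemma idD x y : I x -> I y -> I (x + y). Proof. by case: HI => _ _ h _; apply: h. Qed.
Lemma idMl a x : A a -> I x -> I (a * x). Proof. by case: HI => _ _ _ h; apply: h. Qed.
Lemma idMr a x : A a -> I x -> I (x * a). Proof. by rewrite mulrC; apply: idMl. Qed.
Lemma idN x : I x -> I (- x).
Proof. by move=> Ix; rewrite -mulN1r; apply: idMl => //; apply: srN; exact: sr1. Qed.
Lemma idX x n : I x -> I (x ^+ n.+1).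
Proof. by move=> Ix; rewrite exprS; apply: idMr => //; apply: srX; exact: idS. Qed.
Lemma id_sum (K : Type) (r : seq K) (p : pred K) (f : K -> F) :
  (forall i, p i -> I (f i)) -> I (\sum_(i <- r | p i) f i).
Proof. by move=> h; elim/big_rec: _ => [|i x /h fi Ax]; [exact: id0|exact: idD]. Qed.
Lemma id1 : I 1 -> I = A.
Proof.
move=> I1; apply: sub_antisym => z; first exact: idS.
by move=> Az; rewrite -[z]mulr1; apply: idMl.
Qed.
End Ideal.
Lemma ideal_self : is_ideal A A.
Proof. by split=> //; [exact: sr0|exact: srD|exact: srM]. Qed.
Lemma ideal_zero : is_ideal A (fun z => z = 0).
Proof.
split=> //; first by move=> z ->; exact: sr0.
- by move=> x y -> ->; rewrite addr0.
- by move=> a x _ ->; rewrite mulr0.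
Qed.
Lemma prime_zero : is_prime A (fun z => z = 0).
Proof.
split; first exact: ideal_zero.
- by apply/eqP; rewrite oner_eq0.
- by move=> a b _ _ /eqP; rewrite mulf_eq0 => /orP[/eqP|/eqP]; [left|right].
Qed.
End Subring.

Lemma prime_ideal A P : is_prime A P -> is_ideal A P. Proof. by case. Qed.
Lemma prime1 A P : is_prime A P -> ~ P 1. Proof. by case. Qed.
Lemma primeM A P a b : is_prime A P -> A a -> A b -> P (a * b) -> P a \/ P b.
Proof. by case=> _ _ h; apply: h. Qed.
Lemma primeX A P a n : is_prime A P -> is_subring A -> A a -> P (a ^+ n) -> P a.
Proof.
move=> HP HA Aa; elim: n => [/(prime1 HP)//|n ih]; rewrite exprS => /(primeM HP Aa)[] //.
exact: srX.
Qed.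
Lemma primeMN A P a b : is_prime A P -> A a -> A b -> ~ P a -> ~ P b -> ~ P (a * b).
Proof. by move=> HP Aa Ab na nb /(primeM HP Aa Ab)[]. Qed.
Lemma primeXN A P a n : is_prime A P -> is_subring A -> A a -> ~ P a -> ~ P (a ^+ n).
Proof. by move=> HP HA Aa na /(primeX HP HA Aa). Qed.
End Basics.

Ltac mem :=
  solve [ assumption
  | match goal with
    | H : is_subring ?A |- ?A 0 => exact (sr0 H)
    | H : is_subring ?A |- ?A 1 => exact (sr1 H)
    | H : is_subring ?A |- ?A (_ + _) => apply (srD H); mem
    | H : is_subring ?A |- ?A (- _) => apply (srN H); mem
    | H : is_subring ?A |- ?A (_ * _) => apply (srM H); mem
    | H : is_subring ?A |- ?A (_ ^+ _) => apply (srX H); mem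
    | H : is_subring ?A |- ?A (_ *+ _) => apply (srMn H); mem
    | H : is_ideal ?A ?I |- ?I 0 => exact (id0 H)
    | H : is_ideal ?A ?I |- ?I (_ + _) => apply (idD H); mem
    | H : is_ideal ?A ?I, H' : is_subring ?A |- ?I (- _) => apply (idN H' H); mem
    | H : is_ideal ?A ?I, H' : is_subring ?A |- ?I (_ ^+ _.+1) => apply (idX H' H); mem
    | H : is_ideal ?A ?I |- ?I (_ * _) => apply (idMl H); mem
    | H : is_ideal ?A ?I |- ?I (_ * _) => apply (idMr H); mem
    | H : is_ideal ?A ?I, H' : ?I ?x |- ?A ?x => exact (idS H H')
    | H : is_prime ?A ?I, H' : ?I ?x |- ?A ?x => exact (idS (prime_ideal H) H')
    | H : subset_ ?I ?J, H' : ?I ?x |- ?J ?x => exact (H _ H')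
    | H : is_prime ?A ?I |- ?I _ =>
        lazymatch goal with
        | _ : is_ideal A I |- _ => fail
        | _ => have ? := prime_ideal H; mem
        end
    end ].

(** * Operations on ideals, noetherian rings, Nakayama's lemma *)

Section Ideals.
Variable F : fieldType.
Implicit Types (A B C I J P Q T N : F -> Prop).

Definition isum I J z := exists a b, [/\ I a, J b & z = a + b].
Definition principal A a z := exists r, A r /\ z = r * a.
Definition meet I J (z : F) := I z /\ J z.
(** For [C] the ring this is the ideal generated by [gs]; for [C] an ideal it is the product of [C]
    with that ideal, as Nakayama's lemma needs it. *)
Fixpoint span C (gs : seq F) z :=
  if gs is g :: l then exists c w, [/\ C c, span C l w & z = c * g + w] else z = 0.

Lemma isum_ideal A I J : is_ideal A I -> is_ideal A J -> is_subring A -> is_ideal A (isum I J).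
Proof.
move=> HI HJ HA; split.
- by move=> z [a [b [Ia Jb ->]]]; mem.
- by exists 0, 0; split; [mem|mem|ring].
- move=> x y [a [b [Ia Jb ->]]] [c [d [Ic Jd ->]]].
  by exists (a + c), (b + d); split; [mem|mem|ring].
- move=> r x Ar [a [b [Ia Jb ->]]].
  by exists (r * a), (r * b); split; [mem|mem|ring].
Qed.

Lemma isum_l A I J : is_ideal A J -> subset_ I (isum I J).
Proof. by move=> HJ z Iz; exists z, 0; split; [|mem|ring]. Qed.
Lemma isum_r A I J : is_ideal A I -> subset_ J (isum I J).
Proof. by move=> HI z Jz; exists 0, z; split; [mem| |ring]. Qed.
Lemma isum_min A I J T : is_ideal A T -> subset_ I T -> subset_ J T -> subset_ (isum I J) T.
Proof. by move=> HT h1 h2 z [a [b [/h1 ? /h2 ? ->]]]; mem. Qed.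

Lemma principal_ideal A a : is_subring A -> A a -> is_ideal A (principal A a).
Proof.
move=> HA Aa; split.
- by move=> z [r [Ar ->]]; mem.
- by exists 0; split; [mem|ring].
- by move=> x y [r [Ar ->]] [s [As ->]]; exists (r + s); split; [mem|ring].
- by move=> r x Ar [s [As ->]]; exists (r * s); split; [mem|ring].
Qed.
Lemma principal_self A a : is_subring A -> principal A a a.
Proof. by move=> HA; exists 1; split; [mem|ring]. Qed.
Lemma principal_min A I a : is_ideal A I -> I a -> subset_ (principal A a) I.
Proof. by move=> HI Ia z [r [Ar ->]]; mem. Qed.

Lemma meet_ideal A I J : is_ideal A I -> is_ideal A J -> is_ideal A (meet I J).
Proof.
move=> HI HJ; split.
- by move=> z [? ?]; mem.
- by split; mem.
- by move=> x y [? ?] [? ?]; split; mem.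
- by move=> r x Ar [? ?]; split; mem.
Qed.

Lemma span_ideal A C gs : is_subring A -> is_ideal A C -> (forall g, g \in gs -> A g) ->
  is_ideal A (span C gs).
Proof.
move=> HA HC; elim: gs => [|g l ih] hA; first exact: ideal_zero.
have Ag : A g by apply: hA; rewrite mem_head.
have {}ih : is_ideal A (span C l) by apply: ih => x xl; apply: hA; rewrite in_cons xl orbT.
split.
- by move=> z [c [w [? ? ->]]]; mem.
- by exists 0, 0; split; [mem|mem|ring].
- move=> x y [a [b [Ia Jb ->]]] [c [d [Ic Jd ->]]].
  by exists (a + c), (b + d); split; [mem|mem|ring].
- move=> r x Ar [a [b [Ia Jb ->]]].
  by exists (r * a), (r * b); split; [mem|mem|ring].
Qed.

Lemma span_gen A gs g : is_subring A -> (forall g, g \in gs -> A g) -> g \in gs -> span A gs g.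
Proof.
move=> HA; elim: gs => [|h l ih] hA //.
have hl : forall x, x \in l -> A x by move=> x xl; apply: hA; rewrite in_cons xl orbT.
rewrite in_cons => /orP[/eqP ->|gl].
  exists 1, 0; split; [mem| |ring]; apply: (@id0 _ A).
  exact: (span_ideal HA (ideal_self HA) hl).
by exists 0, g; split; [mem|exact: ih|ring].
Qed.

Lemma span_min A C gs J : is_ideal A J -> subset_ C A -> (forall g, g \in gs -> J g) ->
  subset_ (span C gs) J.
Proof.
move=> HJ CA; elim: gs => [|h l ih] hJ z /=; first by move=> ->; mem.
move=> [c [w [/CA Cc wl ->]]].
have Jh : J h by apply: hJ; rewrite mem_head.
have Jw : J w by apply: ih => // x xl; apply: hJ; rewrite in_cons xl orbT.
mem.
Qed.

Lemma ideal_gen_ideal A T : subset_ T A -> is_subring A -> is_ideal A (ideal_gen A T).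
Proof.
move=> TA HA; split.
- by move=> z h; apply: h => //; exact: ideal_self.
- by move=> I HI _; mem.
- by move=> x y hx hy I HI TI; have Ix := hx I HI TI; have Iy := hy I HI TI; mem.
- by move=> a x Aa hx I HI TI; have Ix := hx I HI TI; mem.
Qed.

Lemma ideal_gen_sub A T : subset_ T (ideal_gen A T).
Proof. by move=> z Tz I HI TI; apply: TI. Qed.

Lemma ideal_gen_min A T I : is_ideal A I -> subset_ T I -> subset_ (ideal_gen A T) I.
Proof. by move=> HI TI z; apply. Qed.

Lemma ideal_gen_span A gs : is_subring A -> (forall g, g \in gs -> A g) ->
  ideal_gen A (fun z => z \in gs) = span A gs.
Proof.
move=> HA hA; apply: sub_antisym.
  apply: ideal_gen_min; first exact: (span_ideal HA (ideal_self HA)).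
  by move=> z; apply: span_gen.
apply: (@span_min A) => //; last by move=> g; apply: ideal_gen_sub.
exact: ideal_gen_ideal.
Qed.

Lemma noeth_fg A I : is_subring A -> noetherian A -> is_ideal A I ->
  exists gs : seq F, (forall g, g \in gs -> I g) /\ I = span A gs.
Proof.
move=> HA hN HI; have [gs /pred_ext e] := hN I HI.
have gI : forall g, g \in gs -> I g by move=> g gg; rewrite e; apply: ideal_gen_sub.
exists gs; split=> //; rewrite {1}e; apply: ideal_gen_span => // g /gI; exact: idS.
Qed.

Lemma noethI A : is_subring A ->
  (forall I, is_ideal A I -> exists gs : seq F, (forall g, g \in gs -> I g) /\ subset_ I (span A gs)) ->
  noetherian A.
Proof.
move=> HA h I HI; have [gs [gI sI]] := h I HI; exists gs.
rewrite ideal_gen_span => [z|//|g /gI]; last exact: idS.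
split; first exact: sI.
by apply: (span_min HI) => //; exact: idS.
Qed.

Lemma noeth_acc A (c : nat -> F -> Prop) : is_subring A -> noetherian A ->
  (forall n, is_ideal A (c n)) -> (forall n, subset_ (c n) (c n.+1)) ->
  exists n, forall m, subset_ (c m) (c n).
Proof.
move=> HA hN cI cS.
have cm m n : (m <= n)%N -> subset_ (c m) (c n).
  elim: n => [|n ih]; first by rewrite leqn0 => /eqP ->.
  by rewrite leq_eqVlt => /orP[/eqP ->//|/ih h]; apply: sub_tr h (cS n).
have UI : is_ideal A (fun z => exists n, c n z).
  split.
  - by move=> z [n]; apply: idS.
  - by exists 0%N; exact: (id0 (cI 0%N)).
  - move=> x y [m cx] [n cy]; exists (maxn m n); have Im := cI (maxn m n); apply: (idD Im).
      exact: (cm _ _ (leq_maxl _ _) _ cx).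
    exact: (cm _ _ (leq_maxr _ _) _ cy).
  - by move=> a x Aa [n cx]; exists n; apply: (idMl (cI n)).
have [gs [gU eU]] := noeth_fg HA hN UI.
have [n hn] : exists n, forall g, g \in gs -> c n g.
  elim: gs gU {eU} => [|g l ih] gU; first by exists 0%N.
  have [|n hn] := ih; first by move=> x xl; apply: gU; rewrite in_cons xl orbT.
  have [k ck] := gU g (mem_head _ _).
  exists (maxn k n) => x; rewrite in_cons => /orP[/eqP ->|/hn xl].
    exact: (cm _ _ (leq_maxl _ _) _ ck).
  exact: (cm _ _ (leq_maxr _ _) _ xl).
exists n => m z cz.
have : span A gs z by rewrite -eU; exists m.
by apply: (span_min (cI n)).
Qed.

Lemma noeth_max A (X : (F -> Prop) -> Prop) I0 : is_subring A -> noetherian A ->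
  (forall I, X I -> is_ideal A I) -> X I0 ->
  exists I, [/\ X I, subset_ I0 I & forall J, X J -> subset_ I J -> J = I].
Proof.
move=> HA hN XI X0; apply: contrapT => nmax.
pose Y := {I | X I /\ subset_ I0 I}.
have step (y : Y) : {z : Y | subset_ (sval y) (sval z) /\ ~ subset_ (sval z) (sval y)}.
  apply: cid; case: y => I [XI1 sI]; apply: contrapT => h; apply: nmax; exists I; split=> //.
  move=> J XJ sIJ; apply: contrapT => ne; apply: h.
  have sJ : X J /\ subset_ I0 J by split=> //; apply: sub_tr sIJ.
  by exists (exist _ J sJ); split=> //= JI; apply: ne; apply: sub_antisym.
pose y0 : Y := exist _ I0 (conj X0 (fun z h => h)).
pose c n := iter n (fun y => sval (step y)) y0.
have [n hn] : exists n, forall m, subset_ (sval (c m)) (sval (c n)).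
  apply: (noeth_acc HA hN) => n.
    by apply: XI; case: (c n) => I [].
  by rewrite /c /=; case: (step _) => z [].
by have := hn n.+1; rewrite /c /=; case: (step _) => z [].
Qed.

(** The finitely many multipliers outside the prime [Q] have a product outside [Q]. *)
Lemma span_kill A Q N gs : is_subring A -> is_prime A Q -> is_ideal A N ->
  (forall g, g \in gs -> A g /\ exists s, [/\ A s, ~ Q s & N (s * g)]) ->
  forall w, span A gs w -> exists s, [/\ A s, ~ Q s & N (s * w)].
Proof.
move=> HA HQ HN; elim: gs => [|g l ih] hg w /=.
  by move=> ->; exists 1; split; [mem|exact: prime1 HQ|rewrite mulr0; mem].
move=> [c [v [Ac lv ->]]].
have [|s [As Qs Ns]] := ih _ v lv; first by move=> x xl; apply: hg; rewrite in_cons xl orbT.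
have [Ag [t [At Qt Nt]]] := hg g (mem_head _ _).
exists (s * t); split; [mem|exact: (primeMN HQ)|].
rewrite (_ : _ * _ = (c * s) * (t * g) + t * (s * v)); last by ring.
have Acs : A (c * s) by mem.
mem.
Qed.

Lemma span_sub C D gs : subset_ C D -> subset_ (span C gs) (span D gs).
Proof.
move=> h; elim: gs => [|g l ih] z //= [c [w [/h Cc /ih lw ->]]].
by exists c, w.
Qed.

(* Nakayama's lemma over the localization at the prime Q, with denominators cleared. *)
Lemma nakayama A Q N gs : is_subring A -> is_prime A Q -> is_ideal A N ->
  (forall g, g \in gs -> A g /\ exists s, [/\ A s, ~ Q s & isum (span Q gs) N (s * g)]) ->
  forall w, span A gs w -> exists s, [/\ A s, ~ Q s & N (s * w)].
Proof.
move=> HA HQ HN hg; apply: (span_kill HA HQ HN).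
have QI := prime_ideal HQ.
elim: gs hg => [|g l ih] hg // x xl; split; first by have [] := hg x xl.
have [Ag [s0 [As0 Qs0 [_ [n0 [[q0 [w0 [Qq0 lw0 ->]]] Nn0 e0]]]]]] := hg g (mem_head _ _).
have lA y : y \in l -> A y by move=> yl; have [] := hg y; rewrite ?in_cons ?yl ?orbT.
have spI := span_ideal HA QI lA.
(* Moving the term q0 g to the left leaves the multiplier s0 - q0, still outside Q; thus t g is a
   combination of the other generators modulo N, and g can be eliminated. *)
pose t := s0 - q0.
have At : A t by rewrite /t; mem.
have nQt : ~ Q t.
  by move=> Qt; apply: Qs0; rewrite (_ : s0 = t + q0); [mem|rewrite /t; ring].
have et : t * g = w0 + n0 by rewrite /t mulrBl e0; ring.
have hl y : y \in l -> A y /\ exists s, [/\ A s, ~ Q s & N (s * y)].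
  apply: ih => {}y yl; have [Ay [s [As Qs]]] : _ := hg y ltac:(by rewrite in_cons yl orbT).
  move=> [_ [n [[q [w [Qq lw ->]]] Nn e]]].
  split=> //; exists (t * s); split; [mem|exact: (primeMN HQ)|].
  have Aq : A q by mem.
  exists (q * w0 + t * w), (q * n0 + t * n); split; [mem|mem|].
  by rewrite -mulrA e mulrDr mulrDr mulrCA et; ring.
move: xl; rewrite in_cons => /orP[/eqP ->|/hl[]//].
have [s [As Qs Ns]] := span_kill HA HQ HN hl (span_sub (@idS _ _ _ QI) lw0).
exists (s * t); split; [mem|exact: (primeMN HQ)|].
by rewrite -mulrA et mulrDr; mem.
Qed.

End Ideals.

(** * Ideal powers, local rings, Krull's intersection theorem *)

Section Local.
Variable F : fieldType.
Implicit Types (A B C I J P Q T N : F -> Prop).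

Lemma pow_ideal A I n : is_subring A -> is_ideal A I -> is_ideal A (ideal_pow A I n).
Proof.
move=> HA HI; apply: ideal_gen_ideal => // z [s [_ hs ->]]; rewrite big_seq.
by elim/big_rec: _ => [|i x /hs fi Ax]; mem.
Qed.

Lemma pow_gen A I (s : seq F) : (forall t, t \in s -> I t) ->
  ideal_pow A I (size s) (\prod_(t <- s) t).
Proof. by move=> hs; apply: ideal_gen_sub; exists s. Qed.

Lemma pow_min A I J n : is_ideal A J ->
  (forall s : seq F, size s = n -> (forall t, t \in s -> I t) -> J (\prod_(t <- s) t)) ->
  subset_ (ideal_pow A I n) J.
Proof. by move=> HJ h; apply: ideal_gen_min => // z [s [zs hs ->]]; apply: h. Qed.

Lemma pow0 A I : is_subring A -> is_ideal A I -> ideal_pow A I 0 = A.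
Proof.
move=> HA HI; apply: (@id1 _ A); first exact: pow_ideal.
by have := @pow_gen A I [::]; rewrite big_nil; apply.
Qed.

Lemma pow_mul A I a b x y : is_subring A -> is_ideal A I ->
  ideal_pow A I a x -> ideal_pow A I b y -> ideal_pow A I (a + b) (x * y).
Proof.
move=> HA HI Ix Iy.
have Hb := pow_ideal b HA HI; have Hab := pow_ideal (a + b) HA HI.
have Ay : A y by mem.
suff: subset_ (ideal_pow A I a) (fun x => A x /\ ideal_pow A I (a + b) (x * y)) by move=> /(_ x Ix)[].
apply: pow_min => [|s zs hs].
  split.
  - by move=> z [].
  - by split; [mem|rewrite mul0r; mem].
  - by move=> u v [? ?] [? ?]; split; [mem|rewrite mulrDl; mem].
  - by move=> r u Ar [? ?]; split; [mem|rewrite -mulrA; mem].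
split.
  rewrite big_seq; elim/big_rec: _ => [|i z /hs fi Az]; mem.
have As : A (\prod_(t <- s) t) by rewrite big_seq; elim/big_rec: _ => [|i z /hs fi Az]; mem.
suff: subset_ (ideal_pow A I b) (fun y => A y /\ ideal_pow A I (a + b) ((\prod_(t <- s) t) * y)).
  by move=> /(_ y Iy)[].
apply: pow_min => [|s' zs' hs'].
  split.
  - by move=> z [].
  - by split; [mem|rewrite mulr0; mem].
  - by move=> u v [? ?] [? ?]; split; [mem|rewrite mulrDr; mem].
  - by move=> r u Ar [? ?]; split; [mem|rewrite mulrCA; mem].
split; first by rewrite big_seq; elim/big_rec: _ => [|i z /hs' fi Az]; mem.
rewrite -big_cat -zs -zs' -size_cat; apply: pow_gen => t.
by rewrite mem_cat => /orP[/hs|/hs'].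
Qed.

Lemma pow1 A I : is_subring A -> is_ideal A I -> ideal_pow A I 1 = I.
Proof.
move=> HA HI; apply: sub_antisym.
  by apply: pow_min => // -[|t [|]] // _ h; rewrite big_seq1; apply: h; rewrite mem_head.
move=> z Iz; have := @pow_gen A I [:: z]; rewrite big_seq1; apply=> t.
by rewrite inE => /eqP ->.
Qed.

Lemma pow_le A I a b : is_subring A -> is_ideal A I -> (a <= b)%N ->
  subset_ (ideal_pow A I b) (ideal_pow A I a).
Proof.
move=> HA HI le; have Ha := pow_ideal a HA HI.
apply: pow_min => // s zs hs.
rewrite -(cat_take_drop a s) big_cat /=.
have At : A (\prod_(t <- drop a s) t).
  rewrite big_seq; elim/big_rec: _ => [|i z /mem_drop/hs fi Az]; mem.
have : ideal_pow A I a (\prod_(t <- take a s) t).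
  rewrite -{1}(@size_takel a _ s) ?zs //; apply: pow_gen => t /mem_take; exact: hs.
by move=> ?; mem.
Qed.

Lemma powX A I n x : I x -> ideal_pow A I n (x ^+ n).
Proof.
move=> Ix; have := @pow_gen A I (nseq n x); rewrite size_nseq big_nseq iter_mulr_1; apply.
by move=> t; rewrite mem_nseq => /andP[_ /eqP ->].
Qed.

(** An ideal maximal among those that contain [J] but no power of [I] is prime, hence contains [I]
    by hypothesis, a contradiction. *)
Lemma pow_sub A I J : is_subring A -> noetherian A -> is_ideal A I -> is_ideal A J ->
  (forall Q, is_prime A Q -> subset_ J Q -> subset_ I Q) ->
  exists k, subset_ (ideal_pow A I k) J.
Proof.
move=> HA hN HI HJ hQ; apply: contrapT => nJ.
pose X K := is_ideal A K /\ ~ exists k, subset_ (ideal_pow A I k) K.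
have [K [[HK nK] JK mK]] : exists K, [/\ X K, subset_ J K & forall L, X L -> subset_ K L -> L = K].
  by apply: (noeth_max HA hN) => // K [].
have step a : A a -> ~ K a -> exists k, subset_ (ideal_pow A I k) (isum K (principal A a)).
  move=> Aa nKa; apply: contrapT => h; apply: nKa.
  have Pa := principal_ideal HA Aa.
  rewrite -(mK (isum K (principal A a))).
  - by apply: (isum_r HK); apply: principal_self.
  - by split=> //; apply: isum_ideal.
  - exact: isum_l Pa.
have KP : is_prime A K.
  split=> //.
    move=> /(id1 HK) e; apply: nK; exists 0%N; rewrite pow0 // e => z; exact.
  move=> a b Aa Ab Kab; apply: contrapT => /Decidable.not_or [na nb]; apply: nK.
  have [k hk] := step a Aa na; have [l hl] := step b Ab nb.
  exists (k + l)%N; apply: pow_min => // s zs hs.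
  rewrite -(cat_take_drop k s) big_cat /=.
  have /hk : ideal_pow A I k (\prod_(t <- take k s) t).
    rewrite -{1}(@size_takel k _ s) ?zs ?leq_addr //; apply: pow_gen => t /mem_take; exact: hs.
  have /hl : ideal_pow A I l (\prod_(t <- drop k s) t).
    have e : size (drop k s) = l by rewrite size_drop zs addKn.
    rewrite -{1}e; apply: pow_gen => t /mem_drop; exact: hs.
  move=> [u [_ [Ku [r [Ar ->]] ->]]] [v [_ [Kv [q [Aq ->]] ->]]].
  rewrite (_ : _ * _ = u * (v + q * a) + r * b * v + r * q * (a * b))=> //; last by ring.
  mem.
by apply: nK; exists 1%N; rewrite pow1 //; apply: hQ.
Qed.

Section OneLocal.
Variable A : F -> Prop.
Hypotheses (HL : is_local A).
Let HA : is_subring A. Proof. by case: HL. Qed.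
Let Hm : is_ideal A (maxideal A). Proof. by case: HL. Qed.

Lemma local_sr : is_subring A. Proof. exact: HA. Qed.
Lemma local_mi : is_ideal A (maxideal A). Proof. exact: Hm. Qed.

Lemma local_unit s : A s -> ~ maxideal A s -> s != 0 /\ A s^-1.
Proof.
move=> As h; have [y [Ay sy]] : exists y, A y /\ s * y = 1.
  by apply: contrapT => h'; apply: h.
have s0 : s != 0 by apply/eqP => e; move/eqP: sy; rewrite e mul0r eq_sym oner_eq0.
by split=> //; rewrite (_ : s^-1 = y) //; apply: (mulfI s0); rewrite divff.
Qed.

Lemma unit_nmax s : A s^-1 -> s != 0 -> ~ maxideal A s.
Proof. by move=> As s0 [_ []]; exists s^-1; rewrite divff. Qed.

Lemma proper_submax I : is_ideal A I -> ~ I 1 -> subset_ I (maxideal A).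
Proof.
move=> HI n1 z Iz; split; first by mem.
by move=> [y [Ay zy]]; apply: n1; rewrite -zy; mem.
Qed.

Lemma max_prime : is_prime A (maxideal A).
Proof.
split=> //; first by apply: unit_nmax; rewrite ?invr1 ?oner_eq0 //; mem.
move=> a b Aa Ab [_ mab]; apply: contrapT => /Decidable.not_or [na nb]; apply: mab.
have [a0 Aa1] := local_unit Aa na; have [b0 Ab1] := local_unit Ab nb.
exists (b^-1 * a^-1); split; [mem|by field; rewrite a0 b0].
Qed.

Lemma prime_submax P : is_prime A P -> subset_ P (maxideal A).
Proof. by move=> HP; apply: proper_submax; [exact: prime_ideal|exact: prime1 HP]. Qed.

Lemma span_max_mul gs y w : (forall g, g \in gs -> A g) -> maxideal A y -> span A gs w ->
  span (maxideal A) gs (y * w).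
Proof.
move=> hA my; elim: gs w hA => [|g l ih] w hA /=; first by move=> ->; rewrite mulr0.
move=> [c [v [Ac lv ->]]]; exists (y * c), (y * v); split; [mem| |by ring].
by apply: ih => // x xl; apply: hA; rewrite in_cons xl orbT.
Qed.

Lemma nak_local gs N : is_ideal A N -> (forall g, g \in gs -> A g) ->
  (forall g, g \in gs -> isum (span (maxideal A) gs) N g) -> subset_ (span A gs) N.
Proof.
move=> HN hA hg w gw.
have [|s [As ns Ns]] := @nakayama _ A (maxideal A) N gs HA max_prime HN _ w gw.
  move=> g gg; split; first exact: hA.
  exists 1; rewrite mul1r; split; [mem|exact: prime1 max_prime|exact: hg].
have [s0 As1] := local_unit As ns.
by rewrite (_ : w = s^-1 * (s * w)); [mem|field].
Qed.

Hypothesis hN : noetherian A.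

Lemma nak_principal I N y : is_ideal A I -> is_ideal A N -> maxideal A y ->
  (forall z, I z -> exists w, I w /\ N (z - y * w)) -> subset_ I N.
Proof.
move=> HI HN my h; have [gs [gI e]] := noeth_fg HA hN HI.
have hA g : g \in gs -> A g by move=> /gI Ig; mem.
rewrite e; apply: nak_local => // g gg; have [w [Iw Nw]] := h g (gI _ gg).
exists (y * w), (g - y * w); split=> //; last by ring.
by apply: span_max_mul => //; rewrite -e.
Qed.

(** Avoids Artin-Rees. Let N be the intersection of the I + m^n and K = mN + I, and take J maximal
    among the ideals that meet N inside K. Every x in m has a power in J, so some m^k lies in J,
    hence N lies in I + m^k and so in J. Therefore N is contained in K, and Nakayama gives N in
    I. *)
Lemma krull I z : is_ideal A I -> (forall n, isum I (ideal_pow A (maxideal A) n) z) -> I z.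
Proof.
move=> HI; set m := maxideal A; pose N z := forall n, isum I (ideal_pow A m n) z.
have Hs n : is_ideal A (isum I (ideal_pow A m n)).
  by apply: isum_ideal => //; apply: pow_ideal.
have HN : is_ideal A N.
  split.
  - by move=> x /(_ 0%N); apply: idS (Hs _) _.
  - by move=> n; exact: id0 (Hs n).
  - by move=> x y hx hy n; apply: idD (Hs n) _ _ (hx n) (hy n).
  - by move=> a x Aa hx n; apply: idMl (Hs n) _ _ Aa (hx n).
suff: subset_ N I by apply.
have [gs [gN e]] := noeth_fg HA hN HN.
have hA g : g \in gs -> A g by move=> /gN Ig; mem.
pose K := isum (span m gs) I.
have Hsp : is_ideal A (span m gs) by apply: span_ideal.
have HK : is_ideal A K by apply: isum_ideal.
rewrite e; apply: nak_local => // g /gN; rewrite -/m -/K.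
pose X J := is_ideal A J /\ subset_ (meet J N) K.
have [J [[HJ JN] KJ mJ]] : exists J, [/\ X J, subset_ K J & forall L, X L -> subset_ J L -> L = J].
  apply: (noeth_max HA hN) => [L []//|]; split=> // x []; exact.
have key x : m x -> exists n, J (x ^+ n).
  move=> mx; have Ax : A x by mem.
  (* The colon ideals J : x^n stabilize; from that n on, adding x^n to J does not enlarge the part
     of the intersection with N outside K, so maximality puts x^n in J. *)
  pose c n r := A r /\ J (r * x ^+ n).
  have [n hn] : exists n, forall k, subset_ (c k) (c n).
    apply: (noeth_acc HA hN) => n.
      split.
      - by move=> r [].
      - by split; [mem|rewrite mul0r; mem].
      - by move=> u v [? ?] [? ?]; split; [mem|rewrite mulrDl; mem].
      - by move=> u v ? [? ?]; split; [mem|rewrite -mulrA; mem].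
    by move=> r [Ar Jr]; split=> //; rewrite exprSr mulrA; mem.
  exists n; have Hp : is_ideal A (principal A (x ^+ n)) by apply: principal_ideal => //; mem.
  rewrite -(mJ (isum J (principal A (x ^+ n)))).
  - by apply: (isum_r HJ); apply: principal_self.
  - split; first exact: isum_ideal.
    move=> _ [[j [_ [Jj [r [Ar ->]] ->]]] Ny].
    apply: JN; split=> //; apply: (idD HJ Jj).
    have : c n.+1 r.
      split=> //; have : J (x * (j + r * x ^+ n)).
        by apply: KJ; apply: (isum_l HI); apply: span_max_mul => //; rewrite -e.
      move=> Jx; rewrite (_ : _ * _ = x * (j + r * x ^+ n) - x * j); last by rewrite exprS; ring.
      by mem.
    by move=> /hn [].
  - exact: isum_l Hp.
have [k hk] : exists k, subset_ (ideal_pow A m k) J.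
  apply: pow_sub => // Q HQ JQ x mx; have [n Jn] := key x mx.
  by apply: (primeX HQ HA) (JQ _ Jn); mem.
move=> Ng; apply: JN; split=> //; have [i [w [Ii /hk Jw ->]]] := Ng k.
have Ji : J i by apply: KJ; apply: (isum_r Hsp).
mem.
Qed.

Lemma krull0 z : (forall n, ideal_pow A (maxideal A) n z) -> z = 0.
Proof.
move=> h; apply: (@krull (fun z => z = 0)); first exact: ideal_zero.
by move=> n; exists 0, z; rewrite add0r.
Qed.

End OneLocal.
End Local.

(** * Localization and the descending chain condition *)

Section Localization.
Variable F : fieldType.
Implicit Types (A B C I J P Q T N : F -> Prop).

(** The extension of [I] to the localization. For [I = A] it is [localize A P] by conversion, so
    [locid_sub] also embeds A there. *)
Definition locid A P I z := exists a b, [/\ I a, A b, ~ P b & z = a / b] : Prop.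

Section OnePrime.
Variables (A P : F -> Prop).
Hypotheses (HA : is_subring A) (HP : is_prime A P).
Let PI : is_ideal A P. Proof. exact: prime_ideal HP. Qed.

Lemma notin_neq0 b : ~ P b -> b != 0.
Proof. by move=> nb; apply/eqP => e; apply: nb; rewrite e; mem. Qed.

Lemma locid_sub I : subset_ I (locid A P I).
Proof. by move=> z Iz; exists z, 1; split; [|mem|exact: prime1 HP|rewrite divr1]. Qed.

Lemma loc_subring : is_subring (localize A P).
Proof.
split.
- by apply: locid_sub; mem.
- by apply: locid_sub; mem.
- move=> x y [a [b [Aa Ab nb ->]]] [c [d [Ac Ad nd ->]]].
  exists (a * d - c * b), (b * d); split; [mem|mem|exact: (primeMN HP)|].
  by field; rewrite !notin_neq0.
- move=> x y [a [b [Aa Ab nb ->]]] [c [d [Ac Ad nd ->]]].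
  exists (a * c), (b * d); split; [mem|mem|exact: (primeMN HP)|].
  by field; rewrite !notin_neq0.
Qed.

Lemma locid_ideal I : is_ideal A I -> is_ideal (localize A P) (locid A P I).
Proof.
move=> HI; split.
- by move=> z [a [b [Ia Ab nb ->]]]; exists a, b; split=> //; mem.
- by apply: locid_sub; mem.
- move=> x y [a [b [Aa Ab nb ->]]] [c [d [Ac Ad nd ->]]].
  exists (a * d + c * b), (b * d); split; [mem|mem|exact: (primeMN HP)|].
  by field; rewrite !notin_neq0.
- move=> x y [a [b [Aa Ab nb ->]]] [c [d [Ac Ad nd ->]]].
  exists (a * c), (b * d); split; [mem|mem|exact: (primeMN HP)|].
  by field; rewrite !notin_neq0.
Qed.

Lemma loc_inv s : A s -> ~ P s -> localize A P s^-1.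
Proof. by move=> As ns; exists 1, s; split; [mem|mem| |rewrite div1r]. Qed.

Lemma contr_ideal J : is_ideal (localize A P) J -> is_ideal A (meet J A).
Proof.
move=> HJ; have sub : subset_ A (localize A P) by exact: locid_sub.
split.
- by move=> z [].
- by split; mem.
- by move=> x y [? ?] [? ?]; split; mem.
- by move=> r x Ar [? ?]; split; last mem; apply: (idMl HJ) => //; exact: sub.
Qed.

Lemma locid_contr J : is_ideal (localize A P) J -> locid A P (meet J A) = J.
Proof.
move=> HJ; have sub : subset_ A (localize A P) by exact: locid_sub.
apply: sub_antisym => z.
  move=> [a [b [[Ja Aa] Ab nb ->]]]; apply: (idMr HJ) => //; exact: loc_inv.
move=> Jz; have [a [b [Aa Ab nb e]]] := idS HJ Jz.
exists a, b; split=> //; split=> //.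
rewrite (_ : a = b * z); first by apply: (idMl HJ) => //; exact: sub.
by rewrite e; field; rewrite notin_neq0.
Qed.

Lemma loc_noeth : noetherian A -> noetherian (localize A P).
Proof.
move=> hN; have HLA := loc_subring; apply: noethI => // J HJ.
have [gs [gJ e]] := noeth_fg HA hN (contr_ideal HJ).
exists gs; split; first by move=> g /gJ [].
rewrite -{1}(locid_contr HJ) e => z [a [b [ga Ab nb ->]]].
have gL : forall g, g \in gs -> localize A P g by move=> g /gJ [Jg _]; mem.
have HS : is_ideal (localize A P) (span (localize A P) gs).
  by apply: span_ideal => //; exact: ideal_self.
have Lb := loc_inv Ab nb.
have : span (localize A P) gs a by apply: span_sub ga; exact: locid_sub.
by move=> ?; mem.
Qed.

Lemma locid_prime p : is_prime A p -> subset_ p P -> is_prime (localize A P) (locid A P p).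
Proof.
move=> Hp pP; have pI := prime_ideal Hp.
have notp x : ~ P x -> ~ p x by move=> h /pP.
split; first exact: locid_ideal.
- move=> [a [b [pa Ab nb e]]]; have b0 := notin_neq0 nb; apply: nb; apply: pP.
  by rewrite (_ : b = a) // -[b]mulr1 e; field.
- move=> x y [a [b [Aa Ab nb ->]]] [c [d [Ac Ad nd ->]]] [u [v [pu Av nv e]]].
  have b0 := notin_neq0 nb; have d0 := notin_neq0 nd; have v0 := notin_neq0 nv.
  have : p (v * (a * c)).
    rewrite (_ : _ * _ = b * d * u); first by mem.
    rewrite (_ : u = u / v * v); last by field.
    by rewrite -e; field; rewrite b0 d0.
  move=> /(primeM Hp)[] //; first by mem.
    by move/(notp _ nv).
  by move=> /(primeM Hp)[] // ?; [left; exists a, b|right; exists c, d].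
Qed.

Lemma locid_mem p z : is_prime A p -> subset_ p P -> A z -> locid A P p z -> p z.
Proof.
move=> Hp pP Az [a [b [pa Ab nb e]]].
have : p (b * z) by rewrite e (_ : _ * _ = a) //; field; rewrite notin_neq0.
by move=> /(primeM Hp)[] // /pP.
Qed.

Lemma contr_prime q : is_prime (localize A P) q -> is_prime A (meet q A).
Proof.
move=> Hq; have sub : subset_ A (localize A P) by exact: locid_sub.
split; first exact: contr_ideal (prime_ideal Hq).
  by move=> [] /(prime1 Hq).
move=> a b Aa Ab [/(primeM Hq) h _]; case: h => [||qa|qb]; try exact: sub.
  by left; split.
by right; split.
Qed.

Lemma loc_max : maxideal (localize A P) = locid A P P.
Proof.
apply: sub_antisym => z.
  move=> [[a [b [Aa Ab nb e]]] h]; exists a, b; split=> //; apply: contrapT => na; apply: h.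
  exists (b / a); split; first by exists b, a.
  by rewrite e; field; rewrite !notin_neq0.
move=> h; split.
  exact: (idS (locid_ideal PI) h).
move=> [y [[c [d [Ac Ad nd ->]]] e]].
have : locid A P P 1.
  by rewrite -e; apply: (idMr (locid_ideal PI)) => //; exists c, d.
exact: prime1 (locid_prime HP (fun _ => id)).
Qed.

Lemma loc_local : is_local (localize A P).
Proof. by split; [exact: loc_subring|rewrite -/(maxideal _) loc_max; exact: locid_ideal]. Qed.
End OnePrime.

(** Stands for the Artinian property of the module K/I. *)
Definition dcc A I K := forall c : nat -> F -> Prop,
  (forall n, [/\ is_ideal A (c n), subset_ I (c n), subset_ (c n) K & subset_ (c n.+1) (c n)]) ->
  exists n, forall m, (n <= m)%N -> subset_ (c n) (c m).

Lemma desc_le (c : nat -> F -> Prop) : (forall n, subset_ (c n.+1) (c n)) ->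
  forall m n, (m <= n)%N -> subset_ (c n) (c m).
Proof.
move=> cS m; elim=> [|n ih]; first by rewrite leqn0 => /eqP ->.
by rewrite leq_eqVlt => /orP[/eqP ->//|/ih h]; apply: sub_tr h.
Qed.

(** Modular law: a descending chain is constant once its traces on [J] and its sums with [J] are. *)
Lemma dcc_trans A I J K : is_subring A -> is_ideal A I -> is_ideal A J -> is_ideal A K ->
  subset_ I J -> subset_ J K -> dcc A I J -> dcc A J K -> dcc A I K.
Proof.
move=> HA HI HJ HK IJ JK d1 d2 c hc.
have cS n : subset_ (c n.+1) (c n) by have [] := hc n.
have [n1 h1] : exists n, forall m, (n <= m)%N -> subset_ (meet (c n) J) (meet (c m) J).
  apply: d1 => n; have [cI Ic cK cs] := hc n; split.
  - exact: meet_ideal.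
  - by move=> z Iz; split; [exact: Ic|exact: IJ].
  - by move=> z [].
  - by move=> z [/cs ? ?].
have [n2 h2] : exists n, forall m, (n <= m)%N -> subset_ (isum (c n) J) (isum (c m) J).
  apply: d2 => n; have [cI Ic cK cs] := hc n; split.
  - exact: isum_ideal.
  - exact: (isum_r cI).
  - exact: (isum_min HK).
  - by move=> z [a [b [/cs ? ? ->]]]; exists a, b.
exists (maxn n1 n2) => m; rewrite geq_max => /andP[m1 m2] z cz.
have : isum (c m) J z.
  apply: (h2 m m2); apply: (isum_l HJ); exact: (desc_le cS (leq_maxr n1 n2)).
move=> [u [j [cu Jj e]]]; have [cI _ _ _] := hc m; have [c1 _ _ _] := hc n1.
have cmn := desc_le cS m1.
have : meet (c m) J j.
  apply: (h1 m m1); split=> //; have c1z : c n1 z by exact: (desc_le cS (leq_maxl n1 n2)).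
  rewrite (_ : j = z - u); [mem|by rewrite e; ring].
by move=> [cj _]; rewrite e; mem.
Qed.

Lemma dcc_one A I g : is_local A -> is_ideal A I -> A g ->
  (forall r, maxideal A r -> I (r * g)) -> dcc A I (isum I (principal A g)).
Proof.
move=> HL HI Ag hg c hc; have HA := local_sr HL.
have cS n : subset_ (c n.+1) (c n) by have [] := hc n.
case: (EM (forall n, c n g)) => [all|/existsNP[n ng]].
  exists 0%N => m _ z; have [_ _ c0 _] := hc 0%N; have [cI Ic _ _] := hc m.
  by move=> /c0 [i [_ [/Ic ci [r [Ar ->]] ->]]]; have cg := all m; mem.
exists n => m _ z cz; have [_ + _ _] := hc m; apply.
have [cI Ic cK _] := hc n; have [i [_ [Ii [r [Ar ->]] e]]] := cK z cz.
case: (EM (maxideal A r)) => [/hg Ir|nr]; first by rewrite e; mem.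
have [r0 Ar1] := local_unit Ar nr; case: ng.
by rewrite (_ : g = r^-1 * (z - i)); [mem|rewrite e; field].
Qed.

Lemma dcc_span A I gs : is_local A -> is_ideal A I -> (forall g, g \in gs -> A g) ->
  (forall g, g \in gs -> forall r, maxideal A r -> I (r * g)) -> dcc A I (isum I (span A gs)).
Proof.
move=> HL HI hA hg; have HA := local_sr HL.
elim: gs I HI hA hg => [|g l ih] I HI hA hg.
  move=> c hc; exists 0%N => m _ z; have [_ Ic _ _] := hc m; have [_ _ cK _] := hc 0%N.
  by move=> /cK [i [_ [/Ic ci -> ->]]]; rewrite addr0.
have Ag : A g by apply: hA; rewrite mem_head.
have lA y : y \in l -> A y by move=> yl; apply: hA; rewrite in_cons yl orbT.
have Hg := principal_ideal HA Ag.
have Hl := span_ideal HA (ideal_self HA) lA.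
have HS := isum_ideal HI Hg HA.
have e : isum I (span A (g :: l)) = isum (isum I (principal A g)) (span A l).
  apply: sub_antisym => z.
    move=> [i [_ [Ii [c [w [Ac lw ->]]] ->]]]; exists (i + c * g), w; split=> //; last by ring.
    by exists i, (c * g); split=> //; exists c.
  move=> [_ [w [[i [_ [Ii [c [Ac ->]] ->]]] lw ->]]]; exists i, (c * g + w); split=> //; last by ring.
  by exists c, w.
rewrite e; apply: (@dcc_trans A I (isum I (principal A g))) => //.
- exact: isum_ideal.
- exact: (isum_l Hg).
- exact: (isum_l Hl).
- by apply: dcc_one => // r mr; apply: hg; rewrite ?mem_head.
- apply: ih => // y yl r mr; apply: (isum_l Hg); apply: hg => //; rewrite in_cons yl orbT //.
Qed.

(** Each layer m^k/m^(k+1) is a finitely generated vector space over the residue field. *)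
Lemma dcc_pow A k : is_local A -> noetherian A -> dcc A (ideal_pow A (maxideal A) k) A.
Proof.
move=> HL hN; have HA := local_sr HL; have Hm := local_mi HL.
have Hp n := pow_ideal n HA Hm.
have HAA := ideal_self HA.
elim: k => [|k ih].
  rewrite pow0 // => c hc; exists 0%N => m _ z; have [_ _ c0 _] := hc 0%N; have [_ cm _ _] := hc m.
  by move=> /c0/cm.
have [gs [gI e]] := noeth_fg HA hN (Hp k).
have le := pow_le HA Hm (leqnSn k).
apply: dcc_trans ih => //; first by move=> z; apply: idS (Hp k) _.
have -> : ideal_pow A (maxideal A) k = isum (ideal_pow A (maxideal A) k.+1) (span A gs).
  apply: sub_antisym; first by rewrite {1}e; exact: (isum_r (Hp _)).
  by apply: (isum_min (Hp k)) => //; rewrite e.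
apply: dcc_span => // g /gI Ig; first exact: idS (Hp k) _ Ig.
by move=> r mr; rewrite -add1n; apply: pow_mul => //; rewrite pow1.
Qed.

End Localization.

(** * Krull's principal ideal theorem and regular sequences *)

Section Dimension.
Variable F : fieldType.
Implicit Types (A B C I J P Q T N : F -> Prop).

(* Krull's principal ideal theorem in A/p: the saturated powers of Q (symbolic powers) stabilize
   modulo a, because m^k lies in p + aA and the ideals above m^k satisfy the descending chain condition. *)
Lemma pit_local A p Q a : is_local A -> noetherian A -> is_prime A p -> is_prime A Q ->
  subset_ p Q -> strict_sub Q (maxideal A) -> maxideal A a ->
  (forall P, is_prime A P -> subset_ p P -> P a -> P = maxideal A) -> Q = p.
Proof.
move=> HL hN Hp HQ pQ sQ ma hP; have HA := local_sr HL; have Hm := local_mi HL.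
have pI := prime_ideal Hp; have QI := prime_ideal HQ.
have Aa : A a by mem.
have nQa : ~ Q a by move=> Qa; apply: (strict_sub_ne sQ); apply: hP.
have Hpa := principal_ideal HA Aa.
have HJ := isum_ideal pI Hpa HA.
have [k hk] : exists k, subset_ (ideal_pow A (maxideal A) k) (isum p (principal A a)).
  apply: pow_sub => // P HP sP; rewrite (hP P) //.
    by move=> z pz; apply: sP; apply: (isum_l Hpa).
  by apply: sP; apply: (isum_r pI); apply: principal_self.
have Hpow n := pow_ideal n HA QI.
have HpQ n := isum_ideal pI (Hpow n) HA.
pose Qs n z := A z /\ exists s, [/\ A s, ~ Q s & isum p (ideal_pow A Q n) (s * z)].
have HQs n : is_ideal A (Qs n).
  have Hn := HpQ n; split.
  - by move=> z [].
  - by split; [mem|exists 1; split; [mem|exact: prime1 HQ|rewrite mulr0; mem]].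
  - move=> x y [Ax [s [As ns sx]]] [Ay [t [At nt ty]]]; split; first by mem.
    exists (s * t); split; [mem|exact: (primeMN HQ)|].
    by rewrite (_ : _ * _ = t * (s * x) + s * (t * y)); [mem|ring].
  - move=> r x Ar [Ax [s [As ns sx]]]; split; first by mem.
    by exists s; split=> //; rewrite mulrCA; mem.
have pQs n : subset_ p (Qs n).
  move=> z pz; split; first by mem.
  exists 1; rewrite mul1r; split; [mem|exact: prime1 HQ|exact: (isum_l (Hpow n))].
have dQs n : subset_ (Qs n.+1) (Qs n).
  move=> z [Az [s [As ns [u [v [pu Qv e]]]]]]; split=> //; exists s; split=> //.
  by exists u, v; split=> //; apply: (pow_le HA QI (leqnSn n)).
have [n hn] : exists n, forall m, (n <= m)%N ->
    subset_ (isum (Qs n) (principal A a)) (isum (Qs m) (principal A a)).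
  apply: ((@dcc_pow _ A k HL hN) (fun n => isum (Qs n) (principal A a))) => n; have Hs := isum_ideal (HQs n) Hpa HA; split=> //.
  - apply: sub_tr hk _; apply: (isum_min Hs).
      by move=> z pz; apply: (isum_l Hpa); apply: pQs.
    exact: (isum_r (HQs n)).
  - by move=> z; apply: idS Hs _.
  - move=> z [u [v [Qu av ->]]]; exists u, v; split=> //; exact: dQs.
(* Here z = w + ra with w in [Qs n.+1], and ra in [Qs n] gives r in [Qs n] because a is outside Q.
   So [Qs n] lies in a [Qs n] + [Qs n.+1], and Nakayama applies. *)
have sQs : subset_ (Qs n) (Qs n.+1).
  apply: (nak_principal HL hN (HQs _) (HQs _) ma) => z Qz.
  have [w [_ [Qw [r [Ar ->]] e]]] := hn n.+1 (leqnSn n) z (isum_l Hpa Qz).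
  exists r; split; last by rewrite (_ : _ - _ = w) // e; ring.
  have Hn := HQs n; have Qw' := dQs _ _ Qw.
  have : Qs n (r * a) by rewrite (_ : r * a = z - w); [mem|rewrite e; ring].
  move=> [_ [s [As ns sx]]]; split=> //; exists (s * a); split; [mem|exact: (primeMN HQ)|].
  by rewrite -mulrA [a * r]mulrC.
have [gs [gQ e]] := noeth_fg HA hN (Hpow n).
have gA g : g \in gs -> A g by move=> /gQ ?; have Hn := Hpow n; mem.
have Hsp : is_ideal A (span Q gs) by apply: span_ideal.
(* Locally at Q, the equality of symbolic powers puts Q^n inside p + Q Q^n, and Nakayama puts it
   inside p. *)
have kill w : ideal_pow A Q n w -> exists s, [/\ A s, ~ Q s & p (s * w)].
  rewrite e; apply: nakayama => // g gg; split; first exact: gA.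
  have [|_ [s [As ns [u [v [pu Qv eu]]]]]] := sQs g.
    split; first exact: gA.
    exists 1; rewrite mul1r; split; [mem|exact: prime1 HQ|apply: (isum_r pI); exact: gQ].
  exists s; split=> //; exists v, u; split=> //; last by rewrite eu addrC.
  move: v Qv {eu}; apply: pow_min => // -[|q l] // [zl] hl; rewrite big_cons.
  have Qq : Q q by apply: hl; rewrite mem_head.
  have : span A gs (\prod_(t <- l) t).
    by rewrite -e -zl; apply: pow_gen => t tl; apply: hl; rewrite in_cons tl orbT.
  elim: (gs) (\prod_(t <- l) t) => [|g' l' ih] x /=; first by move=> ->; rewrite mulr0.
  move=> [c [v [Ac lv ->]]]; exists (q * c), (q * v); split; [mem|exact: ih|by ring].
apply: sub_antisym => // q Qq; have [s [As ns]] := kill (q ^+ n) (powX Qq).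
have Aq : A q by mem.
have Aqn : A (q ^+ n) by mem.
move=> /(primeM Hp As Aqn)[/pQ /ns //|/(primeX Hp HA Aq) //].
Qed.

(** Otherwise P would be minimal over p and y, and the local case, applied in the localization at P,
    would collapse p' to p. *)
Lemma pit A p p' P y : is_subring A -> noetherian A -> is_prime A p -> is_prime A p' ->
  is_prime A P -> strict_sub p p' -> strict_sub p' P -> P y ->
  exists Q, [/\ is_prime A Q, subset_ p Q, strict_sub Q P & Q y].
Proof.
move=> HA hN Hp Hp' HP s1 s2 Py; apply: contrapT => nQ.
have PI := prime_ideal HP.
have pP' := s2.1; have pP := sub_tr s1.1 s2.1.
have Lp := locid_prime HA HP Hp pP; have Lp' := locid_prime HA HP Hp' pP'.
have LL := loc_local HA HP; have LN := loc_noeth HA HP hN.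
have sub : subset_ A (localize A P) := @locid_sub _ _ _ HA HP A.
have Ay : A y by mem.
have e : locid A P p' = locid A P p.
  apply: (pit_local LL LN Lp Lp' (a := y)).
  - by move=> z [a [b [/s1.1 ? ? ? ?]]]; exists a, b.
  - rewrite loc_max //; split; first by move=> z [a [b [/pP' ? ? ? ?]]]; exists a, b.
    have [z [Pz nz]] := s2.2; exists z; split; first exact: locid_sub.
    by move=> /(locid_mem HP Hp' pP' (idS PI Pz))/nz.
  - by rewrite loc_max //; apply: locid_sub.
  - move=> R HR sR Ry; have HC := contr_prime HA HP HR.
    have RI := prime_ideal HR.
    rewrite loc_max // -(locid_contr HA HP RI); congr locid.
    apply: contrapT => ne; apply: nQ; exists (meet R A); split=> //.
      move=> z pz; have Az := idS (prime_ideal Hp) pz.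
      by split=> //; apply: sR; apply: locid_sub.
    apply: strict_subP => // z [Rz Az].
    have := prime_submax HR Rz; rewrite loc_max // => h.
    exact: (locid_mem HP HP (fun _ => id) Az).
have [z [pz nz]] := s1.2; apply: nz.
have Az := idS (prime_ideal Hp') pz.
apply: (locid_mem HP Hp pP Az); rewrite -e; exact: locid_sub.
Qed.

(** Chains listed above a base prime [p], itself not in the list; links of a list are easier to
    replace or append than those of [prime_chain]. *)
Fixpoint pchain A p (l : seq (F -> Prop)) :=
  if l is q :: l' then [/\ strict_sub p q, is_prime A q & pchain A q l'] else True.

Lemma pchain_rcons A p l q : pchain A p (rcons l q) <->
  [/\ pchain A p l, is_prime A q & strict_sub (last p l) q].
Proof.
elim: l p => [|r l ih] p /=; first by split=> [[]|[]].
split; first by move=> [? ? /ih[]].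
by move=> [[? ? ?] ? ?]; split=> //; apply/ih.
Qed.

Lemma pchain_prime A p l : is_prime A p -> pchain A p l -> is_prime A (last p l).
Proof. by elim: l p => [|q l ih] p //= _ [_ Hq /(ih _ Hq)]. Qed.

Lemma pchain_last_sub A p l : pchain A p l -> subset_ p (last p l).
Proof.
elim: l p => [|q l ih] p /=; first by move=> _ z.
by move=> [s _ /ih h]; exact: sub_tr s.1 h.
Qed.

(** From the top down, [pit] replaces the prime just below one containing y by another prime that
    contains y, until y lies in the first prime above p. *)
Lemma pchain_shift A p l y : is_subring A -> noetherian A -> is_prime A p ->
  pchain A p l -> last p l y -> ~ p y ->
  exists q l', [/\ pchain A p (q :: l'), size (q :: l') = size l, last p (q :: l') = last p l & q y].
Proof.
move=> HA hN Hp; move: {2}(size l) (leqnn (size l)) => n; elim: n l => [|n ih] l.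
  by case: l => // _ _ /= py /(_ py).
case/lastP: l => [|l P]; first by move=> _ _ /= py /(_ py).
case/lastP: l => [|l P'].
  by move=> _ /= [s HP _] Py npy; exists P, [::].
rewrite !size_rcons !ltnS => zl /pchain_rcons[/pchain_rcons[cl HP' sP'] HP].
rewrite !last_rcons => sP Py npy.
have [R [HR cR sR Ry]] : exists R, [/\ is_prime A R, pchain A p (rcons l R), strict_sub R P & R y].
  have Hl := pchain_prime Hp cl.
  case: (EM (P' y)) => [P'y|nP'y].
    by exists P'; split=> //; apply/pchain_rcons.
  have [R [HR lR sR Ry]] := pit HA hN Hl HP' HP sP' sP Py.
  exists R; split=> //; apply/pchain_rcons; split=> //.
  have nly : ~ last p l y by move=> /sP'.1.
  by split=> //; exists y.
have [||//|q [l' [c1 z1 e1 qy]]] := ih (rcons l R) _ cR; rewrite ?size_rcons ?last_rcons //.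
exists q, (rcons l' P); rewrite -rcons_cons; split=> //.
- by apply/pchain_rcons; split=> //; rewrite e1 last_rcons.
- by rewrite size_rcons z1 size_rcons.
- by rewrite last_rcons.
Qed.

Lemma chain_pchain A c n : prime_chain A c n -> exists l,
  [/\ size l = n, pchain A (c 0%N) l & last (c 0%N) l = c n].
Proof.
elim: n c => [|n ih] c [h1 h2]; first by exists [::].
have [|l [zl cl el]] := ih (fun i => c i.+1).
  by split=> i h; [apply: h1|apply: h2].
exists (c 1%N :: l); split=> //=; first by rewrite zl.
by split=> //; [apply: h2|apply: h1].
Qed.

Lemma pchain_chain A p l : is_prime A p -> pchain A p l ->
  exists c, [/\ prime_chain A c (size l), c 0%N = p & c (size l) = last p l].
Proof.
elim: l p => [|q l ih] p Hp /=.
  by move=> _; exists (fun=> p); split=> //; split=> // i; rewrite leqn0 => /eqP ->.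
move=> [s Hq /(ih _ Hq)[c [[h1 h2] c0 cl]]].
exists (fun i => if i is j.+1 then c j else p); split=> //; split=> -[|i] //.
- exact: h1.
- by move=> _; rewrite c0.
- exact: h2.
Qed.

(** One induction shows that a regular local ring modulo an initial segment of parameters is a
    domain and that the parameters form a regular sequence. Some generator y lies outside p; it is
    moved into the first link q of the chain, and the induction for I + yA gives I + yA = q. An
    element u + ry of p then has r in p, so p lies in I + yp, and Nakayama gives I = p. The
    generators are permuted because y is only found along the way. *)
Lemma regular_seq A p l I ys : is_local A -> noetherian A -> is_prime A p -> pchain A p l ->
  last p l = maxideal A -> is_ideal A I -> subset_ I p -> size ys = size l ->
  maxideal A = isum I (span A ys) -> (forall y, y \in ys -> A y) ->
  I = p /\ exists ys', perm_eq ys ys' /\ 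
    forall j, (j < size ys)%N ->
      is_prime A (isum I (span A (take j ys'))) /\ ~ isum I (span A (take j ys')) (nth 0 ys' j).
Proof.
move=> HL hN; have HA := local_sr HL.
move: {2}(size l) (erefl (size l)) => n; elim: n l p I ys => [|n ih] l p I ys.
  move=> /size0nil -> Hp _ /= ep HI Ip /size0nil -> e _; split.
    apply: sub_antisym => //; rewrite ep e => z [u [_ [Iu -> ->]]].
    by rewrite addr0.
  by exists [::].
move=> zl Hp cl el HI Ip zy e yA.
have pI := prime_ideal Hp.
have ym y : y \in ys -> maxideal A y.
  by move=> yy; rewrite e; apply: (isum_r HI); apply: span_gen.
have [y yys npy] : exists2 y, y \in ys & ~ p y.
  apply: contrapT => h.
  have sub : subset_ (maxideal A) p.
    rewrite e; apply: (isum_min pI) => //; apply: (span_min pI) => // y yy.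
    by apply: contrapT => ny; apply: h; exists y.
  case: l zl cl el {zy} => //= q l _ [s Hq cl] el.
  have [z [qz nz]] := s.2; apply/nz/sub; rewrite -el; exact: (pchain_last_sub cl).
have Ay := yA y yys.
have := @pchain_shift A p l y HA hN Hp cl; rewrite el => /(_ (ym _ yys) npy).
move=> [q [l' [[spq Hq cl'] /= z' el' qy]]].
have Hpr := principal_ideal HA Ay.
pose I' := isum I (principal A y).
have HI' : is_ideal A I' by exact: isum_ideal.
have remA x : x \in rem y ys -> A x by move=> /mem_rem/yA.
have Hrem := span_ideal HA (ideal_self HA) remA.
have Hys := span_ideal HA (ideal_self HA) yA.
have eI' : maxideal A = isum I' (span A (rem y ys)).
  apply: sub_antisym; rewrite e.
    apply: (isum_min (isum_ideal HI' Hrem HA)).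
      by move=> z Iz; apply: (isum_l Hrem); apply: (isum_l Hpr).
    apply: (span_min (isum_ideal HI' Hrem HA)) => // x xy.
    case: (eqVneq x y) => [->|ne].
      by apply: (isum_l Hrem); apply: (isum_r HI); apply: principal_self.
    apply: (isum_r HI'); apply: span_gen => //.
    have : x \in y :: rem y ys by rewrite -(perm_mem (perm_to_rem yys)).
    by rewrite in_cons (negbTE ne).
  apply: (isum_min (isum_ideal HI Hys HA)).
    apply: (isum_min (isum_ideal HI Hys HA)); first exact: (isum_l Hys).
    by apply: (principal_min (isum_ideal HI Hys HA)); apply: (isum_r HI); apply: span_gen.
  apply: (span_min (isum_ideal HI Hys HA)) => // x xy.
  by apply: (isum_r HI); apply: span_gen => //; exact: mem_rem xy.
have [| | |E [ys' [py hy]]] := ih l' q I' (rem y ys) _ Hq cl' el' HI' _ _ eI' remA.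
- by move: z'; rewrite zl => -[].
- apply: (isum_min (prime_ideal Hq)); first exact: sub_tr Ip spq.1.
  exact: (principal_min (prime_ideal Hq)).
- by rewrite size_rem // zy zl; move: z'; rewrite zl => -[->].
have eI : I = p.
  apply: sub_antisym => //; apply: (nak_principal HL hN pI HI (ym _ yys)) => z pz.
  have : I' z by rewrite E; exact: spq.1.
  move=> [u [_ [Iu [r [Ar ->]] ez]]]; exists r; split.
    have : p (r * y) by rewrite (_ : r * y = z - u); [mem|rewrite ez; ring].
    by move=> /(primeM Hp Ar Ay)[].
  by rewrite (_ : _ - _ = u) // ez; ring.
split=> //; exists (y :: ys'); split.
  by rewrite (perm_trans (perm_to_rem yys)) // perm_cons.
have aux s : isum I (span A (y :: s)) = isum I' (span A s).
  apply: sub_antisym => z.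
    move=> [i [_ [Ii [c [w [Ac lw ->]]] ->]]]; exists (i + c * y), w; split=> //; last by ring.
    by exists i, (c * y); split=> //; exists c.
  move=> [_ [w [[i [_ [Ii [c [Ac ->]] ->]]] lw ->]]]; exists i, (c * y + w); split=> //; last by ring.
  by exists c, w.
move=> [|j] hj /=.
  have -> : isum I (fun z => z = 0) = I.
    by apply: sub_antisym => z; [move=> [u [_ [Iu -> ->]]]; rewrite addr0|move=> Iz; exists z, 0; rewrite addr0].
  by rewrite eI; split.
rewrite -/(span A (y :: take j ys')) aux; apply: hy.
by rewrite size_rem // -ltnS prednK //; move: hj; case: (size ys).
Qed.

End Dimension.

(** * Regular local rings are completely integrally closed *)

Section Normality.
Variable F : fieldType.
Implicit Types (A B C I J P Q T N L : F -> Prop).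

(** A chain of maximal length cannot be prolonged at either end. *)
Lemma dim_pchain A d : is_local A -> krull_dim A d ->
  exists l, [/\ pchain A (fun z => z = 0) l, size l = d & last (fun z => z = 0) l = maxideal A].
Proof.
move=> HL [[c hc] hmax]; have HA := local_sr HL; have H0 := prime_zero HA.
have [l [zl cl el]] := chain_pchain hc.
have Hc0 : is_prime A (c 0%N) by case: hc => h _; apply: h.
have bound p l' : is_prime A p -> pchain A p l' -> (size l' <= d)%N.
  by move=> Hp /(pchain_chain Hp)[c' [h _ _]]; exact: hmax h.
have e0 : (fun z => z = 0) = c 0%N.
  apply: contrapT => ne; have := bound _ (c 0%N :: l) H0.
  rewrite /= zl ltnn => h; apply: notF; apply: h; split=> //; apply: strict_subP => // z ->.
  exact: id0 (prime_ideal Hc0).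
have em : last (c 0%N) l = maxideal A.
  have HP := pchain_prime Hc0 cl.
  apply: contrapT => ne; have := bound _ (rcons l (maxideal A)) Hc0.
  rewrite size_rcons zl ltnn => h; apply: notF; apply: h; apply/pchain_rcons; split=> //.
    exact: max_prime.
  by apply: strict_subP => //; exact: prime_submax.
by exists l; rewrite e0.
Qed.

Lemma span_perm A s s' : is_subring A -> (forall g, g \in s -> A g) -> perm_eq s s' -> span A s = span A s'.
Proof.
move=> HA sA ps.
have sA' : forall g, g \in s' -> A g by move=> g; rewrite -(perm_mem ps); exact: sA.
have H1 := span_ideal HA (ideal_self HA) sA; have H2 := span_ideal HA (ideal_self HA) sA'.
apply: sub_antisym.
  by apply: (span_min H2) => // g gs; apply: span_gen; rewrite -?(perm_mem ps).
by apply: (span_min H1) => // g gs; apply: span_gen; rewrite ?(perm_mem ps).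
Qed.

(** Steinitz exchange over the residue field: some coefficient of w is a unit. *)
Lemma span_exchange A l w : is_local A -> (forall g, g \in l -> A g) -> span A l w ->
  ~ span (maxideal A) l w -> exists g l', perm_eq l (g :: l') /\ span A (w :: l') g.
Proof.
move=> HL; have HA := local_sr HL.
elim: l w => [|h l ih] w hA //=.
move=> [c [v [Ac lv e]]] nw.
have Ah : A h by apply: hA; rewrite mem_head.
have lA y : y \in l -> A y by move=> yl; apply: hA; rewrite in_cons yl orbT.
have Hl := span_ideal HA (ideal_self HA) lA.
case: (EM (maxideal A c)) => [mc|nc].
  have [|g [l' [pl [a [b [Aa lb eg]]]]]] := ih v lA lv.
    by move=> mv; apply: nw; exists c, v.
  exists g, (h :: l'); split.
    by rewrite -[g :: _]/([:: g] ++ [:: h] ++ l') perm_sym perm_catCA /= perm_sym perm_cons.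
  exists a, (- (a * c) * h + b); have Ac' : A c by mem.
  split=> //; last by rewrite eg e; ring.
  by exists (- (a * c)), b; split=> //; mem.
have [c0 Ac1] := local_unit Ac nc.
exists h, l; split=> //; exists c^-1, (- c^-1 * v); split=> //; first by mem.
by rewrite e; field.
Qed.

(** A regular system of parameters, in an order for which the third clause holds; inductions modulo
    initial segments rely on that clause. *)
Definition rsop A (s : seq F) := [/\ forall g, g \in s -> A g, maxideal A = span A s &
  forall j, (j < size s)%N -> is_prime A (span A (take j s)) /\ ~ span A (take j s) s`_j].

Lemma zero_isum A s : isum (fun z => z = 0) (span A s) = span A s.
Proof.
apply: sub_antisym => z; first by move=> [_ [v [-> ? ->]]]; rewrite add0r.
by exists 0, z; rewrite add0r.
Qed.

Lemma gens_rsop A d s : is_local A -> noetherian A -> krull_dim A d ->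
  (forall g, g \in s -> A g) -> size s = d -> maxideal A = span A s ->
  exists s', perm_eq s s' /\ rsop A s'.
Proof.
move=> HL hN hd sA zs es; have HA := local_sr HL; have H0 := prime_zero HA.
have [l [cl zl el]] := dim_pchain HL hd.
have [|||||_ [s' [ps hs]]] := @regular_seq F A _ l (fun z => z = 0) s HL hN H0 cl el; rewrite ?zl ?zero_isum //.
  exact: ideal_zero.
exists s'; split=> //; split.
- by move=> g; rewrite -(perm_mem ps); exact: sA.
- by rewrite es; exact: span_perm.
- by move=> j; rewrite -(perm_size ps) => /hs; rewrite zero_isum.
Qed.

Lemma regular_rsop A : regular_local A -> exists s, rsop A s /\ exists2 d, krull_dim A d & size s = d.
Proof.
move=> [HL hN [d [hd [s [zs [sA /pred_ext es]]]]]].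
rewrite (ideal_gen_span (local_sr HL)) // in es.
have [s' [ps hs]] := gens_rsop HL hN hd sA zs es.
by exists s'; split=> //; exists d => //; rewrite -(perm_size ps).
Qed.

(** By exchange x replaces one of the generators without changing their number. The reordering that
    follows may move x, so only membership is recorded. *)
Lemma regular_rsop_in A x : regular_local A -> maxideal A x -> ~ ideal_pow A (maxideal A) 2 x ->
  exists s, rsop A s /\ x \in s.
Proof.
move=> HR mx nx; have [HL hN _] := HR; have HA := local_sr HL; have Hm := local_mi HL.
have [s [[sA es _] [d hd zs]]] := regular_rsop HR.
have Hp2 := pow_ideal 2 HA Hm.
have [||g [l [pl gl]]] := @span_exchange A s x HL sA; first by rewrite -es.
  move=> h; apply: nx; move: h.
  have ms : forall g, g \in s -> maxideal A g by rewrite es => g; apply: span_gen.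
  elim: (s) (x) ms => [|g l ih] y ms /=; first by move=> ->; mem.
  move=> [c [v [mc lv ->]]]; apply: (idD Hp2).
    by rewrite -[2%N]/(1 + 1)%N; apply: pow_mul => //; rewrite pow1 //; apply: ms; rewrite mem_head.
  by apply: ih => // z zl; apply: ms; rewrite in_cons zl orbT.
have lA y : y \in l -> A y by move=> yl; apply: sA; rewrite (perm_mem pl) in_cons yl orbT.
have Ax : A x by mem.
have xlA y : y \in x :: l -> A y by rewrite in_cons => /orP[/eqP ->|/lA].
have H1 := span_ideal HA (ideal_self HA) xlA.
have ex : maxideal A = span A (x :: l).
  apply: sub_antisym.
    rewrite es; apply: (span_min H1) => // y; rewrite (perm_mem pl) in_cons => /orP[/eqP -> //|yl].
    by apply: span_gen => //; rewrite in_cons yl orbT.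
  apply: (span_min Hm) => // y; rewrite in_cons => /orP[/eqP -> //|yl].
  by rewrite es; apply: span_gen => //; rewrite (perm_mem pl) in_cons yl orbT.
have [|s' [ps' hs']] := gens_rsop HL hN hd xlA _ ex; first by rewrite -zs (perm_size pl).
by exists s'; split=> //; rewrite -(perm_mem ps') mem_head.
Qed.

Definition mdvd A I b a := exists r, A r /\ I (a - r * b).

(* Complete integral closedness of A/I, with fractions cleared. *)
Definition cicl A I := forall a b c, A a -> A b -> A c -> ~ I b -> ~ I c ->
  (forall n, mdvd A I (b ^+ n) (c * a ^+ n)) -> mdvd A I b a.

Section CicStep.
Variables (A I : F -> Prop) (x : F).
Hypotheses (HL : is_local A) (hN : noetherian A) (HI : is_prime A I) (mx : maxideal A x) (nx : ~ I x).
Let I' := isum I (principal A x).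
Hypotheses (HI' : is_prime A I') (ci : cicl A I').
Let HA := local_sr HL.
Let Ax : A x. Proof. by have := local_mi HL => Hm; mem. Qed.
Let II := prime_ideal HI.

Let I'P z : A z -> I' z <-> mdvd A I x z.
Proof.
move=> Az; split.
  by move=> [i [_ [Ii [r [Ar ->]] ->]]]; exists r; split=> //; rewrite addrK.
by move=> [r [Ar Ir]]; exists (z - r * x), (r * x); split=> //; [exists r|ring].
Qed.

Let sI : subset_ I I'. Proof. by apply: (isum_l (principal_ideal HA Ax)). Qed.
Let I'x : I' x. Proof. by apply: (isum_r II); exact: principal_self. Qed.

Let cancel n r : A r -> I (x ^+ n * r) -> I r.
Proof.
move=> Ar; have Axn : A (x ^+ n) by mem.
by move=> /(primeM HI Axn Ar)[/(primeX HI HA Ax)|].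
Qed.

(** By Krull's theorem modulo I, an element divisible by all powers of x lies in I. *)
Let order b : A b -> ~ I b -> exists e b', [/\ A b', ~ I' b' & I (b - x ^+ e * b')].
Proof.
move=> Ab nb; apply: contrapT => h; apply: nb; apply: (krull HL hN II) => n.
suff [r [Ar Ir]] : exists r, A r /\ I (b - x ^+ n * r).
  exists (b - x ^+ n * r), (x ^+ n * r); split=> //; last by ring.
  have Hm := local_mi HL; have Hp := pow_ideal n HA Hm; have hp : ideal_pow A (maxideal A) n (x ^+ n) by exact: powX.
  mem.
elim: n => [|n [r [Ar Ir]]]; first by exists b; split=> //; rewrite expr0 mul1r subrr; mem.
have : I' r by apply: contrapT => nr; apply: h; exists n, r.
move=> /(I'P Ar)[q [Aq Iq]]; exists q; split=> //.
rewrite (_ : _ - _ = (b - x ^+ n * r) + x ^+ n * (r - q * x)); last by rewrite exprS; ring.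
have Axn : A (x ^+ n) by mem.
mem.
Qed.

Let divx f b r u : A b -> A r -> A u -> ~ I' b -> I (b * r - x ^+ f * u) ->
  exists r', A r' /\ I (r - x ^+ f * r').
Proof.
move=> Ab Ar Au nb; case: f => [|f] h.
  by exists r; split=> //; rewrite expr0 mul1r subrr; mem.
elim: f u r Au Ar h => [|f ih] u r Au Ar h.
  have : I' (b * r).
    rewrite (_ : b * r = (b * r - x ^+ 1 * u) + u * x); last by rewrite expr1; ring.
    by have := sI h => ?; mem.
  move=> /(primeM HI' Ab Ar)[//|/(I'P Ar)[q [Aq Iq]]].
  by exists q; split=> //; rewrite expr1 mulrC.
have [|||r' [Ar' Ir']] := ih (x * u) r; [mem|by []|by move: h; rewrite exprSr mulrA|].
have Axf : A (x ^+ f.+1) by mem.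
have : I (x ^+ f.+1 * (b * r' - x * u)).
  rewrite (_ : _ * _ = (b * r - x ^+ f.+2 * u) - b * (r - x ^+ f.+1 * r')); last by rewrite [x ^+ f.+2]exprSr; ring.
  mem.
move=> /cancel h'; have {}h' : I (b * r' - x * u) by apply: h'; mem.
have : I' (b * r').
  rewrite (_ : b * r' = (b * r' - x * u) + u * x); last by ring.
  by have := sI h' => ?; mem.
move=> /(primeM HI' Ab Ar')[//|/(I'P Ar')[q [Aq Iq]]].
exists q; split=> //.
rewrite (_ : _ - _ = (r - x ^+ f.+1 * r') + x ^+ f.+1 * (r' - q * x)); last by rewrite [x ^+ f.+2]exprSr; ring.
mem.
Qed.

Let mdvd_ideal b : A b -> is_ideal A (fun a => A a /\ mdvd A I b a).
Proof.
move=> Ab; split.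
- by move=> z [].
- by split; [mem|exists 0; split; [mem|rewrite mul0r subrr; mem]].
- move=> u v [Au [r [Ar Ir]]] [Av [s [As Is]]]; split; first by mem.
  exists (r + s); split; first by mem.
  by rewrite (_ : _ - _ = (u - r * b) + (v - s * b)); [mem|ring].
- move=> w u Aw [Au [r [Ar Ir]]]; split; first by mem.
  exists (w * r); split; first by mem.
  by rewrite (_ : _ - _ = w * (u - r * b)); [mem|ring].
Qed.

(** A quotient of a by b is found modulo x^N for every N, and Krull's theorem for bA + I removes
    x^N. In one step, closedness modulo I' gives a - rb = a'x modulo I. Expanding (a - rb)^n shows
    that b^n divides c (a'x)^n; as b is outside the prime I', x^n cancels, and a' satisfies the
    hypothesis again. *)
Let reduced a b c : A a -> A b -> A c -> ~ I' b -> ~ I' c ->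
  (forall n, mdvd A I (b ^+ n) (c * a ^+ n)) -> mdvd A I b a.
Proof.
move=> Aa Ab Ac nb nc h.
have Hb := mdvd_ideal Ab.
suff key (N : nat) : exists u r, [/\ A u, A r & I (a - r * b - x ^+ N * u)].
  suff [] : A a /\ mdvd A I b a by [].
  apply: (krull HL hN Hb) => n; have [u [r [Au Ar Iu]]] := key n.
  have Axn : A (x ^+ n) by mem.
  exists (a - x ^+ n * u), (x ^+ n * u); split; last by ring.
    split; first by mem.
    by exists r; split=> //; rewrite (_ : _ - _ = a - r * b - x ^+ n * u) //; ring.
  have Hm := local_mi HL; have Hp := pow_ideal n HA Hm; have hp : ideal_pow A (maxideal A) n (x ^+ n) by exact: powX.
  mem.
elim: N a Aa h => [|N ih] a Aa h.
  by exists a, 0; split=> //; [mem|rewrite mul0r subr0 expr0 mul1r subrr; mem].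
have [r [Ar]] : mdvd A I' b a.
  by apply: ci Aa Ab Ac nb nc _ => n; have [r [Ar /sI Ir]] := h n; exists r.
have Aab : A (a - r * b) by mem.
move=> /(I'P Aab)[a' [Aa' Ia']].
have [n|u [s [Au As Iu]]] := ih a' Aa'; last first.
  exists u, (r + s * x); split=> //; first by mem.
  rewrite (_ : _ - _ = (a - r * b - a' * x) + x * (a' - s * b - x ^+ N * u)); last by rewrite exprS; ring.
  mem.
have Abn : A (b ^+ n) by mem.
have [_ [q [Aq Iq]]] : A (c * (a - r * b) ^+ n) /\ mdvd A I (b ^+ n) (c * (a - r * b) ^+ n).
  rewrite exprBn mulr_sumr; apply: (id_sum (mdvd_ideal Abn)) => i _.
  have Abi : A (b ^+ i) by mem.
  have Aan : A (a ^+ (n - i)) by mem.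
  have [q [Aq Iq]] := h (n - i)%N.
  have As : A ((-1) ^+ i * r ^+ i) by mem.
  have At : A ((-1) ^+ i * r ^+ i * b ^+ i) by mem.
  have Hbn := mdvd_ideal Abn.
  rewrite mulrnAr -mulr_natl; apply: (idMl Hbn).
    mem.
  split; first by rewrite exprMn; mem.
  exists (q * ((-1) ^+ i * r ^+ i)); split; first by mem.
  have -> : b ^+ n = b ^+ (n - i) * b ^+ i by rewrite -exprD subnK // -ltnS.
  rewrite exprMn (_ : _ - _ = (c * a ^+ (n - i) - q * b ^+ (n - i)) * ((-1) ^+ i * r ^+ i * b ^+ i)); last by ring.
  mem.
have Axn : A (x ^+ n) by mem.
have Aan : A (a' ^+ n) by mem.
have Ixn : I (c * (a - r * b) ^+ n - c * (a' * x) ^+ n).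
  rewrite -mulrBr subrXX mulrCA; apply: (idMr II) => //.
  by apply: (srM HA) => //; apply: (sr_sum HA) => i _; mem.
have Ie : I (b ^+ n * q - x ^+ n * (c * a' ^+ n)).
  rewrite (_ : _ - _ = (c * (a - r * b) ^+ n - c * (a' * x) ^+ n) - (c * (a - r * b) ^+ n - q * b ^+ n)).
    mem.
  by rewrite [(a' * x) ^+ n]exprMn; ring.
have nbn : ~ I' (b ^+ n) by apply: (primeXN HI' HA).
have [|||r' [Ar' Ir']] := @divx n (b ^+ n) q (c * a' ^+ n) _ _ _ nbn Ie; try by mem.
exists r'; split=> //; apply: (@cancel n); first by mem.
rewrite (_ : _ * _ = b ^+ n * (q - x ^+ n * r') - (b ^+ n * q - x ^+ n * (c * a' ^+ n))); last by ring.
mem.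
Qed.

(** Modulo I write a = x^g a', b = x^e b', c = x^f c' with a', b', c' outside I'. The divisibilities
    for all n force e <= g, and [reduced] applies to x^(g-e) a', b', c'. *)
Lemma cic_step : cicl A I.
Proof.
move=> a b c Aa Ab Ac nb nc h.
case: (EM (I a)) => [Ia|na]; first by exists 0; split; [mem|rewrite mul0r subr0].
have [e [b' [Ab' nb' eb]]] := order Ab nb.
have [f [c' [Ac' nc' ec]]] := order Ac nc.
have [g [a' [Aa' na' ea]]] := order Aa na.
have powm u v n : A u -> A v -> I (u - v) -> I (u ^+ n - v ^+ n).
  move=> Au Av Iuv; rewrite subrXX; apply: (idMr II) => //.
  by apply: (sr_sum HA) => i _; mem.
have red n : exists r, A r /\ I (x ^+ (f + g * n) * (c' * a' ^+ n) - x ^+ (e * n) * (b' ^+ n * r)).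
  have [r [Ar Ir]] := h n; exists r; split=> //.
  have Axe : A (x ^+ e) by mem.
  have Axf : A (x ^+ f) by mem.
  have Axg : A (x ^+ g) by mem.
  have Ia : I (a ^+ n - (x ^+ g * a') ^+ n) by apply: powm => //; mem.
  have Ib : I (b ^+ n - (x ^+ e * b') ^+ n) by apply: powm => //; mem.
  have Acf : A (x ^+ f * c') by mem.
  have Aan : A (a ^+ n) by mem.
  rewrite exprD !exprM (_ : _ - _ = (c * a ^+ n - r * b ^+ n) - (c - x ^+ f * c') * a ^+ n
     - (x ^+ f * c') * (a ^+ n - (x ^+ g * a') ^+ n) + r * (b ^+ n - (x ^+ e * b') ^+ n)).
    mem.
  by rewrite !exprMn; ring.
have [leg|ltg] := leqP e g; last first.
  (* For g < e the exponent n = f + 1 is large enough to make e n exceed f + g n, so that x would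
     divide c' a'^n modulo I. *)
  have [r [Ar H]] := red f.+1; case: nc'.
  have [k ek] : exists k, (e * f.+1 = f + g * f.+1 + k.+1)%N.
    exists (e * f.+1 - (f + g * f.+1).+1)%N.
    have : (g.+1 * f.+1 <= e * f.+1)%N by rewrite leq_mul2r ltg orbT.
    rewrite mulSn; lia.
  have Acn : A (c' * a' ^+ f.+1) by mem.
  move: H; rewrite ek [x ^+ (_ + k.+1)]exprD => H.
  have : I (c' * a' ^+ f.+1 - x ^+ k.+1 * (b' ^+ f.+1 * r)).
    apply: (@cancel (f + g * f.+1)); first by mem.
    by apply: (eq_ind _ I H); ring.
  move=> /sI Ih; have : I' (c' * a' ^+ f.+1).
    rewrite (_ : c' * _ = (c' * a' ^+ f.+1 - x ^+ k.+1 * (b' ^+ f.+1 * r)) + x * (x ^+ k * (b' ^+ f.+1 * r))); last by rewrite [x ^+ k.+1]exprS; ring.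
    have At : A (x ^+ k * (b' ^+ f.+1 * r)) by mem.
    mem.
  have Aan : A (a' ^+ f.+1) by mem.
  by move=> /(primeM HI' Ac' Aan)[//|/(primeX HI' HA Aa')].
have [||r [Ar Ir]] := @reduced (x ^+ (g - e) * a') b' c' _ Ab' Ac' nb' nc'; [by mem| |].
  move=> n; have [r [Ar Ir]] := red n.
  have Abn : A (b' ^+ n) by mem.
  have Aan : A (a' ^+ n) by mem.
  have nbn : ~ I' (b' ^+ n) by apply: (primeXN HI' HA).
  have Ax' : A (x ^+ (g - e)) by mem.
  have Ir' : I (b' ^+ n * r - x ^+ f * (c' * (x ^+ (g - e) * a') ^+ n)).
    apply: (@cancel (e * n)); first by mem.
    rewrite -[_ * _]opprK; apply: (idN HA II).
    apply: (eq_ind _ I Ir); have -> : x ^+ (f + g * n) = x ^+ (e * n) * (x ^+ f * (x ^+ (g - e)) ^+ n).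
      by rewrite -exprM -!exprD; congr (_ ^+ _); rewrite addnCA -mulnDl subnKC.
    by rewrite exprMn; ring.
  have [|||q [Aq Iq]] := @divx f (b' ^+ n) r (c' * (x ^+ (g - e) * a') ^+ n) _ _ _ nbn Ir'; try by mem.
  exists q; split=> //; apply: (@cancel f); first by mem.
  rewrite (_ : _ * _ = b' ^+ n * (r - x ^+ f * q) - (b' ^+ n * r - x ^+ f * (c' * (x ^+ (g - e) * a') ^+ n))); last by ring.
  mem.
exists r; split=> //.
have Axe : A (x ^+ e) by mem.
have e1 : x ^+ g = x ^+ e * x ^+ (g - e) by rewrite -exprD subnKC.
rewrite (_ : _ - _ = (a - x ^+ g * a') + x ^+ e * (x ^+ (g - e) * a' - r * b') - r * (b - x ^+ e * b')); last by rewrite e1; ring.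
mem.
Qed.
End CicStep.
End Normality.

(** * Height one primes of a regular local ring and discrete valuation rings *)

Section HeightOne.
Variable F : fieldType.
Implicit Types (A B C I J P Q T L : F -> Prop).

Lemma span_take_nth A s j : (j < size s)%N ->
  isum (span A (take j s)) (principal A s`_j) = span A (take j.+1 s).
Proof.
elim: j s => [|j ih] [|h s] //=.
  move=> _; rewrite take0; apply: sub_antisym => z /=.
    by move=> [_ [_ [-> [r [Ar ->]] ->]]]; exists r, 0; rewrite add0r addr0.
  by move=> [c [w [Ac -> ->]]]; exists 0, (c * h); split=> //; [exists c|rewrite addr0 add0r].
move=> /ih e; apply: sub_antisym => z /=.
  move=> [_ [v [[c [w [Ac lw ->]]] pv ->]]]; exists c, (w + v); split=> //; last by rewrite addrA.
  by rewrite -e; exists w, v.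
move=> [c [w [Ac]]]; rewrite -e => -[u [v [lu pv ->]]] ->.
by exists (c * h + u), v; split=> //; [exists c, u|rewrite addrA].
Qed.

Lemma rsop_prime A s j : is_local A -> rsop A s -> (j <= size s)%N -> is_prime A (span A (take j s)).
Proof.
move=> HL [sA es hs]; rewrite leq_eqVlt => /orP[/eqP ->|/hs[]//].
by rewrite take_size -es; exact: max_prime.
Qed.

(** Modulo all parameters the quotient is a field; [cic_step] then drops the last parameter of the
    segment, one at a time, down to the empty segment. *)
Lemma regular_cicl A : regular_local A -> cicl A (fun z => z = 0).
Proof.
move=> HR; have [HL hN _] := HR; have HA := local_sr HL; have Hm := local_mi HL.
have [s [rs _]] := regular_rsop HR; have [sA es hs] := rs.
suff key j : (j <= size s)%N -> cicl A (span A (take (size s - j) s)).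
  by have := key _ (leqnn _); rewrite subnn take0.
elim: j => [|j ih] hj.
  rewrite subn0 take_size -es => a b c Aa Ab Ac nb nc _.
  have [b0 Ab1] := local_unit Ab nb.
  exists (a / b); split; first by mem.
  by rewrite (_ : _ - _ = 0); [mem|field].
have hk : (size s - j.+1 < size s)%N by lia.
have e : (size s - j = (size s - j.+1).+1)%N by lia.
have [Hp np] := hs _ hk.
apply: (cic_step HL hN Hp _ np).
- by rewrite es; apply: span_gen => //; exact: mem_nth.
- by rewrite span_take_nth // -e; apply: rsop_prime => //; lia.
- by rewrite span_take_nth // -e; apply: ih; lia.
Qed.

Lemma regular_cic A z c : regular_local A -> quotient_field_of A -> A c -> c != 0 ->
  (forall n, A (c * z ^+ n)) -> A z.
Proof.
move=> HR HQ Ac c0 h; have [a [b [Aa Ab b0 ez]]] := HQ z.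
have [n|r [Ar /eqP]] := regular_cicl HR Aa Ab Ac (elimN eqP b0) (elimN eqP c0).
  exists (c * z ^+ n); split; first exact: h.
  by rewrite ez expr_div_n mulrA divfK ?subrr // expf_neq0.
by rewrite subr_eq0 ez => /eqP ->; rewrite mulfK.
Qed.

Section Dvr.
Variables (L : F -> Prop) (t : F).
Hypotheses (HL : is_local L) (hN : noetherian L) (t0 : t != 0) (mt : maxideal L t)
  (ht : forall s, maxideal L s -> L (s / t)).

Lemma dvr a : L a -> a != 0 -> exists n e, [/\ L e, L e^-1, e != 0 & a = t ^+ n * e].
Proof.
move=> La a0; have HA := local_sr HL; have Hm := local_mi HL.
apply: contrapT => h; move/eqP: a0; apply; apply: (krull0 HL hN) => n.
suff [r [Lr e]] : exists r, L r /\ a = t ^+ n * r.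
  have Hp := pow_ideal n HA Hm.
  have hp : ideal_pow L (maxideal L) n (t ^+ n) by exact: powX.
  by rewrite e; mem.
elim: n => [|n [r [Lr e]]]; first by exists a; rewrite expr0 mul1r.
exists (r / t); split; last by rewrite e exprSr; field.
apply: ht; apply: contrapT => nr; apply: h; exists n, r.
by have [r0 Lr1] := local_unit Lr nr.
Qed.

Lemma dvr_field z : z != 0 -> (exists a b, [/\ L a, L b, b != 0 & z = a / b]) ->
  exists n m e, [/\ L e, L e^-1, e != 0 & z = t ^+ n / t ^+ m * e].
Proof.
move=> z0 [a [b [La Lb b0 ez]]]; have HA := local_sr HL.
have a0 : a != 0 by apply: contraNneq z0 => e; rewrite ez e mul0r.
have [n [e [Le Le1 e0 ea]]] := dvr La a0; have [m [f [Lf Lf1 f0 eb]]] := dvr Lb b0.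
exists n, m, (e / f); split; [by mem|by rewrite invf_div; mem|by rewrite mulf_neq0 ?invr_neq0|].
by rewrite ez ea eb; field; rewrite f0 expf_neq0.
Qed.
End Dvr.

Lemma common_den A P z (gs : seq F) : is_subring A -> is_prime A P -> (forall g, g \in gs -> A g) ->
  (forall g, g \in gs -> locid A P P (z * g)) ->
  exists d, [/\ A d, ~ P d & forall g, g \in gs -> P (d * z * g)].
Proof.
move=> HA HP; elim: gs => [|h l ih] gA hg.
  by exists 1; split=> //; [mem|exact: prime1 HP].
have [g gl|g gl|d [Ad nd hd]] := ih.
- by apply: gA; rewrite in_cons gl orbT.
- by apply: hg; rewrite in_cons gl orbT.
have [a [b [Pa Ab nb e]]] := hg h (mem_head _ _).
have b0 := notin_neq0 HP nb.
exists (d * b); split; [mem|exact: (primeMN HP)|] => g; rewrite in_cons => /orP[/eqP ->|/hd Pg].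
  rewrite (_ : _ * _ = d * (b * (z * h))); last by ring.
  by rewrite e (_ : b * _ = a); [mem|field].
by rewrite (_ : _ * _ = b * (d * z * g)); [mem|ring].
Qed.

(* z is chosen with z m contained in A_P but z not in A_P; complete integral closedness excludes
   z m in m, so 1/z generates the maximal ideal. *)
Lemma height1_dvr A P : regular_local A -> quotient_field_of A -> is_prime A P ->
  (exists z, P z /\ z != 0) -> (forall Q, is_prime A Q -> subset_ Q P -> (exists z, Q z /\ z != 0) -> Q = P) ->
  exists t, [/\ t != 0, maxideal (localize A P) t &
    forall s, maxideal (localize A P) s -> localize A P (s / t)].
Proof.
move=> HR HQ HP [c [Pc c0]] hmin; have [HLA hNA _] := HR; have HA := local_sr HLA.
have PI := prime_ideal HP.
set L := localize A P; have HL : is_local L := loc_local HA HP.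
have hN : noetherian L := loc_noeth HA HP hNA.
have HLs := local_sr HL; have Hm := local_mi HL; have em : maxideal L = locid A P P := loc_max HA HP.
have mc : maxideal L c by rewrite em; exact: locid_sub.
have Lc : L c by mem.
have Hc := principal_ideal HLs Lc.
have [k hk] : exists k, subset_ (ideal_pow L (maxideal L) k) (principal L c).
  apply: pow_sub => // Q HQ1 sQ; have HC := contr_prime HA HP HQ1.
  rewrite em -(locid_contr HA HP (prime_ideal HQ1)) (hmin _ HC) //.
  - move=> z [Qz Az]; apply: (locid_mem HP HP (fun _ => id) Az).
    by rewrite -em; exact: (prime_submax HQ1).
  - exists c; split=> //; split; last by mem.
    by apply: sQ; exact: principal_self.
have [k0 [hk0 mk0]] : exists k, subset_ (ideal_pow L (maxideal L) k.+1) (principal L c) /\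
    ~ subset_ (ideal_pow L (maxideal L) k) (principal L c).
  elim: k hk => [|k ih] hk.
    case: (unit_nmax (A := L) (s := 1)) => //; rewrite ?invr1 ?oner_eq0 //; try by mem.
    have : principal L c 1 by apply: hk; rewrite pow0 //; mem.
    by apply: (principal_min Hm).
  by case: (EM (subset_ (ideal_pow L (maxideal L) k) (principal L c))) => [/ih//|?]; exists k.
have [w [mw nw]] : exists w, ideal_pow L (maxideal L) k0 w /\ ~ principal L c w.
  by apply: contrapT => h; apply: mk0 => w mw; apply: contrapT => nw; apply: h; exists w.
pose z := w / c.
have nz : ~ L z by move=> Lz; apply: nw; exists z; split=> //; rewrite /z divfK.
have zm s : maxideal L s -> L (z * s).
  move=> ms; have /hk0[r [Lr e]] : ideal_pow L (maxideal L) k0.+1 (w * s).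
    by rewrite -addn1; apply: pow_mul => //; rewrite pow1.
  by rewrite (_ : z * s = r) // /z mulrAC e mulfK.
(* If z mapped the maximal ideal into itself, then, with d outside P a common denominator for z
   times the generators of P, dz would map P into P. All c (dz)^n would lie in P, so dz would lie in
   A and z in L. *)
have [s [ms nzs]] : exists s, maxideal L s /\ ~ maxideal L (z * s).
  apply: contrapT => h.
  have hz s : maxideal L s -> locid A P P (z * s).
    by move=> ms; rewrite -em; apply: contrapT => ns; apply: h; exists s.
  have [gs [gP eP]] := noeth_fg HA hNA PI.
  have gA g : g \in gs -> A g by move=> /gP ?; mem.
  have [|d [Ad nd hd]] := common_den HA HP gA (z := z).
    by move=> g /gP Pg; apply: hz; rewrite em; exact: locid_sub.
  have hdz u : P u -> P (d * z * u).
    rewrite {1}eP => gu.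
    have HI : is_ideal A (fun u => A u /\ P (d * z * u)).
      split.
      - by move=> x [].
      - by split; [mem|rewrite mulr0; mem].
      - by move=> x y [? ?] [? ?]; split; [mem|rewrite mulrDr; mem].
      - by move=> r x Ar [? ?]; split; [mem|rewrite mulrCA; mem].
    suff : A u /\ P (d * z * u) by case.
    apply: (span_min HI) gu => // g gg; split; [exact: gA|exact: hd].
  have Ac : A c by mem.
  have : A (d * z).
    apply: (regular_cic HR HQ Ac c0) => n; suff ? : P (c * (d * z) ^+ n) by mem.
    by elim: n => [|n ih]; [rewrite expr0 mulr1|rewrite exprS mulrCA; exact: hdz].
  move=> Adz; apply: nz; exists (d * z), d; split=> //.
  by field; exact: (notin_neq0 HP nd).
have Lzs := zm s ms; have [zs0 Lzs1] := local_unit Lzs nzs.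
have z0 : z != 0 by apply: contraNneq zs0 => ->; rewrite mul0r.
have s0 : s != 0 by apply: contraNneq zs0 => ->; rewrite mulr0.
exists z^-1; split; first by rewrite invr_eq0.
  by rewrite (_ : z^-1 = (z * s)^-1 * s); [mem|rewrite [(z * s)^-1]invfM mulfVK].
by move=> u /zm; rewrite invrK mulrC.
Qed.
End HeightOne.

(** * Quasi-regularity and multiplicativity of the order *)

Section Coefs.
Variables (F : fieldType) (d : nat).
Implicit Types (A C I J : F -> Prop) (p q : {mpoly F[d]}).

Lemma mpoly_of (f : 'X_{1..d} -> F) k : (forall m, (k <= mdeg m)%N -> f m = 0) ->
  exists p : {mpoly F[d]}, forall m, p@_m = f m.
Proof.
move=> hf; exists (\sum_(m : 'X_{1..d < k}) (f m *: 'X_[m])) => m.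
have [le|lt] := leqP k (mdeg m); last by rewrite mcoeff_mpoly.
rewrite hf // raddf_sum big1 // => i _ /=; rewrite mcoeffZ mcoeffX.
case: eqP => [e|]; last by rewrite mulr0.
by have := bmdeg i; rewrite e ltnNge le.
Qed.

Lemma mcoeffM_neq0 p q m : (p * q)@_m != 0 -> exists k1 k2, [/\ m = (k1 + k2)%MM, p@_k1 != 0 & q@_k2 != 0].
Proof.
move=> h; apply: contrapT => n; move/eqP: h; apply; rewrite mcoeffM big1 // => -[k1 k2] /= /eqP e.
apply/eqP; rewrite mulf_eq0; apply/negPn; rewrite negb_or; apply/negP => /andP[h1 h2].
by apply: n; exists k1, k2.
Qed.

Definition coefs C p := forall m, C p@_m.

Lemma coefs_mul A I p q : is_subring A -> is_ideal A I -> coefs A p -> coefs I q -> coefs I (p * q).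
Proof.
move=> HA HI hp hq m; rewrite mcoeffM; apply: (id_sum HI) => i _.
by apply: (idMl HI); [exact: hp|exact: hq].
Qed.

(** Gauss's lemma modulo I: once the coefficients in I are split off, the leading coefficients of
    the rests lie outside I, and so does their product. *)
Lemma gauss A I p q : is_subring A -> is_prime A I -> coefs A p -> coefs A q ->
  coefs I (p * q) -> coefs I p \/ coefs I q.
Proof.
move=> HA HI hp hq hpq; have II := prime_ideal HI.
have split_ r : coefs A r -> exists p1 p2, [/\ r = p1 + p2, coefs I p1, coefs A p2 &
    forall m, p2@_m != 0 -> ~ I p2@_m].
  move=> hr; have [|p1 e1] := @mpoly_of (fun m => if `[< I r@_m >] then r@_m else 0) (msize r).
    by move=> m /msize_mdeg_ge; rewrite -mcoeff_eq0 => /eqP ->; case: ifP.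
  exists p1, (r - p1); split; first by ring.
  - by move=> m; rewrite e1; case: asboolP => // _; mem.
  - by move=> m; rewrite mcoeffB e1; have Am := hr m; case: asboolP => _; mem.
  - by move=> m; rewrite mcoeffB e1; case: asboolP; rewrite ?subrr ?eqxx ?subr0.
have [p1 [p2 [ep Ip1 Ap2 np2]]] := split_ p hp.
have [q1 [q2 [eq Iq1 Aq2 nq2]]] := split_ q hq.
have Ap1 : coefs A p1 by move=> m; have := Ip1 m => ?; mem.
have [p20|p20] := eqVneq p2 0; first by left; rewrite ep p20 addr0.
have [q20|q20] := eqVneq q2 0; first by right; rewrite eq q20 addr0.
have nzp : p2@_(mlead p2) != 0 by rewrite mleadc_eq0.
have nzq : q2@_(mlead q2) != 0 by rewrite mleadc_eq0.
have Ap := Ap2 (mlead p2); have Aq := Aq2 (mlead q2).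
suff : I (p2@_(mlead p2) * q2@_(mlead q2)).
  by move=> /(primeM HI Ap Aq)[/(np2 _ nzp)|/(nq2 _ nzq)].
rewrite -mleadcM (_ : p2 * q2 = p * q - p1 * q2 - p * q1); last by rewrite ep eq; ring.
rewrite !mcoeffB.
have h1 := hpq (mlead p2 + mlead q2)%MM.
have h2 : I (p1 * q2)@_(mlead p2 + mlead q2) by rewrite mulrC; apply: (@coefs_mul A).
have h3 : I (p * q1)@_(mlead p2 + mlead q2) by apply: (@coefs_mul A).
mem.
Qed.
End Coefs.

(** * Forms in a regular system of parameters *)

Section Forms.
Variable F : fieldType.
Implicit Types (A C I J : F -> Prop).
Variables (A : F -> Prop) (s : seq F).
Hypotheses (HL : is_local A) (rs : rsop A s).
Let HA := local_sr HL.
Let Hm := local_mi HL.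
Let d := size s.
Let v (i : 'I_d) := s`_i.
Let In j := span A (take j s).
Implicit Types (p q : {mpoly F[d]}).

Let sA g : g \in s -> A g. Proof. by case: rs => h _ _; apply: h. Qed.
Let em : maxideal A = span A s. Proof. by case: rs. Qed.
Let vA i : A (v i). Proof. by apply: sA; apply: mem_nth. Qed.
Let II j : is_ideal A (In j).
Proof. by apply: span_ideal => //; [exact: ideal_self|move=> g /mem_take; exact: sA]. Qed.
Let Iv j (i : 'I_d) : (i < j)%N -> In j (v i).
Proof.
move=> ij; apply: span_gen => //; first by move=> g /mem_take; exact: sA.
rewrite /v -(nth_take 0 ij); apply: mem_nth; rewrite size_take; case: ifP => // _.
Qed.
Let Iu j k : (j <= k)%N -> subset_ (In j) (In k).
Proof.
move=> jk; apply: (span_min (II k)) => // g.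
rewrite /In -(subnKC jk) takeD => gj; apply: span_gen => //.
  move=> h; rewrite mem_cat => /orP[/mem_take|/mem_take/mem_drop]; exact: sA.
by rewrite mem_cat gj.
Qed.

Definition form C j n (p : {mpoly F[d]}) :=
  forall m, p@_m != 0 -> [/\ C p@_m, mdeg m = n & forall i : 'I_d, (j <= i)%N -> m i = 0%N].
Definition mon (m : 'X_{1..d}) : F := \prod_(i < d) v i ^+ m i.
Definition Fm C j n z := exists p, form C j n p /\ z = p.@[v].

Lemma form0 C j n : form C j n 0. Proof. by move=> m; rewrite mcoeff0 eqxx. Qed.

Lemma formC C I j n p : is_ideal C I -> form I j n p -> coefs I p.
Proof. by move=> HI h m; have [->|/h[]//] := eqVneq p@_m 0; exact: id0 HI. Qed.

Lemma form_sub C D j k n p : subset_ C D -> (j <= k)%N -> form C j n p -> form D k n p.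
Proof.
move=> CD jk h m /h[Cm dm vm]; split=> //; first exact: CD.
by move=> i ki; apply: vm; apply: leq_trans ki.
Qed.

Lemma form_add I j n p q : is_ideal A I -> form I j n p -> form I j n q -> form I j n (p + q).
Proof.
move=> HI hp hq m; have Ip := formC HI hp m; have Iq := formC HI hq m.
rewrite mcoeffD => h; have [e|/hp[_ ? ?]] := eqVneq p@_m 0; last by split=> //; mem.
by have [|_ ? ?] := hq m; [move: h; rewrite e add0r|split=> //; mem].
Qed.

Lemma form_scale I j n c p : is_ideal A I -> A c -> form I j n p -> form I j n (c *: p).
Proof.
move=> HI Ac hp m; rewrite mcoeffZ mulf_eq0 negb_or => /andP[_ /hp[? ? ?]]; split=> //; mem.
Qed.

Lemma formX I j n c m : I c -> mdeg m = n -> (forall i : 'I_d, (j <= i)%N -> m i = 0%N) ->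
  form I j n (c *: 'X_[m]).
Proof.
move=> Ic dm vm k; rewrite mcoeffZ mcoeffX; have [<-|_] := eqVneq m k; last by rewrite mulr0 eqxx.
by rewrite mulr1.
Qed.

Lemma form_mul j a b p q : form A j a p -> form A j b q -> form A j (a + b) (p * q).
Proof.
move=> hp hq m nz; split.
- by apply: (coefs_mul HA (ideal_self HA)); [exact: formC (ideal_self HA) hp|exact: formC (ideal_self HA) hq].
- by have [k1 [k2 [-> /hp[_ <- _] /hq[_ <- _]]]] := mcoeffM_neq0 nz; rewrite mdegD.
- move=> i ji; have [k1 [k2 [-> /hp[_ _ h1] /hq[_ _ h2]]]] := mcoeffM_neq0 nz.
  by rewrite mnmDE h1 // h2.
Qed.

Lemma monE m : ('X_[m] : {mpoly F[d]}).@[v] = mon m. Proof. exact: mevalX. Qed.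
Lemma monD m1 m2 : mon (m1 + m2) = mon m1 * mon m2. Proof. by rewrite -!monE mpolyXD mevalM. Qed.
Lemma monU i : mon U_(i) = v i. Proof. by rewrite -monE mevalXU. Qed.

Lemma mon0 : mon 0%MM = 1. Proof. by rewrite -monE mpolyX0 meval1. Qed.

Lemma Fm_ideal I j n : is_ideal A I -> is_ideal A (Fm I j n).
Proof.
move=> HI; split.
- move=> z [p [hp ->]]; rewrite mevalE; apply: (sr_sum HA) => m _.
  have := formC HI hp m => ?; have Am : A (\prod_i v i ^+ m i).
    by apply: (sr_prod HA) => i _; apply: (srX HA).
  mem.
- by exists 0; split; [exact: form0|rewrite meval0].
- by move=> x y [p [hp ->]] [q [hq ->]]; exists (p + q); split; [exact: form_add|rewrite mevalD].
- by move=> a x Aa [p [hp ->]]; exists (a *: p); split; [exact: form_scale|rewrite mevalZ].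
Qed.

Lemma Fm_min I j n K : is_ideal A K -> (forall c m, I c -> mdeg m = n ->
   (forall i : 'I_d, (j <= i)%N -> m i = 0%N) -> K (c * mon m)) -> subset_ (Fm I j n) K.
Proof.
move=> HK h z [p [hp ->]]; rewrite mevalE big_seq; apply: (id_sum HK) => m.
by rewrite mcoeff_msupp => /hp[? ? ?]; apply: h.
Qed.

Lemma FmX I j n c m : I c -> mdeg m = n -> (forall i : 'I_d, (j <= i)%N -> m i = 0%N) ->
  Fm I j n (c * mon m).
Proof. by move=> ? ? ?; exists (c *: 'X_[m]); split; [exact: formX|rewrite mevalZ monE]. Qed.

Lemma Fm_lower j n : subset_ (Fm A j n.+1) (Fm (In j) j n).
Proof.
apply: Fm_min => [|c m Ac dm vm]; first exact: Fm_ideal.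
have [i mi] : exists i, (0 < m i)%N.
  apply: contrapT => h; have : mdeg m = 0%N; last by rewrite dm.
  rewrite mdegE big1 // => i _; apply/eqP; rewrite -leqn0 leqNgt; apply/negP => hi; apply: h.
  by exists i.
have ij : (i < j)%N by rewrite ltnNge; apply/negP => /vm e; rewrite e in mi.
have em' : m = (U_(i) + (m - U_(i)))%MM.
  by rewrite addmC submK //; apply/mnm_lepP => l; rewrite mnm1E; case: eqP => // <-.
rewrite em' monD monU mulrA; apply: FmX.
- by have := Iv ij => ?; have := II j => ?; mem.
- by move: dm; rewrite {1}em' mdegD mdeg1 add1n => -[].
- by move=> k /vm mk; rewrite mnmBE mk.
Qed.

Lemma Fm_raise j n : subset_ (Fm (In j) j n) (Fm A j n.+1).
Proof.
have HF := Fm_ideal j n.+1 (ideal_self HA).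
apply: Fm_min => // c m Ic dm vm.
have HI : is_ideal A (fun c => A c /\ Fm A j n.+1 (c * mon m)).
  split.
  - by move=> x [].
  - by split; [mem|rewrite mul0r; mem].
  - by move=> x y [? ?] [? ?]; split; [mem|rewrite mulrDl; mem].
  - by move=> r x Ar [? ?]; split; [mem|rewrite -mulrA; mem].
suff : A c /\ Fm A j n.+1 (c * mon m) by case.
move: c Ic; apply: (span_min HI) => // g gs.
split; first by apply: sA; exact: mem_take gs.
have gs' := mem_take gs.
have id_ : (index g s < d)%N by rewrite index_mem.
pose i := Ordinal id_.
have ij : (i < j)%N by rewrite /i /= ltnNge; apply/negP => h; move: gs; rewrite in_take // ltnNge h.
have -> : g = v i by rewrite /v nth_index.
rewrite -monU -monD -[mon _]mul1r; apply: FmX; first by mem.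
  by rewrite mdegD mdeg1 dm.
move=> k jk; rewrite mnmDE vm // mnm1E addn0; case: eqP => // e.
by move: jk; rewrite -e leqNgt ij.
Qed.

(** Quasi-regularity of the first [j] parameters, tested only on forms with value 0; [Fm_lower]
    reduces values in the next power to this case. *)
Definition qr j := forall n p, form A j n p -> p.@[v] = 0 -> coefs (In j) p.

(** The parameter s_j stays regular modulo the powers of [In j]. By induction a is the value of a
    form p of degree n - 1; s_j p and a form with coefficients in [In j] have the same value, so s_j
    times each coefficient of p lies in the prime [In j], which misses s_j. *)
Lemma qr_colon j n a : (j < d)%N -> qr j -> A a -> Fm A j n (s`_j * a) -> Fm A j n a.
Proof.
move=> jd hq; have [Hp np] : is_prime A (In j) /\ ~ In j s`_j by case: rs => _ _ h; exact: h.
have As : A s`_j by apply: sA; exact: mem_nth.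
elim: n a => [|n ih] a Aa.
  move=> _; by rewrite -[a]mulr1 -mon0; apply: FmX; rewrite ?mdeg0 // => i _; rewrite mnm0E.
move=> h; have hI := II j.
have hl := Fm_lower h.
have {}hl2 : Fm A j n (s`_j * a).
  by have [p [hp ->]] := hl; exists p; split=> //; apply: form_sub hp => // z; apply: idS hI _.
have [p [hp ea]] := ih a Aa hl2; have [q [hq' eq]] := hl.
have c0 : coefs (In j) (s`_j *: p - q).
  apply: (hq n).
    apply: form_add => //; [exact: ideal_self|apply: form_scale => //; exact: ideal_self|].
    rewrite -scaleN1r; apply: form_scale => //; [exact: ideal_self|mem|].
    by apply: form_sub hq' => // z; apply: idS hI _.
  by rewrite mevalB mevalZ -ea -eq subrr.
apply: Fm_raise; exists p; split=> // m nz; have [Ap dm vm] := hp m nz; split=> //.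
have Iq : coefs (In j) q by exact: formC hI hq'.
have : In j (s`_j * p@_m).
  have := c0 m; rewrite mcoeffB mcoeffZ => ?; have := Iq m => ?.
  by rewrite (_ : _ * _ = s`_j * p@_m - q@_m + q@_m); [mem|ring].
by move=> /(primeM Hp As Ap)[].
Qed.

(* Rees: a regular sequence is quasi-regular, by induction on the number of variables and the degree. *)
Lemma qr_step j : (j < d)%N -> qr j -> qr j.+1.
Proof.
move=> jd hj; pose jo := Ordinal jd; have hI := II j; have hI1 := II j.+1.
have HF k n := Fm_ideal k n (ideal_self HA).
elim=> [|n ih] p hp p0.
  have hp0 : form A j 0 p.
    move=> m /hp[Ap dm _]; split=> // i _.
    by move/eqP: dm; rewrite mdeg_eq0 => /eqP ->; rewrite mnm0E.
  by move=> m; apply: (Iu (leqnSn j)); exact: (hj 0%N).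
have [|g eg] := @mpoly_of F d (fun m => p@_(m + U_(jo))) (msize p).
  move=> m le; apply/eqP; rewrite mcoeff_eq0; apply: msize_mdeg_ge.
  by rewrite mdegD; apply: leq_trans le _; apply: leq_addr.
have [|h eh] := @mpoly_of F d (fun m => if m jo == 0%N then p@_m else 0) (msize p).
  by move=> m /msize_mdeg_ge; rewrite -mcoeff_eq0 => /eqP ->; case: ifP.
have epm m : p@_m = if m jo == 0%N then h@_m else g@_(m - U_(jo)).
  rewrite eh eg; have [//|] := eqVneq (m jo) 0%N; rewrite -lt0n => mj.
  by rewrite submK //; apply/mnm_lepP => l; rewrite mnm1E; case: eqP => // <-.
have ep : p = h + g * 'X_jo.
  apply/mpolyP => m; rewrite mcoeffD; have [m0|m0] := eqVneq (m jo) 0%N.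
    rewrite epm m0 eqxx; suff -> : (g * 'X_jo)@_m = 0 by rewrite addr0.
    apply/eqP; apply/negPn/negP => /mcoeffM_neq0[k1 [k2 [e _]]].
    rewrite mcoeffX; have [e2 _|_] := eqVneq U_(jo)%MM k2; last by rewrite eqxx.
    by move: m0; rewrite e mnmDE -e2 mnm1E eqxx addn1.
  rewrite eh (negbTE m0) add0r epm (negbTE m0).
  have e : m = (U_(jo) + (m - U_(jo)))%MM.
    by rewrite addmC submK //; apply/mnm_lepP => l; rewrite mnm1E; case: eqP => // <-; rewrite lt0n.
  by rewrite {2}e mcoeffMX.
have hh : form A j n.+1 h.
  move=> m; rewrite eh; have [m0|_] := eqVneq (m jo) 0%N; last by rewrite eqxx.
  move=> /hp[? ? vm]; split=> // i ji; have [e|ne] := eqVneq (i : nat) j.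
    by rewrite (_ : i = jo) //; apply: val_inj.
  by apply: vm; rewrite ltn_neqAle eq_sym ne.
have hg : form A j.+1 n g.
  move=> m; rewrite eg => /hp[? dm vm]; split=> //.
    by move: dm; rewrite mdegD mdeg1 addn1 => -[].
  by move=> i /vm /eqP; rewrite mnmDE addn_eq0 => /andP[/eqP].
have ev : h.@[v] + g.@[v] * s`_j = 0 by move: p0; rewrite ep mevalD mevalM mevalXU.
have Ag : A g.@[v] by apply: (idS (HF j.+1 n)); exists g.
(* In p = h + g X_j, the value of s_j g is minus that of h, a form of degree n + 1 in the first j
   variables, so [qr_colon] applies to g(v). Then g is settled by induction on the degree, and h by
   [qr j] applied to h + s_j h', where h'(v) = g(v). *)
have Fg : Fm A j n.+1 g.@[v].
  apply: (qr_colon jd hj Ag); have := HF j n.+1 => HFj.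
  have Fh : Fm A j n.+1 h.@[v] by exists h.
  by rewrite mulrC (_ : _ * _ = - h.@[v]); [mem|apply/eqP; rewrite -addr_eq0 addrC ev].
have [h' [hh' e']] := Fg.
have [q [hq eq]] := Fm_lower Fg.
have Iq := formC hI hq.
have cg : coefs (In j.+1) g.
  have c0 : coefs (In j.+1) (g - q).
    apply: ih; last by rewrite mevalB -eq subrr.
    apply: form_add => //; first exact: ideal_self.
    rewrite -scaleN1r; apply: form_scale => //; [exact: ideal_self|mem|].
    by apply: form_sub hq => // z; apply: idS hI _.
  move=> m; have := c0 m; rewrite mcoeffB => ?.
  have ? := Iu (leqnSn j) (Iq m).
  by rewrite (_ : g@_m = g@_m - q@_m + q@_m); [mem|ring].
have As : A s`_j by apply: sA; exact: mem_nth.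
have ch : coefs (In j.+1) h.
  have c0 : coefs (In j) (h + s`_j *: h').
    apply: (hj n.+1); last by rewrite mevalD mevalZ -e' mulrC.
    by apply: form_add => //; [exact: ideal_self|apply: form_scale => //; exact: ideal_self].
  move=> m; have := Iu (leqnSn j) (c0 m); rewrite mcoeffD mcoeffZ => ?.
  have ? : In j.+1 s`_j by exact: (@Iv j.+1 jo).
  have ? := formC (ideal_self HA) hh' m.
  by rewrite (_ : h@_m = h@_m + s`_j * h'@_m - s`_j * h'@_m); [mem|ring].
by move=> m; rewrite epm; case: ifP.
Qed.

Lemma qr_all j : (j <= d)%N -> qr j.
Proof.
elim: j => [|j ih] hj; last by apply: qr_step => //; apply: ih; exact: ltnW.
move=> n p hp p0; have c m : p@_m != 0 -> m = 0%MM.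
  by move=> /hp[_ _ h]; apply/mnmP => i; rewrite h // mnm0E.
have ep : p = (p@_0)%:MP.
  apply/mpolyP => m; rewrite mcoeffC; have [->|nm] := eqVneq m 0%MM; first by rewrite mulr1.
  by rewrite mulr0; apply/eqP/negPn/negP => /c e; rewrite e eqxx in nm.
by move: p0; rewrite ep mevalC => -> m; rewrite mcoeffC mul0r; apply: (id0 (II 0)).
Qed.

Lemma Im : In d = maxideal A. Proof. by rewrite em /In take_size. Qed.

Lemma pow_Fm n : ideal_pow A (maxideal A) n = Fm A d n.
Proof.
have HF k := Fm_ideal d k (ideal_self HA).
have vn (m : 'X_{1..d}) (i : 'I_d) : (d <= i)%N -> m i = 0%N by rewrite leqNgt ltn_ord.
apply: sub_antisym.
  apply: pow_min => // t zt ht; elim: t n zt ht => [|x t ih] n /=.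
    move=> <- _; rewrite big_nil -[1]mul1r -[X in _ * X]mon0.
    by apply: FmX; [mem|rewrite mdeg0|exact: vn].
  move=> <- ht; rewrite big_cons.
  have [p [hp ->]] : Fm A d (size t) (\prod_(j <- t) j).
    by apply: ih => // y yt; apply: ht; rewrite in_cons yt orbT.
  have [q [hq ->]] : Fm A d 1 x.
    apply: Fm_raise; have mx : In d x by rewrite Im; apply: ht; rewrite mem_head.
    rewrite -[x]mulr1 -mon0.
    by apply: FmX; [|rewrite mdeg0|exact: vn].
  by exists (q * p); split; [rewrite -add1n; exact: form_mul|rewrite mevalM].
have Hp := pow_ideal n HA Hm.
apply: Fm_min => // c m Ac dm _; suff : ideal_pow A (maxideal A) n (mon m) by move=> ?; mem.
rewrite -dm mdegE /mon; elim/big_rec2: _ => [|i y1 y2 _ h]; first by rewrite pow0 //; mem.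
apply: pow_mul => //; apply: powX; rewrite -Im; exact: Iv.
Qed.

Lemma pow_form n z : ideal_pow A (maxideal A) n z -> exists p, form A d n p /\ z = p.@[v].
Proof. by rewrite pow_Fm. Qed.

Lemma quasi_regular n p : form A d n p -> ideal_pow A (maxideal A) n.+1 p.@[v] ->
  coefs (maxideal A) p.
Proof.
move=> hp; rewrite pow_Fm => /Fm_lower [q [hq eq]].
have hI := II d; have Iq := formC hI hq.
have c0 : coefs (In d) (p - q).
  apply: (qr_all (leqnn d) (n := n)); last by rewrite mevalB -eq subrr.
  apply: form_add => //; first exact: ideal_self.
  rewrite -scaleN1r; apply: form_scale => //; [exact: ideal_self|mem|].
  by apply: form_sub hq => // z; apply: idS hI _.
rewrite -Im => m; have := c0 m; rewrite mcoeffB => ?; have ? := Iq m.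
by rewrite (_ : p@_m = p@_m - q@_m + q@_m); [mem|ring].
Qed.

Lemma coefs_pow n p : form A d n p -> coefs (maxideal A) p -> ideal_pow A (maxideal A) n.+1 p.@[v].
Proof.
move=> hp cp; rewrite pow_Fm; apply: Fm_raise; exists p; split=> // m /hp[_ ? ?]; split=> //.
by rewrite Im.
Qed.

(** The associated graded ring is a polynomial ring over the residue field, hence a domain: the
    leading forms multiply to a nonzero form by Gauss's lemma. *)
Lemma pow_mulN a b x y : ideal_pow A (maxideal A) a x -> ideal_pow A (maxideal A) b y ->
  ~ ideal_pow A (maxideal A) a.+1 x -> ~ ideal_pow A (maxideal A) b.+1 y ->
  ~ ideal_pow A (maxideal A) (a + b).+1 (x * y).
Proof.
move=> /pow_form[p [hp ->]] /pow_form[q [hq ->]] nx ny; rewrite -mevalM.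
move=> /(quasi_regular (form_mul hp hq)).
move=> /(gauss HA (max_prime HL) (formC (ideal_self HA) hp) (formC (ideal_self HA) hq))[] h.
  by apply: nx; apply: coefs_pow.
by apply: ny; apply: coefs_pow.
Qed.
End Forms.

(** * Quadratic transforms do not increase the order *)

Section Blowup.
Variable F : fieldType.
Implicit Types (A B C I J T : F -> Prop).

Lemma gen_subring_subring A T : is_subring (gen_subring A T).
Proof.
split.
- by move=> C HC _ _; mem.
- by move=> C HC _ _; mem.
- move=> x y hx hy B HB AB TB; have ? := hx B HB AB TB; have ? := hy B HB AB TB; mem.
- move=> x y hx hy B HB AB TB; have ? := hx B HB AB TB; have ? := hy B HB AB TB; mem.
Qed.

Lemma blowupP A x z : is_local A -> x != 0 -> maxideal A x -> blowup A x z <->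
  exists n a, ideal_pow A (maxideal A) n a /\ z = a / x ^+ n.
Proof.
move=> HL x0 mx; have HA := local_sr HL; have Hm := local_mi HL; have Hp n := pow_ideal n HA Hm.
have px n : ideal_pow A (maxideal A) n (x ^+ n) by exact: powX.
have HB := gen_subring_subring A (fun z => exists y, maxideal A y /\ z = y / x).
rewrite -/(blowup A x) in HB; split.
  move=> h; apply: (h (fun z => exists n a, ideal_pow A (maxideal A) n a /\ z = a / x ^+ n)); last 2 first.
  - by move=> a Aa; exists 0%N, a; rewrite expr0 divr1 pow0.
  - by move=> _ [y [my ->]]; exists 1%N, y; rewrite expr1 pow1.
  split.
  - by exists 0%N, 0; rewrite mul0r; split=> //; have := Hp 0%N => ?; mem.
  - by exists 0%N, 1; rewrite expr0 divr1 pow0 //; split=> //; mem.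
  - move=> _ _ [n [a [ha ->]]] [k [b [hb ->]]]; exists (n + k)%N, (a * x ^+ k - b * x ^+ n); split.
      have h1 : ideal_pow A (maxideal A) (n + k) (a * x ^+ k) by exact: pow_mul.
      have h2 : ideal_pow A (maxideal A) (n + k) (b * x ^+ n) by rewrite addnC; exact: pow_mul.
      by have := Hp (n + k)%N => ?; mem.
    by rewrite exprD; field; rewrite !expf_neq0.
  - move=> _ _ [n [a [ha ->]]] [k [b [hb ->]]]; exists (n + k)%N, (a * b); split; first exact: pow_mul.
    by rewrite exprD; field; rewrite !expf_neq0.
move=> [n [a [ha ->]]].
have AB : subset_ A (blowup A x) by move=> u Au C HC sAC _; exact: sAC.
have HI : is_ideal A (fun a => A a /\ blowup A x (a / x ^+ n)).
  split.
  - by move=> u [].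
  - by split; [mem|rewrite mul0r; mem].
  - by move=> u w [? ?] [? ?]; split; [mem|rewrite mulrDl; mem].
  - move=> r u Ar [? ?]; split; [mem|rewrite -mulrA; mem].
suff : A a /\ blowup A x (a / x ^+ n) by case.
apply: (pow_min HI) ha => t zt ht.
elim: t n zt ht {HI} => [|u t ih] n /=.
  by move=> <- _; rewrite big_nil expr0 divr1; split; mem.
move=> <- ht; rewrite big_cons; have [|At Bt] := ih (size t) erefl.
  by move=> w wt; apply: ht; rewrite in_cons wt orbT.
have mu : maxideal A u by apply: ht; rewrite mem_head.
split; first by mem.
have Bu : blowup A x (u / x) by move=> C HC AC TC; apply: TC; exists u.
rewrite exprS (_ : _ / _ = (u / x) * (\prod_(j <- t) j / x ^+ size t)); first by mem.
by field; rewrite x0 expf_neq0.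
Qed.

Definition qtrans A B x := [/\ maxideal A x, ~ ideal_pow A (maxideal A) 2 x &
  exists q, [/\ is_prime (blowup A x) q, subset_ (maxideal A) q & B = localize (blowup A x) q]].

Lemma lqtP A B : local_quadratic_transform A B -> exists x, qtrans A B x.
Proof.
by move=> [x [mx nx [q [Hq sq /pred_ext e]]]]; exists x; split=> //; exists q.
Qed.

Section Qtrans.
Variables (A B : F -> Prop) (x : F).
Hypotheses (HL : is_local A) (HQ : qtrans A B x).
Let HA := local_sr HL.
Let Hm := local_mi HL.
Let Hp n := pow_ideal n HA Hm.
Let mx : maxideal A x. Proof. by case: HQ. Qed.
Let m2x : ~ ideal_pow A (maxideal A) 2 x. Proof. by case: HQ. Qed.

Lemma qt_neq0 : x != 0.
Proof. by apply/eqP => e; apply: m2x; rewrite e; have := Hp 2; move=> ?; mem. Qed.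
Let x0 := qt_neq0.
Let xn0 n : x ^+ n != 0. Proof. by rewrite expf_neq0. Qed.
Let px n : ideal_pow A (maxideal A) n (x ^+ n). Proof. exact: powX. Qed.
Let BlP z := blowupP z HL x0 mx.
Let HBl : is_subring (blowup A x). Proof. exact: gen_subring_subring. Qed.

Lemma qt_local : is_local B.
Proof. by case: HQ => _ _ [q [Hq _ ->]]; exact: loc_local. Qed.
Let HB := local_sr qt_local.
Let HmB := local_mi qt_local.

Lemma qt_pow n a : ideal_pow A (maxideal A) n a -> B (a / x ^+ n).
Proof.
by case: HQ => _ _ [q [Hq _ ->]] h; apply: locid_sub => //; apply/BlP; exists n, a.
Qed.

Lemma qt_sub : subset_ A B.
Proof. by move=> a Aa; have := @qt_pow 0 a; rewrite expr0 divr1 pow0 //; apply. Qed.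

Lemma qt_div y : maxideal A y -> B (y / x).
Proof. by move=> my; have := @qt_pow 1 y; rewrite expr1 pow1 //; apply. Qed.

Lemma qt_max : subset_ (maxideal A) (maxideal B).
Proof. by case: HQ => _ _ [q [Hq sq ->]] y my; rewrite loc_max //; apply: locid_sub => //; exact: sq. Qed.

Lemma qt_contr z : A z -> maxideal B z -> maxideal A z.
Proof.
move=> Az mz; apply: contrapT => nz; have [z0 Az1] := local_unit Az nz.
exact: (unit_nmax (qt_sub Az1) z0 mz).
Qed.

(* Every element of the transform is a/b with a, b of degree n and b/x^n a unit. *)
Lemma qt_frac z : B z -> exists n a b, [/\ ideal_pow A (maxideal A) n a, ideal_pow A (maxideal A) n b,
   b != 0, ~ maxideal B (b / x ^+ n) & z = a / b].
Proof.
case: HQ => _ _ [q [Hq sq eB]]; rewrite {1}eB => -[u [w [/BlP[i [a [ha ->]]] Bw nw ->]]].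
have [j [b [hb ew]]] := (BlP w).1 Bw.
have w0 := notin_neq0 Hq nw.
have b0 : b != 0 by apply: contraNneq w0 => e; rewrite ew e mul0r.
exists (i + j)%N, (a * x ^+ j), (b * x ^+ i); split.
- exact: pow_mul.
- by rewrite addnC; exact: pow_mul.
- by rewrite mulf_neq0.
- rewrite (_ : _ / _ = w); last by rewrite ew exprD; field; rewrite !xn0.
  by rewrite eB loc_max // => /(locid_mem Hq Hq (fun _ => id) Bw).
- by rewrite ew; field; rewrite b0 !xn0.
Qed.

(** * Translating polynomials to a point *)

Section Translate.
Variable d : nat.
Implicit Types (p g : {mpoly F[d]}) (c : 'I_d -> F).

(** The Taylor expansion at the point c, whose coefficients of low degree measure vanishing
    there. *)
Definition shift c p := p \mPo [tuple 'X_i + (c i)%:MP | i < d].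

Lemma shiftE c p : shift c p = \sum_(m <- msupp p) p@_m *: \prod_(i < d) ('X_i + (c i)%:MP) ^+ m i.
Proof. by rewrite /shift comp_mpolyE; apply: eq_bigr => m _; congr (_ *: _); apply: eq_bigr => i _; rewrite tnth_mktuple. Qed.

Lemma shiftM c p g : shift c (p * g) = shift c p * shift c g. Proof. exact: rmorphM. Qed.
Lemma shiftD c p g : shift c (p + g) = shift c p + shift c g. Proof. exact: raddfD. Qed.

Lemma shiftK c p : shift (fun i => - c i) (shift c p) = p.
Proof.
rewrite (shiftE c p) [RHS]mpolyE /shift raddf_sum; apply: eq_bigr => m _ /=.
rewrite comp_mpolyZ rmorph_prod [in RHS]mpolyXE_id; congr (_ *: _); apply: eq_bigr => i _.
rewrite rmorphXn /= comp_mpolyD comp_mpolyXU comp_mpolyC -tnth_nth tnth_mktuple.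
by rewrite mpolyCN subrK.
Qed.

Lemma coefs_sum C (T : Type) (r : seq T) (P : pred T) (f : T -> {mpoly F[d]}) : is_subring C ->
  forall I, is_ideal C I -> (forall i, P i -> coefs I (f i)) -> coefs I (\sum_(i <- r | P i) f i).
Proof. by move=> HC I HI h m; rewrite raddf_sum; apply: (id_sum HI) => i Pi; apply: h. Qed.

Lemma coefs_shift C I c p : is_subring C -> is_ideal C I -> (forall i, C (c i)) -> coefs I p ->
  coefs I (shift c p).
Proof.
move=> HC HI hc hp; rewrite shiftE; apply: (coefs_sum _ HC HI) => m _ k; rewrite mcoeffZ.
apply: (idMr HI) => //; move: k.
have HCC := ideal_self HC.
suff : coefs C (\prod_(i < d) ('X_i + (c i)%:MP) ^+ m i) by [].
elim/big_rec: _ => [|i y _ hy].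
  by move=> k; rewrite mcoeff1; mem.
apply: (coefs_mul HC HCC) => //.
elim: (m i) => [|n ih]; first by move=> k; rewrite expr0 mcoeff1; mem.
rewrite exprS; apply: (coefs_mul HC HCC) => // k.
by rewrite mcoeffD mcoeffX mcoeffC; have := hc i => ?; mem.
Qed.

Lemma shift_deg c n p : (forall m, p@_m != 0 -> (mdeg m <= n)%N) ->
  forall m, (shift c p)@_m != 0 -> (mdeg m <= n)%N.
Proof.
move=> hp; rewrite shiftE => k; rewrite raddf_sum /= => nz.
have [m [pm]] : exists m, p@_m != 0 /\ (\prod_(i < d) ('X_i + (c i)%:MP) ^+ m i)@_k != 0.
  apply: contrapT => h; move/eqP: nz; apply; rewrite big_seq big1 // => m mp.
  rewrite mcoeffZ; apply/eqP/negPn/negP; rewrite mulf_eq0 negb_or => /andP[h1 h2].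
  by apply: h; exists m.
move=> h; apply: leq_trans (hp m pm); move: k h {nz}; rewrite mdegE.
elim/big_rec2: _ => [|i n1 y _ ih] k; first by rewrite mcoeff1; have [->|_] := eqVneq k 0%MM; rewrite ?mdeg0 ?eqxx.
move=> /mcoeffM_neq0[k1 [k2 [-> h1 /ih h2]]]; rewrite mdegD leq_add //.
elim: (m i) k1 h1 => [|n0 ih0] k1; first by rewrite mcoeff1; have [->|_] := eqVneq k1 0%MM; rewrite ?mdeg0 ?eqxx.
rewrite exprS => /mcoeffM_neq0[l1 [l2 [-> h1 /ih0 h2']]]; rewrite mdegD -add1n leq_add //.
move: h1; rewrite mcoeffD mcoeffX mcoeffC; have [<-|_] := eqVneq U_(i)%MM l1; first by rewrite mdeg1.
by rewrite add0r; have [->|_] := eqVneq l1 0%MM; rewrite ?mdeg0 ?mulr0 ?eqxx.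
Qed.

Lemma meval_zero p : p.@[fun=> 0] = p@_0.
Proof.
rewrite mevalE [X in _ = X@__]mpolyE raddf_sum /=; apply: eq_bigr => m _; rewrite mcoeffZ mcoeffX; congr (_ * _).
have [->|nz] := eqVneq m 0%MM; first by rewrite big1 // => i _; rewrite mnm0E.
move: nz; rewrite -mdeg_eq0 mdegE sum_nat_eq0 => /forallPn[i]; rewrite implyTb => mi.
by rewrite (bigD1 i) //= expr0n (negbTE mi) mul0r.
Qed.

Lemma shift_const c p : (shift c p)@_0 = p.@[c].
Proof.
rewrite -meval_zero /shift comp_mpoly_meval; apply: meval_eq => i.
by rewrite tnth_mktuple mevalD mevalXU mevalC add0r.
Qed.

(** Order at least j at the origin over the residue field of B; for [shift y g] this is the order of
    g at the point y. *)
Definition lowmax j p := forall m, B p@_m /\ ((mdeg m < j)%N -> maxideal B p@_m).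

Lemma lowmax_mul i j p g : lowmax i p -> lowmax j g -> lowmax (i + j) (p * g).
Proof.
move=> hp hg m; have HBB := ideal_self HB; split.
  by apply: (coefs_mul HB HBB) => k; [case: (hp k)|case: (hg k)].
move=> lt; rewrite mcoeffM; apply: (id_sum HmB) => k /eqP e.
have [B1 m1] := hp k.1; have [B2 m2] := hg k.2.
have [h1|h1] := ltnP (mdeg k.1) i; first by have := m1 h1 => ?; mem.
have dk : mdeg m = (mdeg k.1 + mdeg k.2)%N by rewrite -mdegD -e.
have h2 : (mdeg k.2 < j)%N by move: lt h1 dk; move: (mdeg k.1) (mdeg k.2) => a b; lia.
by have := m2 h2 => ?; mem.
Qed.

Lemma lowmax_add j p g : lowmax j p -> lowmax j g -> lowmax j (p + g).
Proof.
move=> hp hg m; rewrite mcoeffD; have [B1 m1] := hp m; have [B2 m2] := hg m; split; first by mem.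
by move=> lt; have := m1 lt => ?; have := m2 lt => ?; mem.
Qed.

(** Over the residue field p has a nonzero constant term and is invertible as a power series; the
    induction on degree replaces that inverse. *)
Lemma lowmax_cancel j p g : coefs B p -> ~ maxideal B p@_0 -> coefs B g -> lowmax j (p * g) -> lowmax j g.
Proof.
move=> hp np hg hpg m; split=> //; move: {2}(mdeg m) (leqnn (mdeg m)) => n.
elim: n m => [|n ih] m lem ltj.
  have e : m = 0%MM by apply/eqP; rewrite -mdeg_eq0 -leqn0.
  rewrite e in ltj *; have [_ /(_ ltj)] := hpg 0%MM; rewrite (_ : (p * g)@_0 = p@_0 * g@_0).
    by move=> /(primeM (max_prime qt_local) (hp _) (hg _))[].
  exact: (rmorphM (mcoeff 0%MM)).
have [_ /(_ ltj)] := hpg m; set u := (p - (p@_0)%:MP) * g.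
have -> : p * g = (p@_0)%:MP * g + u by rewrite /u; ring.
rewrite mcoeffD mcoeffCM => h.
have mu : maxideal B u@_m.
  rewrite mcoeffM; apply: (id_sum HmB) => k /eqP e.
  rewrite mcoeffB mcoeffC; have [->|nz] := eqVneq (k.1 : 'X_{1..d}) 0%MM.
    by rewrite mulr1 subrr mul0r; mem.
  rewrite mulr0 subr0; have := hp k.1 => ?; suff : maxideal B g@_k.2 by move=> ?; mem.
  have dk : mdeg m = (mdeg k.1 + mdeg k.2)%N by rewrite -mdegD -e.
  have k10 : (0 < mdeg k.1)%N by rewrite lt0n mdeg_eq0.
  have : (mdeg k.2 < mdeg m)%N by move: k10 dk; move: (mdeg k.1) (mdeg k.2) => a b; lia.
  move=> lt; apply: ih; first by rewrite -ltnS; apply: leq_trans lt lem.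
  exact: ltn_trans lt ltj.
have : maxideal B (p@_0 * g@_m) by rewrite (_ : _ * _ = p@_0 * g@_m + u@_m - u@_m); [mem|ring].
by move=> /(primeM (max_prime qt_local) (hp _) (hg _))[].
Qed.
End Translate.

Lemma form_meval (s : seq F) (n : nat) (p : {mpoly F[size s]}) (y : 'I_(size s) -> F) :
  (forall i : 'I_(size s), s`_i = x * y i) -> form A (size s) n p ->
  p.@[fun i : 'I_(size s) => s`_i] = x ^+ n * p.@[y].
Proof.
move=> hy hp; rewrite !mevalE mulr_sumr !big_seq; apply: eq_bigr => m.
rewrite mcoeff_msupp => /hp[_ <- _]; rewrite mulrCA; congr (_ * _).
rewrite mdegE (big_morph (fun n => x ^+ n) (exprD x) (expr0 x)) -big_split /=.
by apply: eq_bigr => i _; rewrite hy exprMn.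
Qed.

(* A form f of degree n with f(y) in the (n+1)-st power of the maximal ideal of B, y = v/x, has all
   its translated coefficients up to degree n, i.e. all its coefficients, in that maximal ideal. *)
Lemma qt_ord n a : regular_local A -> ideal_pow A (maxideal A) n a -> ~ ideal_pow A (maxideal A) n.+1 a ->
  ~ ideal_pow B (maxideal B) n.+1 (a / x ^+ n).
Proof.
move=> HR ha na; have [s [rs xs]] := regular_rsop_in HR mx m2x.
have [sA es _] := rs; have HAA := ideal_self HA; have HBB := ideal_self HB.
pose d := size s; pose v (i : 'I_d) := s`_i; pose y (i : 'I_d) := s`_i / x.
have hy (i : 'I_d) : s`_i = x * y i by rewrite /y; field.
have By i : B (y i).
  by apply: qt_div; rewrite es; apply: span_gen => //; exact: mem_nth.
have idx : (index x s < d)%N by rewrite index_mem.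
pose i0 := Ordinal idx; have yi0 : y i0 = 1 by rewrite /y /= nth_index // divff.
have lift k z : ideal_pow A (maxideal A) k z -> exists p : {mpoly F[d]}, form A d k p /\ p.@[y] = z / x ^+ k.
  move=> /(pow_form HL rs)[p [hp ->]]; exists p; split=> //.
  by rewrite (form_meval hy hp); field; rewrite xn0.
have Bc k (p : {mpoly F[d]}) : form A d k p -> coefs B (shift y p).
  move=> hp; apply: (coefs_shift HB HBB) => // m; apply: qt_sub; exact: (formC HAA hp).
(* These z are fractions g(y)/t(y) of forms of equal degree with t(y) a unit of B and g of order at
   least j at y. They form an ideal, multiply additively in j, and contain the maximal ideal for j =
   1, hence its j-th power for every positive j. *)
pose Js j z := B z /\ exists N (t g : {mpoly F[d]}), [/\ form A d N t, form A d N g, ~ maxideal B t.@[y],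
   t.@[y] * z = g.@[y] & lowmax j (shift y g)].
have low0 k (p : {mpoly F[d]}) : form A d k p -> lowmax 0 (shift y p).
  by move=> hp m; split=> //; exact: (Bc _ _ hp).
have Bev k (p : {mpoly F[d]}) : form A d k p -> B p.@[y].
  by move=> hp; rewrite -shift_const; exact: (Bc _ _ hp).
have nM u w : B u -> B w -> ~ maxideal B u -> ~ maxideal B w -> ~ maxideal B (u * w).
  by move=> Bu Bw nu nw; exact: (primeMN (max_prime qt_local)).
have HJ j : is_ideal B (Js j).
  split.
  - by move=> z [].
  - split; first by mem.
    have h1 : form A d 0 (1 : {mpoly F[d]}).
      move=> m; rewrite mcoeff1; have [->|_] := eqVneq m 0%MM; last by rewrite eqxx.
      by move=> _; split; [mem|rewrite mdeg0|move=> i _; rewrite mnm0E].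
    exists 0%N, 1, 0; split=> //; first exact: form0.
    + by rewrite meval1; exact: prime1 (max_prime qt_local).
    + by rewrite mulr0 meval0.
    + by move=> m; rewrite /shift comp_mpoly0 mcoeff0; split=> [|_]; mem.
  - move=> z1 z2 [B1 [N1 [t1 [g1 [ht1 hg1 n1 e1 l1]]]]] [B2 [N2 [t2 [g2 [ht2 hg2 n2 e2 l2]]]]].
    split; first by mem.
    exists (N1 + N2)%N, (t1 * t2), (t2 * g1 + t1 * g2); split.
    + exact: form_mul.
    + by apply: (form_add HAA); [rewrite addnC|]; exact: form_mul.
    + by rewrite mevalM; apply: nM => //; apply: Bev; eassumption.
    + by rewrite mevalM mevalD !mevalM -e1 -e2; ring.
    + rewrite shiftD !shiftM; apply: lowmax_add; rewrite -[j]add0n; apply: lowmax_mul => //; apply: low0; eassumption.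
  - move=> r z Br [Bz [N [t [g [ht hg nt e l]]]]]; split; first by mem.
    have [k [a' [b' [ha' hb' b0 nb er]]]] := qt_frac Br.
    have [p [hp ep]] := lift k a' ha'; have [q [hq eq]] := lift k b' hb'.
    exists (k + N)%N, (q * t), (p * g); split.
    + exact: form_mul.
    + exact: form_mul.
    + by rewrite mevalM; apply: nM; [exact: Bev hq|exact: Bev ht|rewrite eq|].
    + by rewrite !mevalM -e ep eq er; field; rewrite b0 xn0.
    + by rewrite shiftM -[j]add0n; apply: lowmax_mul => //; apply: low0; eassumption.
have J1 z : maxideal B z -> Js 1 z.
  move=> mz; have Bz : B z by mem.
  split=> //; have [k [a' [b' [ha' hb' b0 nb er]]]] := qt_frac Bz.
  have [p [hp ep]] := lift k a' ha'; have [q [hq eq]] := lift k b' hb'.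
  exists k, q, p; split=> //; first by rewrite eq.
    by rewrite ep eq er; field; rewrite b0 xn0.
  move=> m; split; first exact: (Bc _ _ hp).
  rewrite ltnS leqn0 mdeg_eq0 => /eqP ->; rewrite shift_const ep.
  have Bq : B (b' / x ^+ k) by exact: qt_pow.
  by rewrite (_ : a' / _ = b' / x ^+ k * z); [mem|rewrite er; field; rewrite b0 xn0].
have JM i j z1 z2 : Js i z1 -> Js j z2 -> Js (i + j)%N (z1 * z2).
  move=> [B1 [N1 [t1 [g1 [ht1 hg1 n1 e1 l1]]]]] [B2 [N2 [t2 [g2 [ht2 hg2 n2 e2 l2]]]]].
  split; first by mem.
  exists (N1 + N2)%N, (t1 * t2), (g1 * g2); split.
  + exact: form_mul.
  + exact: form_mul.
  + by rewrite mevalM; apply: nM => //; apply: Bev; eassumption.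
  + by rewrite !mevalM -e1 -e2; ring.
  + by rewrite shiftM; exact: lowmax_mul.
have Jpow j : subset_ (ideal_pow B (maxideal B) j.+1) (Js j.+1).
  apply: (pow_min (HJ _)) => t zt; elim: t j zt => [|u t ih] j //= [zt] ht; rewrite big_cons.
  have Ju : Js 1%N u by apply: J1; apply: ht; rewrite mem_head.
  case: j zt => [|j] zt; first by rewrite (size0nil zt) big_nil mulr1.
  rewrite -add1n; apply: JM => //; apply: ih => // w wt; apply: ht; rewrite in_cons wt orbT //.
have [f [hf ef]] := lift n a ha.
rewrite -ef => /Jpow[_ [N [t [g [ht hg nt e l]]]]].
(* The coordinate y_i0 = x/x is 1, so this power raises the degree of g without changing its value
   at y. Then t f - X0 g is a form with value 0, and quasi-regularity puts its coefficients in the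
   maximal ideal of A. *)
pose X0 : {mpoly F[d]} := 'X_i0 ^+ n.
have hX : form A d n X0.
  move=> m; rewrite /X0 mcoeffXn; have [<-|_] := eqVneq (U_(i0) *+ n)%MM m; last by rewrite eqxx.
  move=> _; split; first by mem.
    by rewrite mdegMn mdeg1 mul1n.
  by move=> i; rewrite leqNgt ltn_ord.
pose h := t * f - X0 * g.
have hh : form A d (N + n) h.
  apply: (form_add HAA); first exact: form_mul.
  rewrite -scaleN1r; apply: (form_scale HAA); first by mem.
  by rewrite addnC; exact: form_mul.
have h0 : h.@[y] = 0.
  by rewrite /h mevalB !mevalM e /X0 rmorphXn /= mevalXU yi0 expr1n mul1r subrr.
have ch : coefs (maxideal A) h.
  apply: (quasi_regular HL rs hh); rewrite (form_meval hy hh) h0 mulr0; exact: id0 (Hp _).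
have cm : coefs (maxideal B) (shift y h).
  by apply: (coefs_shift HB HmB) => // m; apply: qt_max; exact: ch.
have lf : lowmax n.+1 (shift y f).
  apply: (@lowmax_cancel d n.+1 (shift y t)); [exact: (Bc _ _ ht)|by rewrite shift_const|exact: (Bc _ _ hf)|].
  rewrite -shiftM (_ : t * f = X0 * g + h); last by rewrite /h; ring.
  rewrite shiftD shiftM; apply: lowmax_add.
    by rewrite -[n.+1]add0n; apply: lowmax_mul => //; exact: (low0 _ _ hX).
  by move=> m; have := cm m => ?; split=> [|_]; mem.
have cf : coefs (maxideal B) (shift y f).
  move=> m; have [->|nz] := eqVneq (shift y f)@_m 0; first by mem.
  have [_] := lf m; apply; rewrite ltnS; apply: (shift_deg (n := n) _ nz) => k /hf[_ -> _] //.
apply: na; have -> : a = f.@[v].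
  by rewrite (form_meval hy hf) ef; field; rewrite xn0.
apply: (coefs_pow HL rs hf) => m; apply: qt_contr; first exact: (formC HAA hf).
have := @coefs_shift _ B (maxideal B) (fun i => - y i) (shift y f) HB HmB; rewrite shiftK; apply=> //.
by move=> i; have := By i => ?; mem.
Qed.

End Qtrans.
End Blowup.

(** * The sequence of transforms and the boundary valuation *)

Section Order.
Variable F : fieldType.
Implicit Types (A B C I J P T : F -> Prop).

(** The order made total, with default value 0 where no order exists, in particular at a = 0. *)
Definition ordn A a : nat :=
  if pselect (exists n, ord_is A a n) is left h then sval (cid h) else 0%N.

Section OneRing.
Variable A : F -> Prop.
Hypothesis HR : regular_local A.
Let HL : is_local A. Proof. by case: HR. Qed.
Let hN : noetherian A. Proof. by case: HR. Qed.
Let HA := local_sr HL.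
Let Hm := local_mi HL.

Lemma reg_local : is_local A. Proof. exact: HL. Qed.
Lemma reg_sr : is_subring A. Proof. exact: HA. Qed.

Lemma ordP a : A a -> a != 0 -> ord_is A a (ordn A a).
Proof.
move=> Aa a0; rewrite /ordn; case: pselect => [h|nh]; first by case: (cid h).
case: nh; apply: contrapT => h; move/eqP: a0; apply; apply: (krull0 HL hN) => n.
elim: n => [|n ih]; first by rewrite pow0.
by apply: contrapT => n1; apply: h; exists n.
Qed.

Lemma ord_ge n a : A a -> a != 0 -> ideal_pow A (maxideal A) n a <-> (n <= ordn A a)%N.
Proof.
move=> Aa a0; have [h1 h2] := ordP Aa a0; split.
  move=> h; rewrite leqNgt; apply/negP => lt; apply: h2; exact: (pow_le HA Hm lt).
by move=> le; exact: (pow_le HA Hm le).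
Qed.

Lemma ord_uniq n a : A a -> a != 0 -> ord_is A a n -> n = ordn A a.
Proof.
move=> Aa a0 [h1 h2]; apply/eqP; rewrite eqn_leq; apply/andP; split; first exact/ord_ge.
by rewrite leqNgt; apply/negP => /(ord_ge _ Aa a0).2.
Qed.

Lemma ordM a b : A a -> A b -> a != 0 -> b != 0 -> ordn A (a * b) = (ordn A a + ordn A b)%N.
Proof.
move=> Aa Ab a0 b0; have [s [rs _]] := regular_rsop HR.
have [h1 h2] := ordP Aa a0; have [h3 h4] := ordP Ab b0.
symmetry; apply: ord_uniq; [mem|by rewrite mulf_neq0|split; first exact: pow_mul].
exact: (pow_mulN HL rs).
Qed.

Lemma ord_unit a : A a -> a != 0 -> ordn A a = 0%N <-> ~ maxideal A a.
Proof.
move=> Aa a0; have h := ord_ge 1 Aa a0; rewrite pow1 // in h; rewrite h.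
by split=> [->|]; [rewrite ltnn|move/negP; rewrite -leqNgt leqn0 => /eqP].
Qed.

Lemma ord_gt0 a : a != 0 -> maxideal A a -> (0 < ordn A a)%N.
Proof.
move=> a0 ma; have Aa : A a by mem.
by have h := ord_ge 1 Aa a0; rewrite pow1 // in h; apply/h.
Qed.

Lemma ord_one : ordn A 1 = 0%N.
Proof. by apply/ord_unit; [mem|rewrite oner_eq0|exact: prime1 (max_prime HL)]. Qed.

Lemma ordX n a : A a -> a != 0 -> ordn A (a ^+ n) = (n * ordn A a)%N.
Proof.
move=> Aa a0; elim: n => [|n ih]; first by rewrite expr0 ord_one.
by rewrite exprS ordM ?ih ?mulSn ?expf_neq0 //; mem.
Qed.

(** [ord_nonneg] only asks for some fraction; additivity of the order makes the choice
    irrelevant. *)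
Lemma ord_fracP a b : A a -> A b -> a != 0 -> b != 0 ->
  ord_nonneg A (a / b) <-> (ordn A b <= ordn A a)%N.
Proof.
move=> Aa Ab a0 b0; split; last first.
  move=> le; exists a, b; split=> //; exists (ordn A a), (ordn A b).
  by split=> //; exact: ordP.
move=> [c [d [Ac Ad d0 e [nc [nd [hc hd le]]]]]].
have c0 : c != 0 by apply: contraNneq (mulf_neq0 a0 (invr_neq0 b0)) => c0; rewrite e c0 mul0r.
rewrite (ord_uniq Ac c0 hc) (ord_uniq Ad d0 hd) in le.
have : ordn A (a * d) = ordn A (b * c).
  by congr ordn; rewrite -[a](divfK b0) e; field.
rewrite !ordM // => h; lia.
Qed.

Lemma ord_add n a b : A a -> A b -> a != 0 -> b != 0 -> a + b != 0 ->
  (n <= ordn A a)%N -> (n <= ordn A b)%N -> (n <= ordn A (a + b))%N.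
Proof.
move=> Aa Ab a0 b0 ab0 /(ord_ge _ Aa a0) ha /(ord_ge _ Ab b0) hb.
by apply/ord_ge => //; [mem|have Hp := pow_ideal n HA Hm; mem].
Qed.
End OneRing.
End Order.

Section Sequence.
Variables (F : fieldType) (R : nat -> F -> Prop) (x : nat -> F).
Implicit Types (A B C I J P Q T : F -> Prop).
Hypotheses (reg : forall i, regular_local (R i)) (HQ : quotient_field_of (R 0%N))
  (qt : forall i, qtrans (R i) (R i.+1) (x i)).
Let HL i := reg_local (reg i).
Let HR i := reg_sr (reg i).
Let Hm i := local_mi (HL i).

Lemma x_neq0 i : x i != 0. Proof. exact: (qt_neq0 (HL i) (qt i)). Qed.
Let x0 := x_neq0.

Lemma R_mono i j : (i <= j)%N -> subset_ (R i) (R j).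
Proof.
elim: j => [|j ih]; first by rewrite leqn0 => /eqP ->.
rewrite leq_eqVlt => /orP[/eqP -> //|/ih h] z /h; exact: (qt_sub (HL j) (qt j)).
Qed.

Lemma m_mono i j : (i <= j)%N -> subset_ (maxideal (R i)) (maxideal (R j)).
Proof.
elim: j => [|j ih]; first by rewrite leqn0 => /eqP ->.
rewrite leq_eqVlt => /orP[/eqP -> //|/ih h] z /h; exact: (qt_max (qt j)).
Qed.

Lemma m_contr i j z : (i <= j)%N -> R i z -> maxideal (R j) z -> maxideal (R i) z.
Proof.
move=> ij Rz mz; apply: contrapT => nz; have [z0 Rz1] := local_unit Rz nz.
exact: (unit_nmax (R_mono ij Rz1) z0 mz).
Qed.

Lemma x_max i j : (i <= j)%N -> maxideal (R j) (x i).
Proof. by move=> /m_mono; apply; case: (qt i). Qed.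

Lemma x_R i j : (i <= j)%N -> R j (x i).
Proof. by move=> /x_max h; have := Hm j => ?; mem. Qed.

Lemma R_quot i : quotient_field_of (R i).
Proof.
by move=> z; have [a [b [Ra Rb b0 e]]] := HQ z; exists a, b; split=> //; apply: (R_mono (leq0n i)).
Qed.

Local Notation S := (union_ring R).
Local Notation V := (boundary_valuation_ring R).

Lemma S_common y z : S y -> S z -> exists i, R i y /\ R i z.
Proof.
move=> [i Ry] [j Rz]; exists (maxn i j); split.
  exact: (R_mono (leq_maxl _ _) Ry).
exact: (R_mono (leq_maxr _ _) Rz).
Qed.

Lemma S_sr : is_subring S.
Proof.
split.
- by exists 0%N; have := HR 0 => ?; mem.
- by exists 0%N; have := HR 0 => ?; mem.
- by move=> y z /S_common h /h [i [Ry Rz]]; exists i; have := HR i => ?; mem.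
- by move=> y z /S_common h /h [i [Ry Rz]]; exists i; have := HR i => ?; mem.
Qed.
Let HS := S_sr.

Lemma S_maxP z : maxideal S z <-> exists i, maxideal (R i) z.
Proof.
split.
  move=> [[i Rz] nz]; exists i; split=> //; apply: contra_not nz => -[y [Ry e]].
  by exists y; split=> //; exists i.
move=> [i mz]; have Rz : R i z by have := Hm i => ?; mem.
split; first by exists i.
move=> [y [[j Ry] e]]; have mj := m_mono (leq_maxl i j) mz.
case: mj => _ []; exists y; split=> //; exact: (R_mono (leq_maxr i j) Ry).
Qed.

Lemma S_local : is_local S.
Proof.
split=> //; split.
- by move=> z [].
- by apply/S_maxP; exists 0%N; have := Hm 0 => ?; mem.
- move=> y z /S_maxP[i my] /S_maxP[j mz]; apply/S_maxP; exists (maxn i j).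
  have := m_mono (leq_maxl i j) my; have := m_mono (leq_maxr i j) mz.
  by have := Hm (maxn i j) => ? ? ?; mem.
- move=> a z [i Ra] /S_maxP[j mz]; apply/S_maxP; exists (maxn i j).
  have := R_mono (leq_maxl i j) Ra; have := m_mono (leq_maxr i j) mz.
  by have := Hm (maxn i j) => ? ? ?; mem.
Qed.

Lemma S_max_R i z : R i z -> maxideal S z -> maxideal (R i) z.
Proof.
move=> Rz /S_maxP[j mz]; apply: (m_contr (leq_maxl i j) Rz).
exact: (m_mono (leq_maxr i j) mz).
Qed.

(** The iterated transform of an element a of R_K at stage L: at each stage the full power of x_l is
    divided out. Below stage K the value is a by convention. *)
Fixpoint tr K a L := if L is L'.+1 then
  if (K <= L')%N then tr K a L' / x L' ^+ ordn (R L') (tr K a L') else a else a.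

Lemma tr_base K a : tr K a K = a.
Proof. by case: K => [|K] //=; rewrite ltnn. Qed.

Lemma trS K a L : (K <= L)%N -> tr K a L.+1 = tr K a L / x L ^+ ordn (R L) (tr K a L).
Proof. by move=> /= ->. Qed.

Lemma leq_ind K (P : nat -> Prop) : P K -> (forall L, (K <= L)%N -> P L -> P L.+1) ->
  forall L, (K <= L)%N -> P L.
Proof.
move=> h1 h2; elim=> [|L ih]; first by rewrite leqn0 => /eqP <-.
by rewrite leq_eqVlt => /orP[/eqP <- //|le]; apply: h2 => //; apply: ih.
Qed.

Lemma tr_in K a : R K a -> a != 0 -> forall L, (K <= L)%N -> R L (tr K a L) /\ tr K a L != 0.
Proof.
move=> Ra a0; apply: leq_ind => [|L KL [RL t0]]; first by rewrite tr_base.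
rewrite trS //; split; last by rewrite mulf_neq0 ?invr_neq0 ?expf_neq0.
by apply: (qt_pow (HL L) (qt L)); case: (ordP (reg L) RL t0).
Qed.

Lemma tr_ord K a L : R K a -> a != 0 -> (K <= L)%N ->
  (ordn (R L.+1) (tr K a L.+1) <= ordn (R L) (tr K a L))%N.
Proof.
move=> Ra a0 KL; have [RL t0] := tr_in Ra a0 KL; have [RL1 t1] := tr_in Ra a0 (leqW KL).
have [h1 h2] := ordP (reg L) RL t0.
rewrite leqNgt; apply/negP => lt; have := qt_ord (HL L) (qt L) (reg L) h1 h2.
by rewrite -trS //; apply; apply/ord_ge.
Qed.

Lemma tr_ord_le K a L M : R K a -> a != 0 -> (K <= L)%N -> (L <= M)%N ->
  (ordn (R M) (tr K a M) <= ordn (R L) (tr K a L))%N.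
Proof.
move=> Ra a0 KL; move: M; apply: leq_ind => // M LM; apply: leq_trans.
by apply: tr_ord => //; exact: leq_trans LM.
Qed.

Lemma trM K a b : R K a -> R K b -> a != 0 -> b != 0 -> forall L, (K <= L)%N ->
  tr K (a * b) L = tr K a L * tr K b L.
Proof.
move=> Ra Rb a0 b0; apply: leq_ind => [|L KL e]; first by rewrite !tr_base.
have [Ha ha] := tr_in Ra a0 KL; have [Hb hb] := tr_in Rb b0 KL.
rewrite !trS // e (ordM (reg L)) // exprD; field.
by rewrite !expf_neq0.
Qed.

Lemma tr_tr K a (J : nat) : (K <= J)%N -> forall L, (J <= L)%N -> tr J (tr K a J) L = tr K a L.
Proof.
move=> KJ; apply: leq_ind => [|L JL e]; first by rewrite tr_base.
by rewrite !trS ?e //; exact: leq_trans JL.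
Qed.

Lemma tr_prod K a : forall L, (K <= L)%N ->
  a = \prod_(K <= l < L) x l ^+ ordn (R l) (tr K a l) * tr K a L.
Proof.
apply: leq_ind => [|L KL e]; first by rewrite big_geq // mul1r tr_base.
rewrite {1}e big_nat_recr // trS // -[RHS]mulrA; congr (_ * _).
by field; rewrite expf_neq0.
Qed.

Lemma x_prod_R K L (r : nat -> nat) : R L (\prod_(K <= l < L) x l ^+ r l).
Proof.
have := HR L => H; rewrite big_nat_cond; apply: (sr_prod H) => l; rewrite andbT => /andP[_ /ltnW lL].
by apply: (srX H); exact: x_R.
Qed.

Lemma x_prod_neq0 K L (r : nat -> nat) : \prod_(K <= l < L) x l ^+ r l != 0.
Proof. by rewrite prodf_seq_neq0; apply/allP => l _; rewrite expf_neq0. Qed.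

(* An element that swallows every product x_K ... x_(L-1) is infinitely large compared to
   the element t, since the order of the transform of t never exceeds its initial value. *)
Lemma infinitely_smaller K t a n : R K t -> t != 0 -> a != 0 -> (ordn (R K) t < n)%N ->
  (forall L, (K <= L)%N -> exists r, maxideal (R L) r /\ a = \prod_(K <= l < L) x l * r) ->
  ~ V (t / a ^+ n).
Proof.
move=> Rt t0 a0 lt h [N hN]; set L := maxn K N; have KL : (K <= L)%N := leq_maxl _ _.
have := hN L (leq_maxr _ _); have [r [mr ea]] := h L KL.
have HRL := HR L; have HmL := Hm L; have Rr : R L r by mem.
have r0 : r != 0 by apply: contraNneq a0 => e; rewrite ea e mulr0.
have [RtL tL0] := tr_in Rt t0 KL.
pose s l := ordn (R l) (tr K t l).
have sn l : (K <= l)%N -> (s l <= n)%N.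
  move=> Kl; apply/ltnW/(leq_ltn_trans _ lt); have := tr_ord_le Rt t0 (leqnn K) Kl.
  by rewrite tr_base.
(* Cancelling the powers x_l^(s l), with s l <= n, leaves the denominator D of t/a^n over the
   transform of t. Its order is at least n because r is a nonunit, while the transform has order
   less than n. *)
pose D := \prod_(K <= l < L) x l ^+ (n - s l) * r ^+ n.
have RD : R L D by have := x_prod_R K L (fun l => n - s l)%N => ?; rewrite /D; mem.
have D0 : D != 0 by rewrite mulf_neq0 ?x_prod_neq0 ?expf_neq0.
have -> : t / a ^+ n = tr K t L / D.
  rewrite {1}(tr_prod t KL) -/s ea exprMn -prodrXl /D.
  have -> : \prod_(K <= l < L) x l ^+ n = \prod_(K <= l < L) x l ^+ s l * \prod_(K <= l < L) x l ^+ (n - s l).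
    rewrite -big_split /= !big_nat; apply: eq_bigr => l /andP[Kl _]; rewrite -exprD subnKC //; exact: sn.
  by field; rewrite !x_prod_neq0 expf_neq0.
move=> /(ord_fracP (reg L) RtL RD tL0 D0); apply/negP; rewrite -ltnNge.
rewrite (ordM (reg L)) ?x_prod_neq0 ?expf_neq0 //; last 2 first.
- exact: (x_prod_R K L (fun l => n - s l)%N).
- by mem.
rewrite (ordX (reg L)) //; have r1 := ord_gt0 (reg L) r0 mr.
have tn : (ordn (R L) (tr K t L) < n)%N.
  by apply: leq_ltn_trans lt; have := tr_ord_le Rt t0 (leqnn K) KL; rewrite tr_base.
apply: leq_trans tn _; apply: leq_trans (leq_addl _ _); rewrite -{1}[n]muln1 leq_mul2l r1 orbT //.
Qed.

Lemma V_of_S z : S z -> z != 0 -> V z.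
Proof.
move=> [i Rz] z0; exists i => j ij; have Rj := R_mono ij Rz; have := HR j => H.
rewrite -[z]divr1; apply/(ord_fracP (reg j)) => //; [mem|by rewrite oner_eq0|].
by rewrite (ord_one (reg j)).
Qed.

Lemma V_inv_max z : maxideal S z -> z != 0 -> ~ V z^-1.
Proof.
move=> /S_maxP[i mz] z0 [N hN]; set j := maxn i N.
have mj := m_mono (leq_maxl i N) mz; have := hN _ (leq_maxr i N); rewrite -/j.
have := HR j => H; have H' := Hm j; have Rj : R j z by rewrite -/j in mj; mem.
rewrite -div1r => /(ord_fracP (reg j)) h; have : (ordn (R j) z <= ordn (R j) 1)%N.
  by apply: h; [mem| |rewrite oner_eq0|].
by rewrite (ord_one (reg j)) leqNgt (ord_gt0 (reg j)).
Qed.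

Lemma frac_R i z : z != 0 -> exists a b, [/\ R i a, R i b, a != 0, b != 0 & z = a / b].
Proof.
move=> z0; have [a [b [Ra Rb b0 e]]] := R_quot i z; exists a, b; split=> //.
by apply: contraNneq z0 => a0; rewrite e a0 mul0r.
Qed.

Lemma V_mul y z : y != 0 -> z != 0 -> V y -> V z -> V (y * z).
Proof.
move=> y0 z0 [M hM] [N hN]; exists (maxn M N) => i; rewrite geq_max => /andP[Mi Ni].
have [a [b [Ra Rb a0 b0 ey]]] := frac_R i y0; have [c [d [Rc Rd c0 d0 ez]]] := frac_R i z0.
have := hM i Mi; have := hN i Ni; rewrite ey ez => /(ord_fracP (reg i) Rc Rd c0 d0) h1.
move=> /(ord_fracP (reg i) Ra Rb a0 b0) h2; have := HR i => H.
rewrite mulf_div; apply/(ord_fracP (reg i)); try (by rewrite mulf_neq0); try by mem.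
by rewrite !(ordM (reg i)) // leq_add.
Qed.

Lemma V_add y z : y != 0 -> z != 0 -> y + z != 0 -> V y -> V z -> V (y + z).
Proof.
move=> y0 z0 yz0 [M hM] [N hN]; exists (maxn M N) => i; rewrite geq_max => /andP[Mi Ni].
have [a [b [Ra Rb a0 b0 ey]]] := frac_R i y0; have [c [d [Rc Rd c0 d0 ez]]] := frac_R i z0.
have := hM i Mi; have := hN i Ni; rewrite ey ez => /(ord_fracP (reg i) Rc Rd c0 d0) h1.
move=> /(ord_fracP (reg i) Ra Rb a0 b0) h2; have := HR i => H.
have n0 : a * d + c * b != 0.
  by apply: contraNneq yz0 => e; rewrite ey ez addf_div // e mul0r.
rewrite addf_div //; apply/(ord_fracP (reg i)) => //; try (by rewrite mulf_neq0); try by mem.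
apply: (ord_add (reg i)); try (by rewrite mulf_neq0); try (by mem) => //.
  by rewrite !(ordM (reg i)) // leq_add2r.
by rewrite !(ordM (reg i)) // addnC leq_add2r.
Qed.

Definition at_stage k z a b := [/\ R k a, R k b, a != 0, b != 0 & z = a / b].

Lemma stage_step k z a b : at_stage k z a b -> (ordn (R k) b <= ordn (R k) a)%N ->
  exists a' b', at_stage k.+1 z a' b' /\ (ordn (R k.+1) b' <= ordn (R k) b)%N.
Proof.
move=> [Ra Rb a0 b0 e] le; set n := ordn (R k) b.
have n0 : x k ^+ n != 0 by rewrite expf_neq0.
exists (a / x k ^+ n), (b / x k ^+ n); split.
  split; try (by rewrite mulf_neq0 ?invr_neq0); last by rewrite e; field; rewrite b0 n0.
    by apply: (qt_pow (HL k) (qt k)); apply/(ord_ge (reg k)).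
  by apply: (qt_pow (HL k) (qt k)); apply/(ord_ge (reg k)).
have := tr_ord Rb b0 (leqnn k).
by rewrite trS // tr_base.
Qed.

(** Dividing both by x_k^(ord b) keeps a fraction over the next ring as long as ord b <= ord a. If
    this never fails, z lies in V. At the first failure ord a' < ord b' <= n, so the new minimum is
    below n, which feeds the descent in [V_total]. *)
Lemma stage_phase n k z a b : at_stage k z a b -> (ordn (R k) b <= ordn (R k) a)%N ->
  (ordn (R k) b <= n)%N ->
  V z \/ exists k' a' b', [/\ at_stage k' z a' b', (ordn (R k') a' < ordn (R k') b')%N & (ordn (R k') b' <= n)%N].
Proof.
move=> hs le ln; apply: contrapT => /Decidable.not_or[nV nE]; apply: nV; exists k => i.
move: i; suff key i : (k <= i)%N -> exists a' b', [/\ at_stage i z a' b',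
    (ordn (R i) b' <= ordn (R i) a')%N & (ordn (R i) b' <= n)%N].
  move=> i /key[a' [b' [[Ra Rb a0 b0 ->] le' _]]]; exact/(ord_fracP (reg i)).
move: i; apply: leq_ind => [|i ki [a' [b' [hs' le' ln']]]]; first by exists a, b.
have [a2 [b2 [hs2 le2]]] := stage_step hs' le'; have ln2 := leq_trans le2 ln'.
exists a2, b2; split=> //; rewrite leqNgt; apply/negP => lt2; apply: nE.
by exists i.+1, a2, b2.
Qed.

(* min (ord a, ord b) never increases from one stage to the next and strictly drops whenever the sign
   of ord a - ord b changes, so the sign is eventually constant. *)
Lemma V_total z : z != 0 -> V z \/ V z^-1.
Proof.
move=> z0; suff key n : forall z k a b, at_stage k z a b -> (ordn (R k) b <= ordn (R k) a)%N ->
    (ordn (R k) b <= n)%N -> V z \/ V z^-1.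
  have [a [b [Ra Rb a0 b0 e]]] := frac_R 0 z0.
  have [le|/ltnW le] := leqP (ordn (R 0) b) (ordn (R 0) a).
    by apply: (key _ z 0%N a b).
  rewrite -{1}[z]invrK; apply/or_comm; apply: (key _ z^-1 0%N b a) => //.
  by split=> //; rewrite e invf_div.
elim: n => [|n ih] {z0}z k a b hs le ln; have [Vz|[k' [a' [b' [[Ra Rb a0 b0 e] lt' ln']]]]] := stage_phase hs le ln; try by left.
  by move: lt'; rewrite (eqP (_ : ordn (R k') b' == 0%N)) // -leqn0.
rewrite -{1}[z]invrK; apply/or_comm; apply: (ih z^-1 k' b' a').
- by split=> //; rewrite e invf_div.
- exact: ltnW.
- by rewrite -ltnS; apply: leq_trans ln'.
Qed.
End Sequence.

(** * Primes of the union *)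

Section Primes.
Variable F : fieldType.
Implicit Types (A B C I J P Q T S : F -> Prop).

Definition nonzero I := exists z : F, I z /\ z != 0.

Lemma contr_sub A S P : is_subring A -> subset_ A S -> is_prime S P -> is_prime A (meet P A).
Proof.
move=> HA AS HP; split.
- split.
  + by move=> z [].
  + by split; mem.
  + by move=> u v [? ?] [? ?]; split; mem.
  + by move=> r u Ar [? ?]; split; [have := AS _ Ar => ?; mem|mem].
- by move=> [/(prime1 HP)].
- move=> a b Aa Ab [/(primeM HP (AS _ Aa) (AS _ Ab))[] ? _]; [left|right]; by split.
Qed.

Lemma nonzero_strict A P : is_prime A P -> nonzero P -> strict_sub (fun z => z = 0) P.
Proof.
move=> HP [z [Pz z0]]; split; first by move=> u ->; exact: id0 (prime_ideal HP).
by exists z; split=> //; apply/eqP.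
Qed.

Lemma strict_nonzero P Q A : is_prime A P -> strict_sub P Q -> nonzero Q.
Proof.
move=> HP [_ [z [Qz nz]]]; exists z; split=> //; apply: contra_notN nz => /eqP ->.
exact: id0 (prime_ideal HP).
Qed.

(** Chains in a domain may be started at 0, so height one means minimal among the nonzero primes. *)
Lemma height_oneP A P : is_subring A -> height_one A P <->
  [/\ is_prime A P, nonzero P & forall Q, is_prime A Q -> subset_ Q P -> nonzero Q -> Q = P].
Proof.
move=> HA; have H0 := prime_zero HA; split.
  move=> [HP [c [[h1 h2] /pred_ext e1]] hmax]; split=> //.
    by rewrite -e1; apply: (strict_nonzero (h1 0%N _)) => //; exact: h2.
  move=> Q HQ QP nQ; apply: contrapT => ne.
  have sQ := strict_subP QP ne; have s0 := nonzero_strict HQ nQ.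
  have [|c' [hc' _ e']] := @pchain_chain F A _ [:: Q; P] H0; first by [].
  by have := hmax c' 2%N hc'; rewrite /= in e'; rewrite e'; move=> /(_ (fun z => iff_refl _)).
move=> [HP nP hP]; have s0 := nonzero_strict HP nP; split=> //.
  have [|c [hc _ e]] := @pchain_chain F A _ [:: P] H0; first by [].
  by exists c; split=> //; rewrite /= in e; rewrite e.
move=> c m hc /pred_ext em; rewrite leqNgt; apply/negP => lt.
have [l [zl cl el]] := chain_pchain hc; rewrite em in el.
case: l zl cl el => [|q1 [|q2 l]] zl //=; try (by rewrite -zl in lt).
move=> [s1 Hq1 [s2 Hq2 cl]] el.
have Hc0 : is_prime A (c 0%N) by case: hc => h _; apply: h.
have s2P : subset_ q2 P by rewrite -el; exact: (pchain_last_sub cl).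
have e1 : q1 = P by apply: hP => //; [exact: sub_tr s2.1 s2P|exact: strict_nonzero Hc0 s1].
by apply: (strict_sub_ne (strict_sub_trans s2 s2P)).
Qed.

(* Maximal chains from a prime containing c up to q have bounded length, and by the principal ideal theorem
   a nonzero prime strictly below their starting point would make them longer. *)
Lemma height1_exists A q c d : is_subring A -> noetherian A -> krull_dim A d -> is_prime A q ->
  q c -> c != 0 -> exists p, [/\ is_prime A p, p c, subset_ p q &
    forall Q, is_prime A Q -> subset_ Q p -> nonzero Q -> Q = p].
Proof.
move=> HA hN [_ hd] Hq qc c0.
suff key n p l : is_prime A p -> p c -> pchain A p l -> last p l = q -> (d < n + size l)%N ->
    exists p, [/\ is_prime A p, p c, subset_ p q & forall Q, is_prime A Q -> subset_ Q p -> nonzero Q -> Q = p].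
  by apply: (key d.+1 q [::]) => //; rewrite addn0.
elim: n p l => [|n ih] p l Hp pc cl el lt.
  have [c' [hc' _ _]] := pchain_chain Hp cl; have := hd _ _ hc'.
  by rewrite leqNgt; rewrite add0n in lt; rewrite lt.
case: (EM (forall Q, is_prime A Q -> subset_ Q p -> nonzero Q -> Q = p)) => [h|].
  by exists p; split=> //; rewrite -el; exact: (pchain_last_sub cl).
move=> /existsNP[Q /not_implyP[HQ /not_implyP[Qp /not_implyP[nQ ne]]]].
have sQ := strict_subP Qp ne; have s0 := nonzero_strict HQ nQ.
have [R [HR _ sR Rc]] := pit HA hN (prime_zero HA) HQ Hp s0 sQ pc.
apply: (ih R (p :: l)) => //=; by rewrite addnS -addSn.
Qed.

(** [good] is there because a list witnessing finiteness may also contain sets that are not primes.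
    If a lies in P_n it is corrected by bu, with b in I outside P_n and u outside P_n but in every
    earlier good prime not contained in P_n. *)
Lemma prime_avoidance S I (P : nat -> F -> Prop) (good : nat -> Prop) n : is_subring S -> is_ideal S I ->
  (forall k, (k < n)%N -> good k -> is_prime S (P k) /\ ~ subset_ I (P k)) ->
  exists a, I a /\ forall k, (k < n)%N -> good k -> ~ P k a.
Proof.
move=> HS HI; elim: n => [|n ih] hP; first by exists 0; split; [mem|].
have [k kn|a [Ia ha]] := ih; first by apply: hP; exact: ltnW.
case: (EM (good n /\ P n a)) => [[gn Pa]|nPa]; last first.
  exists a; split=> // k; rewrite ltnS leq_eqVlt => /orP[/eqP -> gn Pa|]; last exact: ha.
  by apply: nPa.
have [Hn nI] := hP n (ltnSn n) gn.
have [b [Ib nb]] : exists b, I b /\ ~ P n b.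
  by apply: contrapT => h; apply: nI => b Ib; apply: contrapT => nb; apply: h; exists b.
have Sb : S b by mem.
have [u [Su nu hu]] : exists u, [/\ S u, ~ P n u & forall k, (k < n)%N -> good k ->
    ~ subset_ (P k) (P n) -> P k u].
  have : forall m, (m <= n)%N -> exists u, [/\ S u, ~ P n u & forall k, (k < m)%N -> good k ->
    ~ subset_ (P k) (P n) -> P k u]; last by move=> /(_ n (leqnn n)).
  elim=> [|m ihm] mn; first by exists 1; split=> //; [mem|exact: prime1 Hn].
  have [u [Su nu hu]] := ihm (ltnW mn).
  case: (EM (good m /\ ~ subset_ (P m) (P n))) => [[gm /existsNP[w /not_implyP[Pw nw]]]|h].
    have [Hk _] := hP m (ltnW mn) gm; have Sw : S w by mem.
    exists (u * w); split; [mem|exact: (primeMN Hn)|] => k.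
    rewrite ltnS leq_eqVlt => /orP[/eqP -> _ _|km gk sk]; first by mem.
    have [Hk' _] := hP k (leqW (leq_trans km (ltnW mn))) gk.
    by have := hu k km gk sk => ?; mem.
  exists u; split=> // k; rewrite ltnS leq_eqVlt => /orP[/eqP -> gm sm|]; last exact: hu.
  by case: h.
exists (a + b * u); split; first by mem.
have nbu : ~ P n (b * u) by exact: (primeMN Hn).
have nn : ~ P n (a + b * u).
  by move=> h; apply: nbu; rewrite (_ : b * u = (a + b * u) - a); [mem|ring].
move=> k; rewrite ltnS leq_eqVlt => /orP[/eqP -> //|kn gk].
case: (EM (subset_ (P k) (P n))) => [sk /sk //|sk h].
have [Hk _] := hP k (leqW kn) gk; have Pu := hu k kn gk sk.
by apply: (ha k kn gk); rewrite (_ : a = (a + b * u) - b * u); [mem|ring].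
Qed.

Lemma valuation_primes S P Q : valuation_ring S -> is_prime S P -> is_prime S Q ->
  subset_ P Q \/ subset_ Q P.
Proof.
move=> [HS hv] HP HQ; case: (EM (subset_ P Q)) => [|/existsNP[u /not_implyP[Pu nu]]]; first by left.
right=> w Qw; have [->|w0] := eqVneq w 0; first by have := prime_ideal HP => ?; mem.
have u0 : u != 0 by apply: contra_notN nu => /eqP ->; have := prime_ideal HQ => ?; mem.
have [h|h] := hv (w / u) (mulf_neq0 w0 (invr_neq0 u0)).
  by rewrite -(divfK u0 w); mem.
by case: nu; rewrite invf_div in h; rewrite -(divfK w0 u); mem.
Qed.
End Primes.

(** * Primes of the union compared with primes of one stage *)

Section SequencePrimes.
Variables (F : fieldType) (R : nat -> F -> Prop) (x : nat -> F).
Implicit Types (A B C I J P Q T p : F -> Prop).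
Hypotheses (reg : forall i, regular_local (R i)) (HQ : quotient_field_of (R 0%N))
  (qt : forall i, qtrans (R i) (R i.+1) (x i)).
Let HL i := reg_local (reg i).
Let HR i := reg_sr (reg i).
Let Hm i := local_mi (HL i).
Let Rm := R_mono reg qt.
Let x0 := x_neq0 reg qt.
Local Notation S := (union_ring R).
Local Notation V := (boundary_valuation_ring R).
Let HS := S_sr reg qt.
Let HSL := S_local reg qt.
Let SmaxP := S_maxP reg qt.

Lemma prime_Smax P : is_prime S P -> subset_ P (maxideal S).
Proof. exact: prime_submax. Qed.

(** Every z in m_i is a multiple in S of each x_j with j >= i, so infinitely many x_j in P would
    make P maximal. *)
Lemma nonmax_index P : is_prime S P -> P <> maxideal S -> exists N, forall i, (N <= i)%N -> ~ P (x i).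
Proof.
move=> HP ne; apply: contrapT => h; apply: ne; apply: sub_antisym => [|z /SmaxP[i mz]].
  exact: prime_Smax.
have [j [ij Px]] : exists j, (i <= j)%N /\ P (x j).
  by apply: contrapT => h'; apply: h; exists i => j ij Px; apply: h'; exists j.
have Sz : S (z / x j) by exists j.+1; apply: (qt_div (HL j) (qt j)); exact: (m_mono qt ij mz).
by rewrite -(divfK (x0 j) z); mem.
Qed.

Section OnePrime.
Variables (P : F -> Prop) (N : nat).
Hypotheses (HP : is_prime S P) (hN : forall i, (N <= i)%N -> ~ P (x i)).
Let PI := prime_ideal HP.
Local Notation p := (meet P (R N)).

Lemma P_contr : is_prime (R N) p.
Proof. by apply: (contr_sub (HR N) _ HP) => z; exists N. Qed.

(** Descent by one stage: z = a/b with a, b in R_L and b/x_L^n a unit of R_(L+1), so b is outside P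
    because x_L is. Hence S lies in the localization of R_N at the contraction of P. *)
Lemma P_den z : S z -> exists d, [/\ R N d, ~ P d & R N (d * z)].
Proof.
move=> [L Rz]; have {Rz} : R (maxn N L) z by exact: (Rm (leq_maxr _ _) Rz).
have := HR N => H.
move: (maxn N L) (leq_maxl N L) => {}L NL; move: L NL z; apply: leq_ind.
  by move=> z Rz; exists 1; split; [mem|exact: prime1 HP|rewrite mul1r].
move=> L NL ih z Rz; have [n [a [b [ha hb b0 nb e]]]] := qt_frac (HL L) (qt L) Rz.
have Hp := pow_ideal n (HR L) (Hm L).
have Ra : R L a by mem.
have Rb : R L b by mem.
have nPb : ~ P b.
  have Rb' := qt_pow (HL L) (qt L) hb.
  have Sx : S (x L) by exists L; apply: (x_R reg qt).
  have Sb : S (b / x L ^+ n) by exists L.+1.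
  rewrite -(divfK (expf_neq0 n (x0 L)) b); apply: (primeMN HP) => //.
  - exact: (srX HS).
  - by move=> /(prime_Smax HP) h; apply: nb; exact: (S_max_R reg qt Rb' h).
  - by apply: (primeXN HP HS) => //; exact: hN.
have [g [Rg ng Rgb]] := ih _ Rb; have [f [Rf nf Rfa]] := ih _ Ra.
have SR : subset_ (R N) S by move=> u; exists N.
have SL : subset_ (R L) S by move=> u; exists L.
exists (f * (g * b)); split.
- by mem.
- by apply: (primeMN HP); [exact: SR|exact: SR|exact: nf|apply: (primeMN HP); [exact: SR|exact: SL| |]].
- by rewrite (_ : _ * _ = g * (f * a)); [mem|rewrite e; field].
Qed.

Lemma P_loc z : S z -> localize (R N) p z.
Proof.
move=> /P_den[d [Rd nd Rdz]]; exists (d * z), d; split=> //; first by case.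
rewrite mulrC mulKf //; apply: contra_notN nd => /eqP ->; mem.
Qed.

(** Since S lies in the localization of R_N at p, the prime q can be extended to that localization
    and contracted to S. *)
Lemma P_ext q : is_prime (R N) q -> subset_ q p ->
  [/\ is_prime S (meet (locid (R N) p q) S), subset_ (meet (locid (R N) p q) S) P,
      subset_ q (meet (locid (R N) p q) S) &
      forall z, R N z -> meet (locid (R N) p q) S z -> q z].
Proof.
move=> Hq qp; have Hp := P_contr; have Hl := locid_prime (HR N) Hp Hq qp; split.
- exact: (contr_sub HS P_loc Hl).
- move=> z [[a [b [/qp[Pa Ra] Rb nb e]]] Sz].
  have : P (b * z).
    rewrite e mulrC divfK //; apply: contra_notN nb => /eqP ->; split; [mem|have := HR N => ?; mem].
  by have Sb : S b by [exists N]; move=> /(primeM HP Sb Sz)[] // Pb; case: nb.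
- by move=> z qz; split; [exact: (locid_sub (HR N) Hp)|exists N; have := prime_ideal Hq => ?; mem].
- by move=> z Rz [h _]; exact: (locid_mem Hp Hq qp Rz h).
Qed.

Lemma P_contr_nonzero : nonzero P -> nonzero p.
Proof.
move=> [z [Pz z0]]; have Sz : S z by mem.
have [d [Rd nd Rdz]] := P_den Sz; exists (d * z); split.
  by split=> //; have Sd : S d by [exists N]; mem.
by rewrite mulf_neq0 //; apply: contra_notN nd => /eqP ->; mem.
Qed.

Lemma P_min_contr : (forall Q, is_prime S Q -> subset_ Q P -> nonzero Q -> Q = P) ->
  forall q, is_prime (R N) q -> subset_ q p -> nonzero q -> q = p.
Proof.
move=> h q Hq qp [z [qz z0]]; have [H1 H2 H3 H4] := P_ext Hq qp.
have e := h _ H1 H2 (ex_intro _ z (conj (H3 _ qz) z0)).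
apply: sub_antisym => // w [Pw Rw]; apply: H4 => //; by rewrite e.
Qed.

(** The height one prime is found in R_N, which is noetherian of finite dimension, below the
    contraction of P and containing a multiple dc with d outside P. *)
Lemma P_height1_in c : nonzero P -> P c -> c != 0 ->
  exists Q, [/\ height_one S Q, subset_ Q P & Q c].
Proof.
move=> nP Pc c0; have Sc : S c by mem.
have [d [Rd nd Rdc]] := P_den Sc; have Sd : S d by exists N.
have dc0 : d * c != 0 by rewrite mulf_neq0 //; apply: contra_notN nd => /eqP ->; mem.
have [_ hNN [dm [hdim _]]] := reg N.
have [|q [Hq qdc qp hq]] := height1_exists (HR N) hNN hdim P_contr _ dc0; first by split; [mem|].
have [H1 H2 H3 H4] := P_ext Hq qp; set Q := meet (locid (R N) p q) S in H1 H2 H3 H4 *.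
exists Q; split=> //.
  apply/(height_oneP _ HS); split=> //; first by exists (d * c); split=> //; exact: H3.
  move=> Q' HQ' sQ' [z [Qz z0]]; apply: sub_antisym => // w Qw.
  have SN : subset_ (R N) S by move=> u; exists N.
  have eq : meet Q' (R N) = q.
    apply: hq.
    - exact: (contr_sub (HR N) SN HQ').
    - by move=> u [/sQ' ? ?]; exact: H4.
    - have Sz : S z by have := prime_ideal HQ' => ?; mem.
      have [e [Re ne Rez]] := P_den Sz; exists (e * z); split; last first.
        by rewrite mulf_neq0 //; apply: contra_notN ne => /eqP ->; mem.
      by split=> //; have := prime_ideal HQ' => ?; have := SN _ Re => ?; mem.
  have Sw : S w by case: Qw.
  have [e [Re ne Rew]] := P_den Sw; have Se := SN _ Re.
  have : q (e * w) by apply: H4 => //; have := prime_ideal H1 => ?; mem.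
  by rewrite -eq => -[/(primeM HQ' Se Sw)[] // /sQ' /H2].
have : Q (d * c) by exact: H3.
by move=> /(primeM H1 Sd Sc)[] // /H2.
Qed.

Lemma P_dvr : nonzero P -> (forall Q, is_prime S Q -> subset_ Q P -> nonzero Q -> Q = P) ->
  exists t, [/\ t != 0, maxideal (localize (R N) p) t &
    forall s, maxideal (localize (R N) p) s -> localize (R N) p (s / t)].
Proof.
move=> nP h; apply: (height1_dvr (reg N) (R_quot reg HQ qt N) P_contr).
  exact: P_contr_nonzero.
exact: P_min_contr.
Qed.
End OnePrime.
End SequencePrimes.

(** * Finitely many height one primes from conditions (1) and (3) *)

Section Easy.
Variables (F : fieldType) (R : nat -> F -> Prop) (x : nat -> F).
Implicit Types (A B C I J P Q T p : F -> Prop).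
Hypotheses (reg : forall i, regular_local (R i)) (HQ : quotient_field_of (R 0%N))
  (qt : forall i, qtrans (R i) (R i.+1) (x i)).
Let HL i := reg_local (reg i).
Let HR i := reg_sr (reg i).
Let Hm i := local_mi (HL i).
Let Rm := R_mono reg qt.
Let x0 := x_neq0 reg qt.
Local Notation S := (union_ring R).
Local Notation V := (boundary_valuation_ring R).
Let HS := S_sr reg qt.
Let HSL := S_local reg qt.
Let SmaxP := S_maxP reg qt.

Lemma valuation_finite : valuation_ring S -> finitely_many_height_one S.
Proof.
move=> hv; case: (EM (exists Q, height_one S Q)) => [[Q hQ]|n]; last first.
  by exists 0%N, (fun _ _ => False) => Q hQ; case: n; exists Q.
exists 1%N, (fun _ => Q) => Q' hQ'; exists 0%N; split=> //.
have [H1 n1 m1] := (height_oneP Q HS).1 hQ; have [H2 n2 m2] := (height_oneP Q' HS).1 hQ'.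
by have [h|h] := valuation_primes hv H1 H2; [rewrite (m2 _ H1 h n1)|rewrite (m1 _ H2 h n2)].
Qed.

Lemma dim_chain3 P Q d : krull_dim S d -> is_prime S P -> is_prime S Q -> nonzero P -> strict_sub P Q ->
  (2 <= d)%N.
Proof.
move=> [_ hd] HP HQ1 nP sPQ; have H0 := prime_zero HS; have s0 := nonzero_strict HP nP.
have [|c [hc _ _]] := @pchain_chain F S _ [:: P; Q] H0; first by [].
exact: hd hc.
Qed.

Lemma dim_chain4 P Q T d : krull_dim S d -> is_prime S P -> is_prime S Q -> is_prime S T -> nonzero P ->
  strict_sub P Q -> strict_sub Q T -> (3 <= d)%N.
Proof.
move=> [_ hd] HP HQ1 HT nP sPQ sQT; have H0 := prime_zero HS; have s0 := nonzero_strict HP nP.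
have [|c [hc _ _]] := @pchain_chain F S _ [:: P; Q; T] H0; first by [].
exact: hd hc.
Qed.

Lemma dim1_finite : krull_dim S 1 -> finitely_many_height_one S.
Proof.
move=> hd; exists 1%N, (fun _ => maxideal S) => Q hQ; exists 0%N; split=> //.
have [H1 n1 _] := (height_oneP Q HS).1 hQ.
suff -> : Q = maxideal S by [].
apply: contrapT => ne; have := dim_chain3 hd H1 (max_prime HSL) n1.
by move=> h; apply: notF; apply: h; apply: strict_subP => //; exact: prime_submax.
Qed.

(** Dividing an element of Q by x_L stays in Q, since x_L is outside Q, and the division can be
    repeated at every stage. This supplies the divisibility required by [infinitely_smaller]. *)
Lemma swallow Q N K t : is_prime S Q -> (forall i, (N <= i)%N -> ~ Q (x i)) -> (N <= K)%N -> R K t -> Q t ->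
  forall L, (K <= L)%N -> exists r, [/\ maxideal (R L) r, Q r & t = \prod_(K <= l < L) x l * r].
Proof.
move=> HQ1 hN NK Rt Qt.
have maxQ L r : R L r -> Q r -> maxideal (R L) r.
  by move=> Rr /(prime_submax HQ1); exact: (S_max_R reg qt).
apply: leq_ind => [|L KL [r [mr Qr e]]]; first by exists t; rewrite big_geq // mul1r; split=> //; exact: maxQ.
have Rr : R L.+1 (r / x L) by exact: (qt_div (HL L) (qt L)).
have Qr' : Q (r / x L).
  have Sx : S (x L) by exists L; exact: (x_R reg qt).
  have Sr : S (r / x L) by exists L.+1.
  have : Q (x L * (r / x L)) by rewrite mulrC divfK.
  by move=> /(primeM HQ1 Sx Sr)[] //; move/hN: (leq_trans NK KL).
exists (r / x L); split=> //; first exact: maxQ.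
by rewrite big_nat_recr //= e; field.
Qed.

Section ValueGroup.
Variables (G : rat -> Prop) (w : F -> int * rat).
Hypotheses (wM : forall y z, y != 0 -> z != 0 -> w (y * z) = ((w y).1 + (w z).1, (w y).2 + (w z).2))
  (ws : forall n g, G g -> exists y, y != 0 /\ w y = (n, g)) (G0 : G 0)
  (wV : forall y, y != 0 -> (V y <-> lex_nonneg (w y))).

Let w1 y := (w y).1.
Let w1M y z : y != 0 -> z != 0 -> w1 (y * z) = w1 y + w1 z.
Proof. by move=> y0 z0; rewrite /w1 wM. Qed.
Let w11 : w1 1 = 0.
Proof. by have := w1M (oner_neq0 F) (oner_neq0 F); rewrite mulr1; move: (w1 1) => u h; lia. Qed.
Let w1V y : y != 0 -> w1 y^-1 = - w1 y.
Proof.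
move=> y0; have := w1M y0 (invr_neq0 y0); rewrite divff // w11 => h; lia.
Qed.
Let w1X y n : y != 0 -> w1 (y ^+ n) = w1 y * n%:Z.
Proof.
move=> y0; elim: n => [|n ih]; first by rewrite expr0 w11 mulr0.
by rewrite exprS w1M ?expf_neq0 // ih; lia.
Qed.
Let w1V0 y : y != 0 -> V y -> 0 <= w1 y.
Proof. by move=> y0 /(wV y0)[|[]] h; rewrite /w1; lia. Qed.
Let w1S y : y != 0 -> S y -> 0 <= w1 y.
Proof. by move=> y0 Sy; apply: w1V0 => //; apply: (V_of_S reg qt). Qed.
Let P' z := S z /\ (z = 0 \/ 0 < w1 z).

Let P'_add y z : P' y -> P' z -> P' (y + z).
Proof.
move=> [Sy hy] [Sz hz]; split; first by mem.
have [->|y0] := eqVneq y 0; first by rewrite add0r.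
have [->|z0] := eqVneq z 0; first by rewrite addr0.
case: hy => [/eqP|hy]; first by rewrite (negbTE y0).
case: hz => [/eqP|hz]; first by rewrite (negbTE z0).
have [->|s0] := eqVneq (y + z) 0; [by left|right].
wlog h : y z y0 z0 s0 hy hz Sy Sz / V (z / y).
  move=> hw; have [h|h] := V_total reg HQ qt (mulf_neq0 z0 (invr_neq0 y0)).
    exact: (hw y z).
  by rewrite addrC; apply: hw => //; [rewrite addrC|rewrite invf_div in h].
have e : y + z = y * (1 + z / y) by field.
have u0 : 1 + z / y != 0 by apply: contraNneq s0 => u0; rewrite e u0 mulr0.
rewrite e w1M //; have : 0 <= w1 (1 + z / y); last by lia.
apply: w1V0 => //; apply: (V_add reg HQ qt) => //; rewrite ?oner_neq0 ?mulf_neq0 ?invr_neq0 //.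
by apply: (V_of_S reg qt); [mem|exact: oner_neq0].
Qed.

Let P'_prime : is_prime S P'.
Proof.
split; first split.
- by move=> z [].
- by split; [mem|left].
- exact: P'_add.
- move=> a z Sa [Sz hz]; split; first by mem.
  have [->|a0] := eqVneq a 0; first by left; rewrite mul0r.
  have [->|z0] := eqVneq z 0; first by left; rewrite mulr0.
  case: hz => [/eqP|hz]; first by rewrite (negbTE z0).
  by right; rewrite w1M //; have := w1S a0 Sa; lia.
- by move=> [_ [/eqP|]]; rewrite ?oner_eq0 // w11.
- move=> a b Sa Sb [_ h].
  have [e|a0] := eqVneq a 0; first by left; split; [|left].
  have [e|b0] := eqVneq b 0; first by right; split; [|left].
  case: h => [/eqP|h]; first by rewrite mulf_eq0 (negbTE a0) (negbTE b0).
  rewrite w1M // in h;   case: (boolP (0 < w1 a)) => ha; first by left; split; [|right].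
  by right; split=> //; right; lia.
Qed.

Lemma value_group_finite : krull_dim S 2 -> finitely_many_height_one S.
Proof.
move=> hd; exists 1%N, (fun _ => P') => Q hQ; exists 0%N; split=> //.
have [HQ1 nQ hmin] := (height_oneP Q HS).1 hQ.
suff -> : Q = P' by [].
have Hmx := max_prime HSL.
(* In dimension 2 the middle prime of a chain is nonzero and strictly below the maximal ideal, which
   therefore does not have height one. *)
have nmax : Q <> maxideal S.
  move=> e; have [[c [h1 h2]] _] := hd.
  have s1 := h2 0%N isT; have s2 := h2 1%N isT.
  have cm : subset_ (c 2%N) (maxideal S) by apply: prime_submax; exact: h1.
  have n1 := strict_nonzero (h1 0%N isT) s1.
  apply: (strict_sub_ne (strict_sub_trans s2 cm)); rewrite -e; apply: hmin => //; first exact: h1.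
  by rewrite e; exact: sub_tr s2.1 cm.
have [N hN] := nonmax_index reg qt HQ1 nmax.
have stage t : Q t -> exists K, (N <= K)%N /\ R K t.
  move=> Qt; have [i Ri] : S t by mem.
  by exists (maxn N i); split; [exact: leq_maxl|exact: (Rm (leq_maxr _ _))].
have sQ : subset_ Q P'.
  move=> t Qt; have St : S t by mem.
  split=> //; have [t0|t0] := eqVneq t 0; [by left|right].
  rewrite ltNge; apply/negP => h; have wt : w1 t = 0 by have := w1S t0 St; lia.
  have [K [NK Rt]] := stage t Qt.
  (* An element of Z-component 1 has a numerator a with positive Z-component. If t had component 0,
     every a/t^n would lie in V, against [infinitely_smaller]. *)
  have [z [z0 ez]] := ws 1 G0; have [a [b [Ra Rb a0 b0 e]]] := frac_R reg HQ qt K z0.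
  have wa : 0 < w1 a.
    have e' : a = z * b by rewrite e divfK.
    have : w1 a = w1 z + w1 b by rewrite e' w1M.
    by have := w1S b0 (ex_intro _ K Rb); rewrite /w1 ez /=; lia.
  have := @infinitely_smaller F R x reg qt K a t (ordn (R K) a).+1 Ra a0 t0 (ltnSn _).
  move=> h'; apply: h'.
    move=> L KL; have [r [mr _ er]] := swallow HQ1 hN NK Rt Qt KL; by exists r.
  apply/wV; first by rewrite mulf_neq0 ?invr_neq0 ?expf_neq0.
  left; rewrite -/(w1 _) w1M ?invr_neq0 ?expf_neq0 // w1V ?expf_neq0 // w1X // wt; lia.
apply: contrapT => ne; have sQP := strict_subP sQ ne.
(* With Q strictly inside P', dimension 2 leaves only P' maximal. Then each x_l has Z-component at
   least 1, while a nonzero t in Q is divisible by arbitrarily long products of them. *)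
have [eP|neP] := EM (P' = maxideal S); last first.
  have sP := strict_subP (prime_submax P'_prime) neP.
  by have := dim_chain4 hd HQ1 P'_prime Hmx nQ sQP sP.
have wx l : 1 <= w1 (x l).
  have : P' (x l) by rewrite eP; apply/SmaxP; exists l; exact: (x_max qt).
  by move=> [_ [/eqP|]]; [rewrite (negbTE (x0 l))|lia].
have [t [Qt t0]] := nQ; have [K [NK Rt]] := stage t Qt.
have grow L : (K <= L)%N -> (L - K)%:Z <= w1 (\prod_(K <= l < L) x l) /\ \prod_(K <= l < L) x l != 0.
  move: L; apply: leq_ind => [|L KL [ih nz]]; first by rewrite big_geq // w11 subnn oner_neq0.
  rewrite big_nat_recr //=; split; last by rewrite mulf_neq0.
  by rewrite w1M //; move: (wx L) ih; move: (w1 (x L)) (w1 (\prod_(K <= l < L) x l)) => u u1; lia.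
have [M [KM hM]] : exists M, (K <= M)%N /\ (absz (w1 t) < M - K)%N.
  by exists (K + (absz (w1 t)).+1)%N; rewrite leq_addr addKn.
have [r [mr Qr er]] := swallow HQ1 hN NK Rt Qt KM; have [g1 g2] := grow _ KM.
have r0 : r != 0 by apply: contraNneq t0 => e; rewrite er e mulr0.
have Sr : S r by mem.
have : w1 t = w1 (\prod_(K <= l < M) x l) + w1 r by rewrite -w1M // -er.
move: (w1S r0 Sr) g1 hM; move: (w1 (\prod_(K <= l < M) x l)) (w1 t) (w1 r) => u1 u2 u3.
by lia.
Qed.
End ValueGroup.
End Easy.

(** * Finite intersections of valuation rings *)

Section Valuations.
Variable F : fieldType.
Implicit Types (A B C I J P Q T S W : F -> Prop).

Lemma zorn_prime S D u : is_subring S -> is_ideal S D -> S u -> (forall e, ~ D (u ^+ e)) ->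
  exists Q, [/\ is_prime S Q, subset_ D Q & ~ Q u].
Proof.
move=> HS HD Su hu.
pose good X := [/\ is_ideal S X, subset_ D X & forall e, ~ X (u ^+ e)].
pose X0 (X : classical_sets.set F) := (forall z, ~ X z) \/ good X.
have [|Q [hQ mQ]] := @classical_sets.Zorn_bigcup F X0.
  move=> C CX tC; case: (EM (exists X, C X /\ good X)) => [[X [CX' gX]]|nC]; last first.
    left=> z [X CX' Xz]; case: (CX _ CX') => [h|gX]; first exact: h Xz.
    by apply: nC; exists X.
  have tot Y Z : C Y -> C Z -> subset_ Y Z \/ subset_ Z Y by move=> CY CZ; exact: tC.
  have ne Y z : C Y -> Y z -> good Y.
    by move=> CY Yz; case: (CX _ CY) => // h; case: (h z).
  right; split; first split.
  - by move=> z [Y CY Yz]; have [HY _ _] := ne _ _ CY Yz; exact: (idS HY Yz).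
  - by exists X => //; have [HX _ _] := gX; exact: (id0 HX).
  - move=> y z [Y CY Yy] [Z CZ Zz]; have [HY _ _] := ne _ _ CY Yy; have [HZ _ _] := ne _ _ CZ Zz.
    have [s|s] := tot _ _ CY CZ; [exists Z => //; have := s _ Yy|exists Y => //; have := s _ Zz]; move=> ?; mem.
  - by move=> a z Sa [Y CY Yz]; exists Y => //; have [HY _ _] := ne _ _ CY Yz; mem.
  - by move=> z Dz; exists X => //; have [_ h _] := gX; exact: h.
  - by move=> e [Y CY Yz]; have [_ _ h] := ne _ _ CY Yz; exact: h Yz.
have max_ J : good J -> subset_ Q J -> subset_ J Q.
  by move=> gJ QJ; apply: contrapT => nJ; apply: (mQ J); [split|right].
have gQ : good Q.
  case: hQ => // e; have gD : good D by split.
  by have := max_ D gD (fun z Qz => False_ind _ (e z Qz)) 0 (id0 HD) => /e.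
have [HQ DQ nQ] := gQ.
have nQu : ~ Q u by move=> Qu; apply: (nQ 1%N); rewrite expr1.
exists Q; split=> //; split=> //; first by move=> Q1; apply: (nQ 0%N); rewrite expr0.
have step a : S a -> ~ Q a -> exists e, isum Q (principal S a) (u ^+ e).
  move=> Sa na; apply: contrapT => h; apply: na; have Ha := principal_ideal HS Sa.
  apply: (max_ (isum Q (principal S a))).
  - split; first exact: isum_ideal.
      by apply: sub_tr DQ _; exact: (isum_l Ha).
    by move=> e he; apply: h; exists e.
  - exact: (isum_l Ha).
  - by apply: (isum_r HQ); exact: principal_self.
move=> a b Sa Sb Qab; apply: contrapT => /Decidable.not_or[na nb].
have [i [y [_ [Qy [r [Sr ->]] ei]]]] := step a Sa na.
have [j [z [_ [Qz [s [Ss ->]] ej]]]] := step b Sb nb.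
apply: (nQ (i + j)%N); rewrite exprD ei ej.
rewrite (_ : _ * _ = y * (z + s * b) + r * a * z + r * s * (a * b)); last by ring.
mem.
Qed.

Definition vunit W (z : F) := z != 0 /\ W z^-1.

Lemma vunit_add W u v : valuation_ring W -> W u -> W v -> vunit W (u + v) -> vunit W u \/ vunit W v.
Proof.
move=> [HW hv] Wu Wv [w0 Ww].
wlog h : u v Wu Wv w0 Ww / v = 0 \/ W (u / v).
  move=> hw; have [v0|v0] := eqVneq v 0; first by apply: hw => //; left.
  have [u0|u0] := eqVneq u 0; first by apply/or_comm; apply: hw; rewrite ?[v + u]addrC //; left.
  have [h|h] := hv (u / v) (mulf_neq0 u0 (invr_neq0 v0)); first by apply: hw => //; right.
  by rewrite invf_div in h; apply/or_comm; apply: hw; rewrite ?[v + u]addrC //; right.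
case: (eqVneq v 0) h => [v0 _|v0 [/eqP|h]]; first by left; move: w0 Ww; rewrite v0 addr0.
  by rewrite (negbTE v0).
right; split=> //; rewrite (_ : v^-1 = (u + v)^-1 * (1 + u / v)); first by mem.
by field; rewrite v0 w0.
Qed.

Definition gsum (y : F) k := \sum_(i < k) y ^+ i.

Lemma gsumS y k : gsum y k.+1 = 1 + y * gsum y k.
Proof. by rewrite /gsum big_ord_recl expr0 mulr_sumr; congr (_ + _); apply: eq_bigr => i _; rewrite -exprS. Qed.

Lemma gsumD y m k : gsum y (m + k) = gsum y m + y ^+ m * gsum y k.
Proof.
rewrite /gsum big_split_ord /=; congr (_ + _); rewrite mulr_sumr; apply: eq_bigr => i _.
by rewrite exprD.
Qed.

Lemma gsum_in W y k : is_subring W -> W y -> W (gsum y k).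
Proof. by move=> HW Wy; apply: (sr_sum HW) => i _; apply: (srX HW). Qed.

Lemma gsum_inv y k : y != 0 -> gsum y k.+1 = y ^+ k * gsum y^-1 k.+1.
Proof.
move=> y0; rewrite /gsum mulr_sumr (reindex_inj rev_ord_inj) /=; apply: eq_bigr => i _.
have ik : (i <= k)%N by rewrite -ltnS.
rewrite subSS exprVn; move: (i : nat) ik => j jk.
by rewrite -[in RHS](subnK jk) exprD mulfK ?expf_neq0.
Qed.

Lemma vunit_gsum_max W y k : valuation_ring W -> W y -> ~ vunit W y -> vunit W (gsum y k.+1).
Proof.
move=> hW Wy ny; have [HW _] := hW; have Wk := gsum_in k HW Wy; have Wk1 := gsum_in k.+1 HW Wy.
have [|||//|] := @vunit_add W (gsum y k.+1) (- (y * gsum y k)) hW => //; first by mem.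
  by rewrite gsumS addrK; split; rewrite ?oner_neq0 ?invr1 //; mem.
move=> [v0 Wv]; case: ny; rewrite oppr_eq0 mulf_eq0 negb_or in v0; case/andP: v0 => y0 g0.
split=> //; rewrite (_ : y^-1 = (- (y * gsum y k))^-1 * - gsum y k); first by mem.
by rewrite invrN mulrNN; field; rewrite y0 g0.
Qed.

(* If y is a unit of W, its residue class is a root of 1 + T + ... + T^(k-1) only for the multiples k of
   a fixed d > 1. *)
Lemma gsum_valuation W y : valuation_ring W -> y != 0 -> exists d, (1 < d)%N /\
  forall k, (0 < k)%N -> ~~ (d %| k)%N -> gsum y k != 0 /\ forall j, (j < k)%N -> W (y ^+ j / gsum y k).
Proof.
move=> hW y0; have [HW hv] := hW.
case: (EM (vunit W y)) => [[_ Wy1]|nu]; last first.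
  have Wy : W y by case: (hv y y0) => // Wy1; case: nu.
  exists 2%N; split=> // -[|k] // _ _; have [g0 Wg] := vunit_gsum_max k hW Wy nu.
  by split=> // j _; have ? := srX HW j Wy; mem.
have [Wy|nWy] := EM (W y); last first.
  exists 2%N; split=> // -[|k] // _ _; have ny1 : ~ vunit W y^-1 by move=> [_]; rewrite invrK.
  have [g0 Wg] := vunit_gsum_max k hW Wy1 ny1.
  rewrite gsum_inv //; split; first by rewrite mulf_neq0 ?expf_neq0.
  move=> j; rewrite ltnS => jk.
  rewrite (_ : _ / _ = y^-1 ^+ (k - j) * (gsum y^-1 k.+1)^-1); first by have ? := srX HW (k - j) Wy1; mem.
  rewrite invfM mulrA; congr (_ * _).
  by rewrite exprVn -{1}(subnK jk) exprD invfM mulrCA divff ?mulr1 // expf_neq0.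
suff [d [d1 hd]] : exists d, (1 < d)%N /\ forall k, (0 < k)%N -> ~~ (d %| k)%N -> vunit W (gsum y k).
  exists d; split=> // k k0 dk; have [g0 Wg] := hd k k0 dk; split=> // j _.
  by have ? := srX HW j Wy; mem.
case: (EM (forall k, (0 < k)%N -> vunit W (gsum y k))) => [h|nh].
  by exists 2%N; split=> // k k0 _; exact: h.
have [d [d0 nd md]] : exists d, [/\ (0 < d)%N, ~ vunit W (gsum y d) &
    forall k, (0 < k)%N -> (k < d)%N -> vunit W (gsum y k)].
  have [k0 [k00 nk0]] : exists k, (0 < k)%N /\ ~ vunit W (gsum y k).
    by apply: contrapT => h; apply: nh => k k0; apply: contrapT => nk; apply: h; exists k.
  elim/ltn_ind: k0 k00 nk0 => k ih k0 nk.
  case: (EM (exists j, [/\ (0 < j)%N, (j < k)%N & ~ vunit W (gsum y j)])) => [[j [j0 jk nj]]|h].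
    exact: (ih j).
  exists k; split=> // j j0 jk; apply: contrapT => nj; apply: h; by exists j.
have d1 : (1 < d)%N.
  case: d d0 nd {md} => [|[|d]] // _ nd; case: nd.
  by rewrite /gsum big_ord1 expr0; split; rewrite ?oner_neq0 ?invr1 //; mem.
exists d; split=> // k k0 dk; apply: contrapT => nk; move/negP: dk; apply.
(* As [gsum y k - gsum y d = y ^+ d * gsum y (k - d)], the indices of nonunits are stable under
   subtracting d. *)
elim/ltn_ind: k k0 nk => k ih k0 nk.
have [lt|le] := ltnP k d; first by case: nk; exact: md.
have [e|lt] := eqVneq k d; first by rewrite e.
have kd : (0 < k - d)%N by rewrite subn_gt0 ltn_neqAle eq_sym lt.
rewrite -(subnKC le) dvdn_addr //; apply: ih => //; first by lia.
move=> [g0 Wg]; have Wd := gsum_in d HW Wy; have Wk := gsum_in k HW Wy.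
have e : gsum y k + - gsum y d = y ^+ d * gsum y (k - d) by rewrite -{1}(subnKC le) gsumD; ring.
have [|||//|[g1 Wg1]] := @vunit_add W (gsum y k) (- gsum y d) hW => //; first by mem.
  rewrite e; split; first by rewrite mulf_neq0 ?expf_neq0.
  rewrite (_ : _^-1 = y^-1 ^+ d * (gsum y (k - d))^-1); first by have ? := srX HW d Wy1; mem.
  by rewrite invfM exprVn.
apply: nd; split; first by rewrite -oppr_eq0.
by rewrite (_ : _^-1 = - (- gsum y d)^-1); [mem|rewrite invrN opprK].
Qed.

(* For suitable k the elements y^j/(1 + y + ... + y^(k-1)) with j < k lie in all the valuation rings; they
   sum to 1, so one of them is a unit of S. *)
Lemma local_inter_valuation S (W : nat -> F -> Prop) n : is_local S -> (forall i, (i < n)%N -> valuation_ring (W i)) ->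
  (forall y, y != 0 -> (forall i, (i < n)%N -> W i y) -> S y) -> valuation_ring S.
Proof.
move=> HL hW hS; have HS := local_sr HL; have Hm := local_mi HL; split=> // y y0.
have [d hd] : exists d : nat -> nat, forall i, (i < n)%N -> (1 < d i)%N /\ forall k, (0 < k)%N ->
    ~~ (d i %| k)%N -> gsum y k != 0 /\ forall j, (j < k)%N -> W i (y ^+ j / gsum y k).
  have h i : exists d, (i < n)%N -> (1 < d)%N /\ forall k, (0 < k)%N ->
      ~~ (d %| k)%N -> gsum y k != 0 /\ forall j, (j < k)%N -> W i (y ^+ j / gsum y k).
    case: (ltnP i n) => [lt|]; last by exists 0%N.
    by have [d hd] := gsum_valuation (hW i lt) y0; exists d.
  by exists (fun i => sval (cid (h i))) => i; exact: (svalP (cid (h i))).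
pose k := (1 + \prod_(i < n) d i)%N.
have k1 : (1 < k)%N.
  by rewrite /k ltnS; apply: prodn_gt0 => i; have [/ltnW] := hd i (ltn_ord i).
have dk i : (i < n)%N -> ~~ (d i %| k)%N.
  move=> lt; rewrite /k dvdn_addl; last by rewrite (bigD1 (Ordinal lt)) //= dvdn_mulr.
  by rewrite dvdn1; have [h _] := hd i lt; rewrite neq_ltn h orbT.
have [g0|g0] := eqVneq (gsum y k) 0.
  have n0 : n = 0%N.
    apply/eqP; rewrite -leqn0 leqNgt; apply/negP => lt.
    by have [_ h] := hd 0%N lt; have [] := h k (ltnW k1) (dk _ lt); rewrite g0 eqxx.
  by left; apply: hS => // i; rewrite n0.
have Sz j : (j < k)%N -> S (y ^+ j / gsum y k).
  move=> jk; apply: hS; first by rewrite mulf_neq0 ?invr_neq0 ?expf_neq0.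
  by move=> i lt; have [_ h] := hd i lt; have [_ h2] := h k (ltnW k1) (dk _ lt); exact: h2.
have [j [jk nj]] : exists j, (j < k)%N /\ ~ maxideal S (y ^+ j / gsum y k).
  apply: contrapT => h; apply: (prime1 (max_prime HL)).
  have -> : 1 = \sum_(j < k) y ^+ j / gsum y k by rewrite -mulr_suml -/(gsum y k) divff.
  by apply: (id_sum Hm) => j _; apply: contrapT => nj; apply: h; exists j.
have [z0 Sz1] := local_unit (Sz j jk) nj.
(* Put z_j = y^j / [gsum y k]. If z_0 is a unit then y = z_1/z_0 lies in S; if z_(j+1) is, then y^-1
   = z_j/z_(j+1) does. *)
case: j jk nj z0 Sz1 => [|j] jk nj z0 Sz1.
  left; have h := Sz 1%N k1; rewrite (_ : y = (y ^+ 1 / gsum y k) * (y ^+ 0 / gsum y k)^-1); first by mem.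
  by rewrite expr1 expr0 div1r invrK divfK.
right; have h := Sz j (ltnW jk).
rewrite (_ : y^-1 = (y ^+ j / gsum y k) * (y ^+ j.+1 / gsum y k)^-1); first by mem.
by rewrite exprS invf_div mulrA divfK // invfM mulrCA divff ?mulr1 ?expf_neq0.
Qed.
End Valuations.

(** * Transforms of principal primes *)

Section PrincipalTransform.
Variable F : fieldType.
Implicit Types (A B C I J P Q T : F -> Prop).

(** By the principal ideal theorem z already lies in a prime strictly below the maximal ideal. *)
Lemma max_not_principal A d z : is_local A -> noetherian A -> krull_dim A d -> (2 <= d)%N ->
  maxideal A z -> ~ subset_ (maxideal A) (principal A z).
Proof.
move=> HL hN hd d2 mz sz; have HA := local_sr HL.
have [l [cl zl el]] := dim_pchain HL hd.
case: l zl cl el => [|q1 [|q2 l]] zl //=; try (by rewrite -zl in d2).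
move=> [s1 H1 [s2 H2 cl]] el.
have s2m : subset_ q2 (maxideal A) by rewrite -el; exact: (pchain_last_sub cl).
have s1m := strict_sub_trans s2 s2m.
have [Q [HQ _ sQ Qz]] := pit HA hN (prime_zero HA) H1 (max_prime HL) s1 s1m mz.
apply: (strict_sub_ne sQ); apply: sub_antisym sQ.1 _; apply: sub_tr sz _.
exact: (principal_min (prime_ideal HQ)).
Qed.

Section Qt.
Variables (A B : F -> Prop) (x : F).
Hypotheses (HR : regular_local A) (qt : qtrans A B x) (HRB : regular_local B).
Let HL := reg_local HR.
Let HA := local_sr HL.
Let Hm := local_mi HL.
Let HLB := reg_local HRB.
Let HB := local_sr HLB.
Let HmB := local_mi HLB.
Let x0 : x != 0 := qt_neq0 HL qt.
Let mx : maxideal A x. Proof. by case: qt. Qed.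
Let Ax : A x. Proof. by mem. Qed.
Let Bx : B x. Proof. exact: (qt_sub HL qt). Qed.
Let mBx : maxideal B x. Proof. exact: (qt_max qt). Qed.
Let xn0 n : x ^+ n != 0. Proof. by rewrite expf_neq0. Qed.

Lemma exceptional_mem n a : ideal_pow A (maxideal A) n.+1 a -> principal B x (a / x ^+ n).
Proof.
move=> ha; exists (a / x ^+ n.+1); split; first exact: (qt_pow HL qt).
by rewrite exprSr; field; rewrite x0 xn0.
Qed.

Lemma ord_den n b : ideal_pow A (maxideal A) n b -> b != 0 -> ~ maxideal B (b / x ^+ n) -> ordn A b = n.
Proof.
move=> hb b0 nb; have Hp := pow_ideal n HA Hm; have Ab : A b by mem.
symmetry; apply: (ord_uniq HR) => //; split=> // hb1; apply: nb.
exact: (principal_min HmB mBx (exceptional_mem hb1)).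
Qed.

Lemma frac_unit n a b z : ideal_pow A (maxideal A) n a -> ideal_pow A (maxideal A) n b -> b != 0 ->
  ~ maxideal B (b / x ^+ n) -> z = a / b -> exists e, B e /\ z = e * (a / x ^+ n).
Proof.
move=> ha hb b0 nb ->; have Bb := qt_pow HL qt hb; have [bx0 Bb1] := local_unit Bb nb.
by exists (b / x ^+ n)^-1; split=> //; field; rewrite b0 xn0.
Qed.

(** For u = a/b with b/x^k a unit of B, ord a > k puts u in xB. Comparing orders in a1 a2 g = x c b1
    b2 forces this for one of the two factors, because x contributes at least 1. *)
Lemma exceptional_prime : is_prime B (principal B x).
Proof.
have HI := principal_ideal HB Bx; split=> //.
  by move=> /(principal_min HmB mBx); exact: prime1 (max_prime HLB).
move=> u v Bu Bv [w [Bw e]].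
have [k1 [a1 [b1 [ha1 hb1 b10 nb1 e1]]]] := qt_frac HL qt Bu.
have [k2 [a2 [b2 [ha2 hb2 b20 nb2 e2]]]] := qt_frac HL qt Bv.
have [j [c [g [hc hg g0 ng ew]]]] := qt_frac HL qt Bw.
have Hp n := pow_ideal n HA Hm.
have h1 := Hp k1; have h2 := Hp k2; have h3 := Hp j.
have Aa1 : A a1 by mem.
have Aa2 : A a2 by mem.
have Ab1 : A b1 by mem.
have Ab2 : A b2 by mem.
have Ac : A c by mem.
have Ag : A g by mem.
have [a10|a10] := eqVneq a1 0; first by left; rewrite e1 a10 mul0r; mem.
have [a20|a20] := eqVneq a2 0; first by right; rewrite e2 a20 mul0r; mem.
have E : a1 * a2 * g = x * c * (b1 * b2).
  have -> : a1 * a2 = u * v * (b1 * b2) by rewrite e1 e2; field; rewrite b10 b20.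
  by rewrite e ew; field.
have c0 : c != 0.
  apply: contraNneq (mulf_neq0 (mulf_neq0 a10 a20) g0) => c0.
  by rewrite E c0 mulr0 mul0r.
have o1 := ord_den hb1 b10 nb1; have o2 := ord_den hb2 b20 nb2; have o3 := ord_den hg g0 ng.
have := congr1 (ordn A) E; rewrite !(ordM HR) ?mulf_neq0 //; try by mem.
rewrite o1 o2 o3; have : (0 < ordn A x)%N by exact: (ord_gt0 HR).
have : (j <= ordn A c)%N by apply/(ord_ge HR).
have big a k z : A a -> a != 0 -> (k < ordn A a)%N -> (exists e, B e /\ z = e * (a / x ^+ k)) -> principal B x z.
  by move=> Aa a0 lt [e' [Be ->]]; have := exceptional_mem ((ord_ge HR k.+1 Aa a0).2 lt) => ?; mem.
have [lt1 _ _ _|le1] := ltnP k1 (ordn A a1); first by left; apply: (big a1 k1) => //; exact: (frac_unit ha1 hb1).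
have [lt2 _ _ _|le2] := ltnP k2 (ordn A a2); first by right; apply: (big a2 k2) => //; exact: (frac_unit ha2 hb2).
by move=> *; lia.
Qed.

Section Transform.
Variable f : F.
Hypotheses (Af : A f) (f0 : f != 0) (Hpf : is_prime A (principal A f)).
Let n := ordn A f.
Let f' := f / x ^+ n.
Hypothesis mf' : maxideal B f'.
Let pI := prime_ideal Hpf.
Let Bf' : B f'. Proof. by mem. Qed.
Let Hf' := principal_ideal HB Bf'.

Let mf : maxideal A f.
Proof. by apply: (prime_submax Hpf); exact: principal_self. Qed.

(** If f divided x, the cofactor would be a unit because x is outside m^2; f would have order 1, and
    f' = f/x would be a unit of B. *)
Let nx : ~ principal A f x.
Proof.
move=> [r [Ar e]]; have nr : ~ maxideal A r.
  move=> mr; case: (qt) => _ n2 _; apply: n2; rewrite e.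
  by rewrite -[2%N]/(1 + 1)%N; apply: pow_mul => //; rewrite pow1.
have [r0 Ar1] := local_unit Ar nr.
have n1 : n = 1%N.
  have o1 : ordn A r = 0%N by apply/(ord_unit HR).
  have := ordM HR Ar Af r0 f0; rewrite -e o1 add0n => h; rewrite /n -h; symmetry; apply: (ord_uniq HR) => //.
  by case: (qt) => _ n2 _; split; rewrite ?pow1.
apply: (unit_nmax (A := B) (s := f')) mf'; last by rewrite mulf_neq0 ?invr_neq0.
rewrite /f' n1 expr1 invf_div e mulfK //; exact: (qt_sub HL qt).
Qed.

Let memf j e : ideal_pow A (maxideal A) j e -> principal A f e -> principal B f' (e / x ^+ j).
Proof.
move=> he [r [Ar er]]; have Bf := principal_self f' HB.
have [r0|r0] := eqVneq r 0; first by rewrite er r0 !mul0r; mem.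
have e0 : e != 0 by rewrite er mulf_neq0.
have Ae : A e by rewrite er; mem.
have := (ord_ge HR j Ae e0).1 he; rewrite er (ordM HR) // -/n => le.
have [jn|nj] := leqP j n.
  have Br := qt_sub HL qt Ar.
  rewrite (_ : _ / _ = r * x ^+ (n - j) * f'); first by mem.
  by rewrite /f' -{2}(subnKC jn) exprD; field; rewrite !xn0.
have Br : B (r / x ^+ (j - n)).
  by apply: (qt_pow HL qt); apply/(ord_ge HR) => //; lia.
rewrite (_ : _ / _ = r / x ^+ (j - n) * f'); first by mem.
by rewrite /f' -{1}(subnKC (ltnW nj)) exprD; field; rewrite !xn0.
Qed.

(** Write u = (c/h) f' with h/x^j a unit of B. Then f divides a x^n h, but neither x nor h, since f
    dividing h would put the unit h/x^j in f'B. *)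
Let fact u k a b : ideal_pow A (maxideal A) k a -> A b -> b != 0 -> u = a / b -> principal B f' u -> principal A f a.
Proof.
move=> ha Ab b0 eu [g [Bg e]]; have Hk := pow_ideal k HA Hm; have Aa : A a by mem.
have [j [c [h [hc hh h0 nh eg]]]] := qt_frac HL qt Bg.
have Hj := pow_ideal j HA Hm; have Ac : A c by mem.
have Ah : A h by mem.
have nph : ~ principal A f h.
  by move=> /(memf hh)/(principal_min HmB mf').
have pf := principal_self f HA.
have : principal A f (a * (x ^+ n * h)).
  rewrite (_ : _ * _ = c * b * f); first by mem.
  have -> : a = u * b by rewrite eu divfK.
  by rewrite e eg /f'; field; rewrite xn0 h0.
have Axh : A (x ^+ n * h) by mem.
have Axn : A (x ^+ n) by mem.
move=> /(primeM Hpf Aa Axh)[//|/(primeM Hpf Axn Ah)[/(primeX Hpf HA Ax)|] //].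
Qed.

Lemma transform_contr r : A r -> principal B f' r -> principal A f r.
Proof.
move=> Ar; apply: (@fact r 0 r 1); [by rewrite pow0|mem|exact: oner_neq0|by rewrite divr1].
Qed.

Lemma transform_prime : is_prime B (principal B f').
Proof.
split=> //; first by move=> /(principal_min HmB mf'); exact: prime1 (max_prime HLB).
move=> u v Bu Bv huv.
have [k1 [a1 [b1 [ha1 hb1 b10 nb1 e1]]]] := qt_frac HL qt Bu.
have [k2 [a2 [b2 [ha2 hb2 b20 nb2 e2]]]] := qt_frac HL qt Bv.
have h1 := pow_ideal k1 HA Hm; have h2 := pow_ideal k2 HA Hm.
have Aa1 : A a1 by mem.
have Aa2 : A a2 by mem.
have Ab1 : A b1 by mem.
have Ab2 : A b2 by mem.
have : principal A f (a1 * a2).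
  apply: (@fact (u * v) (k1 + k2) _ (b1 * b2)) => //; first exact: pow_mul.
  - by mem.
  - by rewrite mulf_neq0.
  - by rewrite e1 e2; field; rewrite b10 b20.
move=> /(primeM Hpf Aa1 Aa2)[] h; [left|right].
  by have [e [Be ->]] := frac_unit ha1 hb1 b10 nb1 e1; have := memf ha1 h => ?; mem.
by have [e [Be ->]] := frac_unit ha2 hb2 b20 nb2 e2; have := memf ha2 h => ?; mem.
Qed.
End Transform.
End Qt.
End PrincipalTransform.

(** * From finitely many height one primes to a valuation ring *)

Section FiniteToValuation.
Variables (F : fieldType) (R : nat -> F -> Prop) (x : nat -> F).
Implicit Types (A B C I P Q T p : F -> Prop).
Hypotheses (reg : forall i, regular_local (R i)) (HQ : quotient_field_of (R 0%N))
  (qt : forall i, qtrans (R i) (R i.+1) (x i))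
  (dim2 : forall i, exists d, krull_dim (R i) d /\ (2 <= d)%N).
Let HL i := reg_local (reg i).
Let HR i := reg_sr (reg i).
Let Hm i := local_mi (HL i).
Let Rm := R_mono reg qt.
Let x0 := x_neq0 reg qt.
Local Notation S := (union_ring R).
Local Notation V := (boundary_valuation_ring R).
Local Notation tr := (tr R x).
Let HS := S_sr reg qt.
Let HSL := S_local reg qt.
Let SmaxP := S_maxP reg qt.

Lemma finite_height1 Q : finitely_many_height_one S -> is_prime S Q -> Q <> maxideal S -> nonzero Q ->
  height_one S Q.
Proof.
move=> [n [P hP]] HQ1 ne nQ; have QI := prime_ideal HQ1.
have [N hN] := nonmax_index reg qt HQ1 ne.
pose good k := height_one S (P k).
have hgood c : Q c -> c != 0 -> exists k, [/\ (k < n)%N, good k & P k c].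
  move=> Qc c0; have [Q' [h1 _ Q'c]] := P_height1_in reg qt HQ1 hN nQ Qc c0.
  by have [k [kn /pred_ext e]] := hP _ h1; exists k; rewrite /good -e.
have [k [gk sk]] : exists k, good k /\ subset_ Q (P k).
  apply: contrapT => h.
  have [|a [Qa ha]] := @prime_avoidance F S Q P good n HS QI.
    move=> k kn gk; split; first by case: gk.
    by move=> sk; apply: h; exists k.
  have [a0|a0] := eqVneq a 0.
    have [c [Qc c0]] := nQ; have [k [kn gk _]] := hgood c Qc c0.
    by apply: (ha k kn gk); rewrite a0; case: gk => Hk _ _; have := prime_ideal Hk => ?; mem.
  by have [k [kn gk Pk]] := hgood a Qa a0; exact: (ha k kn gk).
by have [H1 _ hmin] := (height_oneP (P k) HS).1 gk; rewrite (hmin _ HQ1 sk nQ).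
Qed.

Lemma finite_index : finitely_many_height_one S -> exists N, forall Q, is_prime S Q -> Q <> maxideal S ->
  forall i, (N <= i)%N -> ~ Q (x i).
Proof.
move=> hf; have [n [P hP]] := hf.
have [N hN] : exists N, forall k, (k < n)%N -> is_prime S (P k) -> P k <> maxideal S ->
    forall i, (N <= i)%N -> ~ P k (x i).
  elim: n {hP} => [|n [N hN]]; first by exists 0%N.
  case: (EM (is_prime S (P n) /\ P n <> maxideal S)) => [[Hn ne]|nn].
    have [M hM] := nonmax_index reg qt Hn ne; exists (maxn N M) => k.
    rewrite ltnS leq_eqVlt => /orP[/eqP -> _ _|kn H1 n1] i; rewrite geq_max => /andP[iN iM].
      exact: hM.
    exact: hN.
  exists N => k; rewrite ltnS leq_eqVlt => /orP[/eqP -> H1 n1|]; last exact: hN.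
  by case: nn.
exists N => Q HQ1 ne i Ni Qx.
have nQ : nonzero Q by exists (x i).
have [k [kn /pred_ext e]] := hP Q (finite_height1 hf HQ1 ne nQ).
by move: HQ1 ne Qx; rewrite e => H1 n1; exact: (hN k kn).
Qed.

(* Otherwise the principal primes generated by the successive transforms of x l would have a nonmaximal
   prime containing x l as their union. *)
Lemma exceptional_vanish l : (forall Q, is_prime S Q -> Q <> maxideal S -> ~ Q (x l)) ->
  exists L, (l < L)%N /\ ordn (R L) (tr l.+1 (x l) L) = 0%N.
Proof.
move=> hl; apply: contrapT => hn.
have Rx : R l.+1 (x l) by exact: (x_R reg qt).
have tin L : (l < L)%N -> R L (tr l.+1 (x l) L) /\ tr l.+1 (x l) L != 0 by exact: (tr_in reg qt).
have tm L : (l < L)%N -> maxideal (R L) (tr l.+1 (x l) L).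
  move=> lL; have [h1 h2] := tin L lL; apply: contrapT => nm; apply: hn; exists L; split=> //.
  exact/(ord_unit (reg L)).
pose pL L := principal (R L) (tr l.+1 (x l) L).
have key L : (l < L)%N -> is_prime (R L) (pL L) /\ (forall r, R l.+1 r -> pL L r -> pL l.+1 r).
  move: L; apply: leq_ind => [|L lL [H1 h1]].
    by split=> //; rewrite /pL tr_base; exact: (exceptional_prime (reg l) (qt l) (reg l.+1)).
  have [h2 h3] := tin L lL.
  have tm1 := tm L.+1 (leqW lL); rewrite (trS _ _ _ lL) in tm1.
  have pT := transform_prime (reg L) (qt L) (reg L.+1) h2 h3 H1 tm1.
  split; first by rewrite /pL trS.
  move=> r Rr; rewrite /pL (trS _ _ _ lL) => pr; apply: h1 => //.
  by apply: (transform_contr (reg L) (qt L) (reg L.+1) h2 h3 H1 tm1) => //; exact: (Rm lL).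
have mono L M : (l < L)%N -> (L <= M)%N -> subset_ (pL L) (pL M).
  move=> lL; move: M; apply: leq_ind => // M LM h z /h [r [Rr ->]].
  have lM : (l < M)%N by exact: leq_trans LM.
  rewrite /pL (trS _ _ _ lM); set n := ordn _ _.
  exists (r * x M ^+ n); split; last by field; rewrite expf_neq0.
  have Rr' := Rm (leqnSn M) Rr; have Rx' : R M.+1 (x M) by exact: (x_R reg qt).
  by have := HR M.+1 => ?; mem.
pose P z := exists L, (l < L)%N /\ pL L z.
have up y z : P y -> P z -> exists L, [/\ (l < L)%N, pL L y & pL L z].
  move=> [L [lL Py]] [M [lM Pz]]; exists (maxn L M); split; first by rewrite leq_max lL.
    exact: (mono _ _ lL (leq_maxl _ _)).
  exact: (mono _ _ lM (leq_maxr _ _)).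
have HP : is_prime S P.
  split; first split.
  - move=> z [L [lL Pz]]; exists L; have [HL1 _] := key L lL; mem.
  - by exists l.+1; split=> //; have [HL1 _] := key l.+1 (ltnSn l); have := prime_ideal HL1 => ?; mem.
  - move=> y z Py Pz; have [L [lL P1 P2]] := up _ _ Py Pz; exists L; split=> //.
    by have [HL1 _] := key L lL; have := prime_ideal HL1 => ?; mem.
  - move=> a z [M Ra] [L [lL Pz]]; exists (maxn L M).
    have lM : (l < maxn L M)%N by rewrite leq_max lL.
    split=> //; have [HL1 _] := key _ lM; have := prime_ideal HL1 => ?.
    have ? := mono _ _ lL (leq_maxl L M) _ Pz; have ? := Rm (leq_maxr L M) Ra; mem.
  - by move=> [L [lL P1]]; have [HL1 _] := key L lL; exact: (prime1 HL1).
  - move=> a b [i Ra] [j Rb] [L [lL Pab]]; pose M := maxn L (maxn i j).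
    have lM : (l < M)%N by rewrite leq_max lL.
    have LM : (L <= M)%N by exact: leq_maxl.
    have iM : (i <= M)%N by rewrite /M !leq_max leqnn orbT.
    have jM : (j <= M)%N by rewrite /M !leq_max leqnn !orbT.
    have [HL1 _] := key M lM.
    by have [h|h] := primeM HL1 (Rm iM Ra) (Rm jM Rb) (mono _ _ lL LM _ Pab); [left|right]; exists M.
apply: (hl P HP); last by exists l.+1; split=> //; rewrite /pL tr_base; apply: principal_self; exact: HR.
(* The union P contracts in R_(l+1) to the ideal generated by x_l, whereas in dimension at least 2
   the maximal ideal is not principal; so P is not maximal. *)
move=> eP; have [d [hd d2]] := dim2 l.+1; have [_ hNN _] := reg l.+1.
apply: (max_not_principal (HL l.+1) hNN hd d2 (x_max qt (leqnSn l))) => z mz.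
have : P z by rewrite eP; apply/SmaxP; exists l.+1.
move=> [L [lL Pz]]; have [_ h] := key L lL.
have Rz : R l.+1 z by have := Hm l.+1 => ?; mem.
by have := h z Rz Pz; rewrite /pL tr_base.
Qed.

(** Order 0 means that the transform is a unit, so by [tr_prod] a is then a unit times a monomial in
    the x_l with l >= J. *)
Definition vanishing J a := [/\ R J a, a != 0 & exists L, (J <= L)%N /\ ordn (R L) (tr J a L) = 0%N].

Lemma vanish_stay J a L M : R J a -> a != 0 -> (J <= L)%N -> (L <= M)%N ->
  ordn (R L) (tr J a L) = 0%N -> ordn (R M) (tr J a M) = 0%N.
Proof.
move=> Ra a0 JL LM e; apply/eqP; rewrite -leqn0 -e; exact: (tr_ord_le reg qt).
Qed.

Lemma vanishing_one J : vanishing J 1.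
Proof.
split; [by have := HR J => ?; mem|exact: oner_neq0|exists J; split=> //].
by rewrite tr_base (ord_one (reg J)).
Qed.

Lemma vanishing_mul J a b : vanishing J a -> vanishing J b -> vanishing J (a * b).
Proof.
move=> [Ra a0 [L [JL eL]]] [Rb b0 [M [JM eM]]]; split; [by have := HR J => ?; mem|by rewrite mulf_neq0|].
have JLM : (J <= maxn L M)%N by rewrite leq_max JL.
exists (maxn L M); split=> //; rewrite (trM reg qt) //.
have [h1 h2] := tr_in reg qt Ra a0 JLM; have [h3 h4] := tr_in reg qt Rb b0 JLM.
rewrite (ordM (reg _)) // (vanish_stay Ra a0 JL (leq_maxl _ _) eL).
by rewrite (vanish_stay Rb b0 JM (leq_maxr _ _) eM).
Qed.

Lemma vanishing_exp J a n : vanishing J a -> vanishing J (a ^+ n).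
Proof.
move=> h; elim: n => [|n ih]; first by rewrite expr0; exact: vanishing_one.
by rewrite exprS; exact: vanishing_mul.
Qed.

(** In R_J the element x_l is its own transform times powers of x_i with l < i < J, which the
    induction on J - l has already treated. *)
Lemma vanishing_x N (J : nat) : (forall l, (N <= l)%N -> exists L, (l < L)%N /\ ordn (R L) (tr l.+1 (x l) L) = 0%N) ->
  forall l, (N <= l)%N -> (l < J)%N -> vanishing J (x l).
Proof.
move=> hN l; move: {2}(J - l)%N (leqnn (J - l)) => k; elim: k l => [|k ih] l le Nl lJ; first by lia.
have Rx : R l.+1 (x l) by exact: (x_R reg qt).
have e := tr_prod reg qt (x l) lJ.
have [h1 h2] := tr_in reg qt Rx (x0 l) lJ.
rewrite e; apply: vanishing_mul.
  rewrite big_nat_cond; elim/big_rec: _ => [|i y]; first exact: vanishing_one.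
  rewrite andbT => /andP[li iJ] hy; apply: vanishing_mul => //; apply: vanishing_exp.
  by apply: ih => //; [lia|exact: leq_trans Nl (ltnW li)].
split=> //; have [L [lL eL]] := hN l Nl; exists (maxn J L); split; first exact: leq_maxl.
rewrite (tr_tr _ _ _ lJ (leq_maxl _ _)).
exact: (vanish_stay Rx (x0 l) lL (leq_maxr _ _) eL).
Qed.

(** The ideal of denominators of y contains a power b of x_N: otherwise a prime containing it but
    not x_N would contradict y in S_Q. As y has nonnegative order at late stages, the transform b_J
    satisfies ord (b_J y) >= ord b_J, so passing to the next transform keeps the product in the
    ring, until b_J becomes a unit. *)
Lemma S_inter N y : (forall Q, is_prime S Q -> Q <> maxideal S -> ~ Q (x N)) ->
  (forall J, (N < J)%N -> vanishing J (x N)) -> y != 0 -> V y ->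
  (forall Q, is_prime S Q -> Q <> maxideal S -> nonzero Q -> localize S Q y) -> S y.
Proof.
move=> hx hJ y0 Vy hloc; pose D d := S d /\ S (d * y).
have HD : is_ideal S D.
  split.
  - by move=> z [].
  - by split; [mem|rewrite mul0r; mem].
  - by move=> u v [? ?] [? ?]; split; [mem|rewrite mulrDl; mem].
  - by move=> r u Sr [? ?]; split; [mem|rewrite -mulrA; mem].
have [e [_ Se]] : exists e, D (x N ^+ e).
  apply: contrapT => h.
  have Sx : S (x N) by exists N; exact: (x_R reg qt).
  have [|Q [HQ1 DQ nQ]] := zorn_prime HS HD Sx; first by move=> e he; apply: h; exists e.
  have ne : Q <> maxideal S.
    by move=> eQ; apply: nQ; rewrite eQ; apply/SmaxP; exists N; exact: (x_max qt).
  have nQ0 : nonzero Q.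
    have [a [b [Ra Rb b0 ey]]] := HQ y; exists b; split=> //; apply: DQ; split; first by exists 0%N.
    by rewrite ey mulrC divfK //; exists 0%N.
  have [u [w [Su Sw nw ey]]] := hloc Q HQ1 ne nQ0; have w0 := notin_neq0 HQ1 nw.
  by apply: nw; apply: DQ; split=> //; rewrite ey mulrC divfK.
have [M hM] := Vy; have [i Ri] := Se.
pose K := maxn N.+1 (maxn M i).
have NK : (N < K)%N by exact: leq_maxl.
have MK : (M <= K)%N by rewrite /K !leq_max leqnn orbT.
have iK : (i <= K)%N by rewrite /K !leq_max leqnn !orbT.
have [Rb b0 [L [KL eL]]] := vanishing_exp e (hJ K NK).
set b := x N ^+ e in Rb b0 eL Ri.
have key J : (K <= J)%N -> R J (tr K b J * y).
  move: J; apply: leq_ind => [|J KJ h]; first by rewrite tr_base; exact: (Rm iK).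
  have [h1 h2] := tr_in reg qt Rb b0 KJ.
  have c0 : tr K b J * y != 0 by rewrite mulf_neq0.
  have := hM J (leq_trans MK KJ); rewrite (_ : y = (tr K b J * y) / tr K b J); last by field.
  move=> /(ord_fracP (reg J) h h1 c0 h2)/(ord_ge (reg J) _ h c0) hp.
  rewrite mulrAC divff // mul1r (trS _ _ _ KJ) mulrAC.
  exact: (qt_pow (HL J) (qt J)).
have [h1 h2] := tr_in reg qt Rb b0 KL.
have nm : ~ maxideal (R L) (tr K b L) by apply/(ord_unit (reg L)).
have [_ Rb1] := local_unit h1 nm.
exists L; rewrite (_ : y = (tr K b L)^-1 * (tr K b L * y)); last by field.
by have := key L KL => ?; have := HR L => ?; mem.
Qed.

Lemma loc_valuation Q : is_prime S Q -> Q <> maxideal S -> nonzero Q ->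
  (forall Q', is_prime S Q' -> subset_ Q' Q -> nonzero Q' -> Q' = Q) -> valuation_ring (localize S Q).
Proof.
move=> HQ1 ne nQ hmin; have [N hN] := nonmax_index reg qt HQ1 ne.
have HSQ := loc_subring HS HQ1; split=> // y y0.
have HP := P_contr reg N HQ1.
have HLL := loc_local (HR N) HP; have [_ hNN _] := reg N.
have [t [t0 mt ht]] := P_dvr reg HQ qt HQ1 hN nQ hmin.
have [a [b [Ra Rb a0 b0 ey]]] := frac_R reg HQ qt N y0.
have sub : subset_ (localize (R N) (meet Q (R N))) (localize S Q).
  move=> z [c [d [Rc Rd nd ->]]]; exists c, d; split; [by exists N|by exists N| |by []].
  by move=> Qd; apply: nd.
have sR : subset_ (R N) (localize (R N) (meet Q (R N))) by exact: (locid_sub (HR N) HP).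
have [|n [m [e [Le Le1 e0 E]]]] := dvr_field HLL (loc_noeth (HR N) HP hNN) t0 mt ht y0.
  by exists a, b; split=> //; exact: sR.
have Lt : localize S Q t by apply: sub; have := local_mi HLL => ?; mem.
have := sub _ Le => ?; have := sub _ Le1 => ?.
have [nm|mn] := leqP m n; [left|right].
  rewrite (_ : y = t ^+ (n - m) * e); first by mem.
  by rewrite E -{1}(subnK nm) exprD mulfK // expf_neq0.
rewrite (_ : y^-1 = t ^+ (m - n) * e^-1); first by mem.
by rewrite E invfM invf_div -{1}(subnK (ltnW mn)) exprD mulfK // expf_neq0.
Qed.

(** 0 has no order, so [boundary_valuation_ring] does not contain it as encoded, and it is adjoined
    here. *)
Lemma boundary_valuation : valuation_ring (fun z => z = 0 \/ V z).
Proof.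
split; last by move=> z z0; have [h|h] := V_total reg HQ qt z0; [left|right]; right.
have V1 : V 1 by apply: (V_of_S reg qt); [mem|exact: oner_neq0].
have VN z : z != 0 -> V z -> V (- z).
  move=> z0 Vz; rewrite -mulN1r; apply: (V_mul reg HQ qt) => //; first by rewrite oppr_eq0 oner_neq0.
  by apply: (V_of_S reg qt); [mem|rewrite oppr_eq0 oner_neq0].
split; [by left|by right| |].
  move=> y z hy hz; have [->|y0] := eqVneq y 0.
    rewrite sub0r; have [->|z0] := eqVneq z 0; first by left; rewrite oppr0.
    by case: hz => [/eqP|h]; [rewrite (negbTE z0)|right; exact: VN].
  have [->|z0] := eqVneq z 0; first by rewrite subr0.
  case: hz => [/eqP|hz]; first by rewrite (negbTE z0).
  case: hy => [/eqP|hy]; first by rewrite (negbTE y0).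
  have [->|s0] := eqVneq (y - z) 0; [by left|right].
  by apply: (V_add reg HQ qt); rewrite ?oppr_eq0 //; exact: VN.
move=> y z hy hz; have [->|y0] := eqVneq y 0; first by left; rewrite mul0r.
have [->|z0] := eqVneq z 0; first by left; rewrite mulr0.
case: hz => [/eqP|hz]; first by rewrite (negbTE z0).
case: hy => [/eqP|hy]; first by rewrite (negbTE y0).
by right; exact: (V_mul reg HQ qt).
Qed.

Lemma finite_valuation : finitely_many_height_one S -> valuation_ring S.
Proof.
move=> hf; have [N hN] := finite_index hf; have [n [P hP]] := hf.
have hx Q : is_prime S Q -> Q <> maxideal S -> ~ Q (x N) by move=> H1 ne; exact: (hN Q H1 ne N).
have hv l : (N <= l)%N -> exists L, (l < L)%N /\ ordn (R L) (tr l.+1 (x l) L) = 0%N.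
  by move=> Nl; apply: exceptional_vanish => Q H1 ne; exact: (hN Q H1 ne l).
(* Index 0 holds V. An index that names no nonmaximal height one prime gets all of F, a valuation
   ring imposing no condition. *)
pose W k := if k is k'.+1 then
  if `[< height_one S (P k') /\ P k' <> maxideal S >] then localize S (P k') else (fun=> True)
  else (fun z => z = 0 \/ V z).
apply: (@local_inter_valuation F S W n.+1 HSL) => [[|k] kn|y y0 hy] /=.
- exact: boundary_valuation.
- case: asboolP => [[h1 ne]|_]; last by split=> // z _; left.
  have [H1 n1 m1] := (height_oneP _ HS).1 h1; exact: loc_valuation.
apply: (S_inter hx) => //.
- by move=> J NJ; exact: (vanishing_x hv (leqnn N) NJ).
- by have [/eqP|//] := hy 0%N isT; rewrite (negbTE y0).
move=> Q H1 ne nQ; have h1 := finite_height1 hf H1 ne nQ.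
have [k [kn /pred_ext e]] := hP Q h1.
by have := hy k.+1 kn; rewrite /= -e; case: asboolP => // -[].
Qed.
End FiniteToValuation.

(** * The value group *)

Section Units.
Variables (F : fieldType) (A : F -> Prop).
Hypothesis HA : is_subring A.

Definition runit (A : F -> Prop) z := [/\ z != 0, A z & A z^-1].

Lemma runit_one : runit A 1. Proof. by rewrite /runit invr1 oner_neq0; split=> //; mem. Qed.
Lemma runit_mul y z : runit A y -> runit A z -> runit A (y * z).
Proof. by move=> [? ? ?] [? ? ?]; split; [rewrite mulf_neq0|mem|rewrite invfM; mem]. Qed.
Lemma runit_inv z : runit A z -> runit A z^-1.
Proof. by move=> [? ? ?]; split; rewrite ?invr_neq0 ?invrK. Qed.
Lemma runit_exp z n : runit A z -> runit A (z ^+ n).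
Proof.
by move=> h; elim: n => [|n ih]; rewrite ?expr0 ?exprS; [exact: runit_one|exact: runit_mul].
Qed.
Lemma runit_max z : runit A z -> ~ maxideal A z.
Proof. by move=> [? ? ?]; exact: unit_nmax. Qed.

Lemma runit_expz t (k : int) : is_local A -> maxideal A t -> runit A (t ^ k) -> k = 0.
Proof.
move=> HL mt; have Hm := local_mi HL; case: k => [[|k]|k] //.
  by rewrite -exprnP => /runit_max h; case: h; mem.
by rewrite NegzE -exprnN => /runit_inv; rewrite invrK => /runit_max h; case: h; mem.
Qed.
End Units.

(** * Primes and commensurability in a valuation ring S *)

Section ValuationToDimension.
Variables (F : fieldType) (R : nat -> F -> Prop) (x : nat -> F).
Implicit Types (A B C I P Q T p : F -> Prop).
Hypotheses (reg : forall i, regular_local (R i)) (HQ : quotient_field_of (R 0%N))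
  (qt : forall i, qtrans (R i) (R i.+1) (x i)).
Let HL i := reg_local (reg i).
Let HR i := reg_sr (reg i).
Let Hm i := local_mi (HL i).
Let Rm := R_mono reg qt.
Let x0 := x_neq0 reg qt.
Local Notation S := (union_ring R).
Local Notation V := (boundary_valuation_ring R).
Let HS := S_sr reg qt.
Let HSL := S_local reg qt.
Let SmaxP := S_maxP reg qt.
Hypothesis hv : valuation_ring S.

Let mSx i : maxideal S (x i).
Proof. by apply/SmaxP; exists i; exact: (x_max qt). Qed.

(** All powers of an element u of P outside Q divide every q in Q, so Krull's theorem in the
    noetherian localization at P gives q = 0. *)
Lemma nonmax_height1 P : is_prime S P -> P <> maxideal S -> nonzero P ->
  forall Q, is_prime S Q -> subset_ Q P -> nonzero Q -> Q = P.
Proof.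
move=> HP ne nP Q HQ1 QP [q [Qq q0]]; apply: contrapT => neq.
have [N hN] := nonmax_index reg qt HP ne.
have [_ [u [Pu nu]]] := strict_subP QP neq.
have HPc := P_contr reg N HP; have HLL := loc_local (HR N) HPc; have [_ hNN _] := reg N.
suff : q = 0 by apply/eqP.
apply: (krull0 HLL (loc_noeth (HR N) HPc hNN)) => n.
have Su : S u by mem.
have Sq : S q by mem.
have u0 : u != 0 by apply: contra_notN nu => /eqP ->; have := prime_ideal HQ1 => ?; mem.
have Ln := local_mi HLL; have HLs := local_sr HLL.
have Hp := pow_ideal n HLs Ln.
have mu : maxideal (localize (R N) (meet P (R N))) u.
  rewrite loc_max //; have [d [Rd nd Rdu]] := P_den reg qt HP hN Su.
  have Sd : S d by exists N.
  exists (d * u), d; split=> //; first by split=> //; have := prime_ideal HP => ?; mem.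
    by case.
  rewrite mulrC mulKf //; apply: contra_notN nd => /eqP ->; have := prime_ideal HP => ?; mem.
have hu : ideal_pow (localize (R N) (meet P (R N))) (maxideal (localize (R N) (meet P (R N)))) n (u ^+ n).
  exact: powX.
have un0 : u ^+ n != 0 by rewrite expf_neq0.
have [h|h] := hv.2 (q / u ^+ n) (mulf_neq0 q0 (invr_neq0 un0)).
  rewrite -(divfK un0 q); have := P_loc reg qt HP hN h => ?; mem.
case: nu; apply: (primeX (n := n) HQ1 HS Su); rewrite invf_div in h.
by rewrite -(divfK q0 (u ^+ n)); have := prime_ideal HQ1 => ?; mem.
Qed.

Lemma nonmax_unique P Q : is_prime S P -> P <> maxideal S -> nonzero P ->
  is_prime S Q -> Q <> maxideal S -> nonzero Q -> Q = P.
Proof.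
move=> H1 e1 n1 H2 e2 n2; have [h|h] := valuation_primes hv H1 H2.
  by rewrite (nonmax_height1 H2 e2 n2 H1 h n1).
exact: (nonmax_height1 H1 e1 n1 H2 h n2).
Qed.

Lemma strict_nonmax P Q : is_prime S Q -> strict_sub P Q -> P <> maxideal S.
Proof.
move=> HQ1 s e; apply: (strict_sub_ne s); apply: sub_antisym s.1 _.
rewrite e; exact: prime_submax.
Qed.

Lemma max_nonzero : nonzero (maxideal S).
Proof. by exists (x 0). Qed.

Lemma dim_one : (forall P, is_prime S P -> P <> maxideal S -> ~ nonzero P) -> krull_dim S 1.
Proof.
move=> h; have H0 := prime_zero HS; have Hmx := max_prime HSL; split.
  have [|c [hc _ _]] := @pchain_chain F S _ [:: maxideal S] H0; last by exists c.
  by split=> //; exact: (nonzero_strict Hmx max_nonzero).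
move=> c m hc; rewrite leqNgt; apply/negP => lt; have [h1 h2] := hc.
have P0 := h1 0%N isT; have P1 := h1 1%N (ltnW lt); have P2 := h1 2%N lt.
apply: (h _ P1 (strict_nonmax P2 (h2 1%N lt))); exact: (strict_nonzero P0 (h2 0%N (ltnW lt))).
Qed.

Lemma dim_two P : is_prime S P -> P <> maxideal S -> nonzero P -> krull_dim S 2.
Proof.
move=> HP ne nP; have H0 := prime_zero HS; have Hmx := max_prime HSL; split.
  have [|c [hc _ _]] := @pchain_chain F S _ [:: P; maxideal S] H0; last by exists c.
  split=> //; first exact: (nonzero_strict HP nP).
  by split=> //; apply: strict_subP => //; exact: prime_submax.
move=> c m hc; rewrite leqNgt; apply/negP => lt; have [h1 h2] := hc.
have lt1 := ltnW lt; have lt0 := ltnW lt1.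
have P0 := h1 0%N isT; have P1 := h1 1%N lt0; have P2 := h1 2%N lt1; have P3 := h1 3%N lt.
have s01 := h2 0%N lt0; have s12 := h2 1%N lt1; have s23 := h2 2%N lt.
apply: (strict_sub_ne s12); apply: nonmax_unique => //.
- exact: (strict_nonmax P3 s23).
- exact: (strict_nonzero P1 s12).
- exact: (strict_nonmax P2 s12).
- exact: (strict_nonzero P0 s01).
Qed.

Section Rank2.
Variables (P : F -> Prop) (N : nat).
Hypotheses (HP : is_prime S P) (nP : nonzero P) (neP : P <> maxideal S)
  (hN : forall i, (N <= i)%N -> ~ P (x i)).
Let PI := prime_ideal HP.

Local Notation sunit := (runit S).
Let sunit_one := runit_one HS.
Let sunit_mul := @runit_mul _ _ HS.

(** The multiplicative monoid generated by [E] and the units of S. *)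
Definition mgen (E : seq F) z := forall X : F -> Prop, (forall c, sunit c -> X c) ->
  (forall e, e \in E -> X e) -> (forall a b, X a -> X b -> X (a * b)) -> X z.

Lemma mgen_trans (E E' : seq F) z : mgen E z -> (forall e, e \in E -> mgen E' e) -> mgen E' z.
Proof.
move=> hz hE X h1 h2 h3; apply: hz => // e eE; exact: hE.
Qed.

Lemma mgen_small (E : seq F) : (size E <= 1)%N -> exists e, forall y, mgen E y -> exists c a, sunit c /\ y = c * e ^+ a.
Proof.
case: E => [|e [|]] // _.
  exists 1 => y hy; exists y, 0%N; rewrite mulr1; split=> //; apply: hy => //; exact: sunit_mul.
exists e => y hy; apply: (hy (fun y => exists c a, sunit c /\ y = c * e ^+ a)).
- by move=> c hc; exists c, 0%N; rewrite mulr1.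
- by move=> e'; rewrite inE => /eqP ->; exists 1, 1%N; rewrite mul1r expr1; split=> //; exact: sunit_one.
- move=> _ _ [c [a [hc ->]]] [c' [a' [hc' ->]]]; exists (c * c'), (a + a')%N; split; first exact: sunit_mul.
  by rewrite exprD; ring.
Qed.

Let stage L (E : seq F) := forall e, e \in E -> maxideal (R L) e /\ ~ P e.

(* Replacing a list E of nonunits at stage L by x_L and the nonunits among the e/x_L divides the product
   of the list by x_L^(size E - 1), so the size cannot stay above 1: the product would be infinitely
   small compared to the elements of P. *)
Lemma commensurable (K : nat) y z : (N <= K)%N -> maxideal (R K) y -> maxideal (R K) z -> ~ P y -> ~ P z ->
  exists e, forall u, u \in [:: y; z] -> exists c a, sunit c /\ u = c * e ^+ a.
Proof.
move=> NK my mz nPy nPz; apply: contrapT => hno.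
have SRm L r : maxideal (R L) r -> S r by move=> mr; exists L; have := Hm L => ?; mem.
have big L E : (forall u, u \in [:: y; z] -> mgen E u) -> stage L E -> (1 < size E)%N.
  move=> hE _; rewrite ltnNge; apply/negP => le; apply: hno.
  have [e he] := mgen_small le; exists e => u uin; apply: he; exact: hE.
have step L : (K <= L)%N -> exists E g, [/\ stage L E, forall u, u \in [:: y; z] -> mgen E u, R L g &
    y * z = \prod_(K <= l < L) x l * g * \prod_(e <- E) e].
  move: L; apply: leq_ind.
    exists [:: y; z], 1; split.
    - by move=> e; rewrite !inE => /orP[] /eqP ->.
    - by move=> u uin X _ h _; exact: h.
    - by have := HR K => ?; mem.
    - by rewrite big_geq // !big_cons big_nil; ring.
  move=> L KL [E [g [hE hgen Rg eq]]]; have sE := big L E hgen hE.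
  have HL1 := HR L.+1.
  pose D := [seq e / x L | e <- E].
  have RD d : d \in D -> R L.+1 d /\ ~ P d.
    move=> /mapP[e eE ->]; have [me ne] := hE e eE; have Rd := qt_div (HL L) (qt L) me.
    split=> // Pd; apply: ne; rewrite -(divfK (x0 L) e); have := SRm L _ (x_max qt (leqnn L)) => ?; mem.
  pose nu d := `[< maxideal (R L.+1) d >].
  have unitD d : d \in D -> ~~ nu d -> sunit d.
    move=> /RD[Rd nd] /asboolPn h; have [d0 Rd1] := local_unit Rd h.
    by split=> //; exists L.+1.
  (* Of the [size E] factors x_L, one extends the product of the x_l, one heads the new list, and
     the remaining ones join g together with the units. *)
  exists (x L :: [seq d <- D | nu d]), (g * x L ^+ (size E - 2) * \prod_(d <- D | ~~ nu d) d); split.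
  - move=> e; rewrite inE => /orP[/eqP ->|].
      split; [exact: (x_max qt (leqnSn L))|by apply: hN; exact: leq_trans KL].
    by rewrite mem_filter => /andP[/asboolP h /RD[_ ?]].
  - move=> u uin; apply: (mgen_trans (hgen u uin)) => e eE X h1 h2 h3.
    rewrite -(divfK (x0 L) e); apply: h3; last by apply: h2; rewrite mem_head.
    have dD : e / x L \in D by apply: map_f.
    case: (boolP (nu (e / x L))) => hd; last by apply: h1; exact: unitD.
    by apply: h2; rewrite inE mem_filter hd dD orbT.
  - have Rg' := Rm (leqnSn L) Rg; have Rx' : R L.+1 (x L) by exact: (x_R reg qt).
    have : R L.+1 (\prod_(d <- D | ~~ nu d) d).
      by rewrite big_seq_cond; apply: (sr_prod HL1) => d /andP[/RD[]].
    by move=> ?; mem.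
  - rewrite eq big_nat_recr //= big_cons big_filter.
    have -> : \prod_(e <- E) e = x L ^+ size E * \prod_(d <- D) d.
      rewrite /D big_map; elim: (E) => [|e l ih]; first by rewrite !big_nil expr0 mulr1.
      rewrite !big_cons ih /= exprS; have xl0 := x0 L; field.
      by rewrite xl0.
    rewrite [\prod_(d <- D) d](bigID nu) /= -{1}(subnK sE) exprD.
    by ring.
(* Every product of the x_l from K on now divides yz with a nonunit cofactor. For a nonzero s of P
   in R_N, some s/(yz)^n would be outside V; but it lies in S, as (yz)^n/s in S would put yz in
   P. *)
have [t [Pt t0]] := nP; have [i Ri] : S t by mem.
have [d [Rd nd Rdt]] := P_den reg qt HP hN (ex_intro _ i Ri).
pose s := d * t.
have Sd : S d by exists N.
have Ps : P s by rewrite /s; mem.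
have RK := Rm NK Rdt.
have d0 := notin_neq0 HP nd.
have s0 : s != 0 by rewrite mulf_neq0.
have y0 := notin_neq0 HP nPy; have z0 := notin_neq0 HP nPz.
have yz0 : y * z != 0 by rewrite mulf_neq0.
have Syz : S (y * z) by have := SRm K y my => ?; have := SRm K z mz => ?; mem.
have npyz : ~ P (y * z) by apply: (primeMN HP) => //; exact: (SRm K).
have := infinitely_smaller reg qt RK s0 yz0 (ltnSn _); apply.
  move=> L KL; have [E [g [hE hgen Rg eq]]] := step L KL.
  exists (g * \prod_(e <- E) e); split; last by rewrite mulrA.
  have HmL := Hm L; have HRL := HR L.
  have := big L E hgen hE; case: E hE {hgen eq} => // e l hE _; rewrite big_cons.
  have [me _] := hE e (mem_head _ _).
  have : R L (\prod_(j <- l) j).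
    rewrite big_seq; apply: (sr_prod HRL) => j jl; have [|mj _] := hE j; first by rewrite in_cons jl orbT.
    by mem.
  by move=> ?; mem.
set n := (_).+1; have yzn0 : (y * z) ^+ n != 0 by rewrite expf_neq0.
have q0 : s / (y * z) ^+ n != 0 by rewrite mulf_neq0 ?invr_neq0.
apply: (V_of_S reg qt) => //; have [//|h] := hv.2 _ q0.
case: npyz; apply: (primeX (n := n) HP HS Syz).
by rewrite invf_div in h; rewrite -(divfK s0 ((y * z) ^+ n)); mem.
Qed.

End Rank2.
End ValuationToDimension.

(** * The valuation of V with values in Z + Q *)

Section ValueGroupOfV.
Variables (F : fieldType) (R : nat -> F -> Prop) (x : nat -> F).
Implicit Types (A B C I P Q T p : F -> Prop).
Hypotheses (reg : forall i, regular_local (R i)) (HQ : quotient_field_of (R 0%N))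
  (qt : forall i, qtrans (R i) (R i.+1) (x i)).
Let HL i := reg_local (reg i).
Let HR i := reg_sr (reg i).
Let Hm i := local_mi (HL i).
Let Rm := R_mono reg qt.
Let x0 := x_neq0 reg qt.
Local Notation S := (union_ring R).
Local Notation V := (boundary_valuation_ring R).
Let HS := S_sr reg qt.
Let HSL := S_local reg qt.
Let SmaxP := S_maxP reg qt.
Hypothesis hv : valuation_ring S.
Variables (P : F -> Prop) (N : nat).
Hypotheses (HP : is_prime S P) (nP : nonzero P) (neP : P <> maxideal S)
  (hN : forall i, (N <= i)%N -> ~ P (x i)).
Let PI := prime_ideal HP.
Let HmS := local_mi HSL.

Local Notation L := (localize (R N) (meet P (R N))).
Let HPc := P_contr reg N HP.
Let HLL : is_local L. Proof. exact: loc_local (HR N) HPc. Qed.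
Let HLs := local_sr HLL.
Let HmL := local_mi HLL.
Let SL : subset_ S L. Proof. by move=> z; exact: (P_loc reg qt HP hN). Qed.
Let eL : maxideal L = locid (R N) (meet P (R N)) (meet P (R N)). Proof. exact: loc_max (HR N) HPc. Qed.

Let Lmax_S z : maxideal L z -> S z.
Proof.
move=> mz; have [->|z0] := eqVneq z 0; first by mem.
have [//|/SL Lz] := hv.2 z z0; case: (unit_nmax Lz z0 mz).
Qed.

Let xi := x N.
Let xi0 : xi != 0 := x0 N.
Let mxi : maxideal S xi. Proof. by apply/SmaxP; exists N; exact: (x_max qt). Qed.

Let invexpz (z : F) (k : int) : z ^ (- k) = (z ^ k)^-1.
Proof. by rewrite -exprz_inv expfV. Qed.

Let expn_expz (z : F) (k : int) n : (z ^ k) ^+ n = z ^ (k * n%:Z).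
Proof. by rewrite exprnP exprz_exp. Qed.

(** For a nonunit e of S, e and x_N are powers of one g up to units, say with exponents a and b; b >
    0 as x_N is a nonunit, so e^b and x_N^a agree up to a unit. If e is outside S its inverse is
    used. *)
Let commens e : runit L e -> exists (m : nat) (a : int), (0 < m)%N /\ runit S (e ^+ m / xi ^ a).
Proof.
have main u : runit L u -> S u -> exists (m : nat) (a : int), (0 < m)%N /\ runit S (u ^+ m / xi ^ a).
  move=> [u0 Lu Lu1] Su; have nPu : ~ P u.
    move=> Pu; apply: (unit_nmax Lu1 u0); rewrite eL.
    have [d [Rd nd Rdu]] := P_den reg qt HP hN Su; have Sd : S d by exists N.
    exists (d * u), d; split=> //; [by split=> //; mem|by case|].
    by rewrite mulrC mulKf // (notin_neq0 HP).
  case: (EM (maxideal S u)) => [mu|nu]; last first.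
    have [_ Su1] := local_unit Su nu; exists 1%N, 0; split=> //.
    by rewrite expr1 expr0z divr1.
  have [i mi] := (SmaxP u).1 mu; pose K := maxn N i.
  have mK : maxideal (R K) u by exact: (m_mono qt (leq_maxr _ _)).
  have xK : maxideal (R K) xi by exact: (x_max qt (leq_maxl _ _)).
  have nx := hN (leqnn N).
  have [g hg] := commensurable reg qt hv HP nP hN (leq_maxl N i) mK xK nPu nx.
  have [c [a [hc ec]]] := hg u (mem_head _ _).
  have [c' [b [hc' ec']]] : exists c a, runit S c /\ xi = c * g ^+ a.
    by apply: hg; rewrite !inE eqxx orbT.
  have b0 : (0 < b)%N.
    rewrite lt0n; apply/eqP => b0; move: ec'; rewrite b0 mulr1 => ec'.
    by apply: (runit_max hc'); rewrite -ec'.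
  exists b, a%:Z; split=> //; rewrite -exprnP.
  have -> : u ^+ b / xi ^+ a = c ^+ b * (c' ^+ a)^-1.
    have g0 : g != 0 by apply: contraNneq xi0 => g0; rewrite ec' g0 expr0n (gtn_eqF b0) mulr0.
    have c0 : c' != 0 by case: hc'.
    rewrite [in LHS]ec [in LHS]ec' !exprMn -!exprM [(b * a)%N]mulnC; field.
    by rewrite !expf_neq0.
  by apply: runit_mul => //; [exact: runit_exp|apply: runit_inv; exact: runit_exp].
move=> he; have [e0 Le Le1] := he; have [Se|Se] := hv.2 e e0; first exact: main.
have [m [a [m0 h]]] := main _ (runit_inv he) Se; exists m, (- a); split=> //.
by have := runit_inv h; rewrite invexpz invrK exprVn invf_div invrK [xi ^ a * _]mulrC.
Qed.

Variable t : F.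
Hypotheses (t0 : t != 0) (mt : maxideal L t) (ht : forall s, maxideal L s -> L (s / t)).

(* z has value (n, q): z/t^n is a unit of S_P, one of whose powers is a power of x_N up to units of S,
   the quotient of the exponents being q. *)
Definition has_value z (n : int) (q : rat) := runit L (z / t ^ n) /\
  exists (m : nat) (a : int), [/\ (0 < m)%N, q = a%:~R / m%:R & runit S ((z / t ^ n) ^+ m / xi ^ a)].

Let natr_neq0 m : (0 < m)%N -> m%:R != 0 :> rat.
Proof. by rewrite pnatr_eq0 -lt0n. Qed.
Let tz0 (k : int) : t ^ k != 0. Proof. by rewrite expfz_neq0. Qed.
Let xz0 (k : int) : xi ^ k != 0. Proof. by rewrite expfz_neq0. Qed.

Lemma value_exists z : z != 0 -> exists v : int * rat, has_value z v.1 v.2.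
Proof.
move=> z0; have [_ hNN _] := reg N.
have [|n [m [e [Le Le1 e0 E]]]] := dvr_field HLL (loc_noeth (HR N) HPc hNN) t0 mt ht z0.
  have [a [b [Ra Rb a0 b0 ez]]] := frac_R reg HQ qt N z0; exists a, b.
  by split=> //; apply: (locid_sub (HR N) HPc).
have Ez : z / t ^ (n%:Z - m%:Z) = e.
  by rewrite expfzDr // -exprnN -exprnP E; field; rewrite !expf_neq0.
have he : runit L e by split.
have [k [a [k0 h]]] := commens he.
exists (n%:Z - m%:Z, a%:~R / k%:R); rewrite /has_value /= Ez; split=> //.
by exists k, a.
Qed.

Lemma value_uniq z n q n' q' : z != 0 -> has_value z n q -> has_value z n' q' -> n = n' /\ q = q'.
Proof.
move=> z0 [h1 [m [a [m0 eq h2]]]] [h1' [m' [a' [m0' eq' h2']]]].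
have en : n = n'.
  have : runit L (t ^ (n' - n)).
    rewrite (_ : _ ^ _ = (z / t ^ n) * (z / t ^ n')^-1); first by apply: runit_mul => //; exact: runit_inv.
    by rewrite expfzDr // invexpz; field; rewrite z0 !tz0.
  by move=> /(runit_expz HLs HLL mt) /eqP; rewrite subr_eq0 => /eqP.
split=> //; move: h2' h1'; rewrite -en; move: h1 h2; set e := z / t ^ n; clearbody e => h1 h2 h2' h1'.
have e0 : e != 0 by case: h1.
have : runit S (xi ^ (a' * m%:Z - a * m'%:Z)).
  rewrite (_ : _ ^ _ = (e ^+ m / xi ^ a) ^+ m' * ((e ^+ m' / xi ^ a') ^+ m)^-1).
    by apply: runit_mul => //; [exact: runit_exp|apply: runit_inv; exact: runit_exp].
  rewrite !expr_div_n !expn_expz -!exprM [(m' * m)%N]mulnC expfzDr // invexpz; field.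
  by rewrite !xz0 !expf_neq0.
move=> /(runit_expz HS HSL mxi) /eqP; rewrite subr_eq0 => /eqP ea.
rewrite eq eq'; apply/eqP; rewrite eqr_div ?natr_neq0 //.
by apply/eqP; have := congr1 (fun k : int => k%:~R : rat) ea; rewrite !rmorphM /= !pmulrn => ->.
Qed.

Lemma value_mul y z n q n' q' : y != 0 -> z != 0 -> has_value y n q -> has_value z n' q' ->
  has_value (y * z) (n + n') (q + q').
Proof.
move=> y0 z0 [h1 [m [a [m0 eq h2]]]] [h1' [m' [a' [m0' eq' h2']]]].
have E : y * z / t ^ (n + n') = (y / t ^ n) * (z / t ^ n') by rewrite expfzDr //; field; rewrite !tz0.
split; first by rewrite E; exact: runit_mul.
exists (m * m')%N, (a * m'%:Z + a' * m%:Z); split; first by rewrite muln_gt0 m0.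
  by rewrite eq eq' addf_div ?natr_neq0 // natrM rmorphD !rmorphM.
rewrite {h1 h1'}E; move: h2 h2'; set e := y / t ^ n; set f := z / t ^ n'; clearbody e f => h2 h2'.
rewrite (_ : _ / _ = (e ^+ m / xi ^ a) ^+ m' * (f ^+ m' / xi ^ a') ^+ m).
  by apply: runit_mul => //; exact: runit_exp.
rewrite !expr_div_n !expn_expz -!exprM [(m' * m)%N]mulnC expfzDr // exprMn; field.
by rewrite !xz0.
Qed.

Lemma value_inv z n q : z != 0 -> has_value z n q -> has_value z^-1 (- n) (- q).
Proof.
move=> z0 [h1 [m [a [m0 eq h2]]]].
have E : z^-1 / t ^ (- n) = (z / t ^ n)^-1 by rewrite invexpz invf_div invrK mulrC.
split; first by rewrite E; exact: runit_inv.
exists m, (- a); split=> //; first by rewrite eq rmorphN mulNr.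
by rewrite E invexpz invrK exprVn mulrC -invf_div; exact: runit_inv.
Qed.

Lemma value_t (k : int) : has_value (t ^ k) k 0.
Proof.
split; first by rewrite divff //; exact: runit_one.
exists 1%N, 0; rewrite divff //; split=> //.
by rewrite expr1 expr0z divr1; exact: runit_one.
Qed.

(** For n > 0, z lies in the maximal ideal of L, which S contains, being a valuation ring; n < 0 is
    the inverse case. For n = 0 the sign of q is that of the exponent of the nonunit x_N. *)
Lemma value_S z n q : z != 0 -> has_value z n q -> S z <-> lex_nonneg (n, q).
Proof.
have pos y k r : y != 0 -> has_value y k r -> 0 < k -> maxideal L y.
  move=> y0 [[_ h _] _] k0; case: k k0 h => [[|k]|k] // _ h.
  rewrite -(divfK (tz0 k.+1) y) -exprnP; mem.
move=> z0 hz; rewrite /lex_nonneg /=; have [lt|lt|e] := ltgtP n 0.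
- have : maxideal L z^-1 by apply: (pos z^-1 (- n) (- q)); [rewrite invr_neq0|exact: value_inv|lia].
  split; last by move=> [|[]]; lia.
  by move=> /SL Lz; case: (unit_nmax (A := L) (s := z^-1)) => //; rewrite ?invrK ?invr_neq0.
- by split=> // _; [left|apply: Lmax_S; exact: (pos z n q)].
rewrite e in hz *; have [h1 [m [a [m0 eq h2]]]] := hz; rewrite expr0z divr1 in h1 h2.
have q0 : (0 <= q) = (0 <= a).
  by rewrite eq pmulr_lge0 ?ler0z // invr_gt0 ltr0n.
split.
  move=> Sz; right; split=> //; rewrite q0 leNgt; apply/negP => a0.
  apply: (runit_max h2); case: a a0 {eq q0} h2 => // k _ h2.
  by rewrite NegzE -exprnN invrK; mem.
move=> [|[_]] //; rewrite q0 => a0; have [//|Sz1] := hv.2 z z0; apply: contrapT => nSz.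
have mz : maxideal S z^-1.
  by apply: contrapT => nm; have [_] := local_unit Sz1 nm; rewrite invrK.
apply: (runit_max (runit_inv h2)); rewrite invf_div mulrC -exprVn.
case: m m0 {eq h2 hz} => // m _; case: a a0 {q0} => // a _; rewrite -exprnP; mem.
Qed.

Lemma V_S z : z != 0 -> V z <-> S z.
Proof.
move=> z0; split; last by move=> Sz; exact: (V_of_S reg qt).
move=> Vz; have [//|Sz1] := hv.2 z z0; apply: contrapT => nSz.
have mz : maxideal S z^-1.
  by apply: contrapT => nm; have [_] := local_unit Sz1 nm; rewrite invrK.
by have := V_inv_max reg qt mz; rewrite invrK invr_neq0 //; apply.
Qed.

Lemma value_group : value_group_Z_lex_subQ V.
Proof.
(* The value at 0 is arbitrary: the clauses on [w] concern nonzero elements only. *)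
pose w z : int * rat := if pselect (z != 0) is left h then sval (cid (value_exists h)) else 0.
have wP z : z != 0 -> has_value z (w z).1 (w z).2.
  by move=> z0; rewrite /w; case: pselect => // h; exact: (svalP (cid (value_exists h))).
have wE z n q : z != 0 -> has_value z n q -> w z = (n, q).
  by move=> z0 h; have [e1 e2] := value_uniq z0 (wP z z0) h; rewrite [LHS]surjective_pairing e1 e2.
pose G q := exists z n, z != 0 /\ has_value z n q.
exists G, w; split; last split.
- split; first by exists 1, 0; split; [exact: oner_neq0|have := value_t 0; rewrite expr0z].
  move=> q q' [y [n [y0 hy]]] [z [n' [z0 hz]]]; exists (y * z^-1), (n - n').
  by split; [rewrite mulf_neq0 ?invr_neq0|apply: value_mul; rewrite ?invr_neq0 //; exact: value_inv].
- by move=> y z y0 z0; apply: wE; [rewrite mulf_neq0|apply: value_mul => //; exact: wP].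
(* Since t has value (1, 0), powers of t adjust the Z-component freely; this splits the value group
   as Z + G. *)
- move=> n g [z [k [z0 hz]]]; exists (z * t ^ (n - k)); split; first by rewrite mulf_neq0.
  apply: wE; first by rewrite mulf_neq0.
  by have := value_mul z0 (tz0 (n - k)) hz (value_t (n - k)); rewrite addr0 addrCA subrr addr0.
- by move=> z z0; exists z, (w z).1; split=> //; exact: wP.
- move=> z z0; rewrite V_S //; rewrite [w z]surjective_pairing; exact: (value_S z0 (wP z z0)).
Qed.
End ValueGroupOfV.

Theorem theorem8p1 (F : fieldType) (Rs : nat -> F -> Prop) :
  regular_local (Rs 0%N) ->
  quotient_field_of (Rs 0%N) ->
  (forall i : nat,
     [/\ local_quadratic_transform (Rs i) (Rs i.+1),
         strict_sub (Rs i) (Rs i.+1),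
         regular_local (Rs i) &
         exists d, krull_dim (Rs i) d /\ (2 <= d)%N]) ->
  let S := union_ring Rs in
  let V := boundary_valuation_ring Rs in
  (valuation_ring S <-> finitely_many_height_one S) /\
  (finitely_many_height_one S <->
     (krull_dim S 1 \/ (krull_dim S 2 /\ value_group_Z_lex_subQ V))).
Proof.
move=> _ HQ h S V.
have reg i : regular_local (Rs i) by case: (h i).
have dim2 i : exists d, krull_dim (Rs i) d /\ (2 <= d)%N by case: (h i).
have lqt i : exists x, qtrans (Rs i) (Rs i.+1) x by case: (h i) => /lqtP.
pose x i := sval (cid (lqt i)); have qt i : qtrans (Rs i) (Rs i.+1) (x i) := svalP (cid (lqt i)).
have HS : is_subring S := S_sr reg qt.
have fv : finitely_many_height_one S -> valuation_ring S by exact: (finite_valuation reg HQ qt dim2).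
split; split=> //; first exact: (valuation_finite reg qt).
- move=> /fv hv; case: (EM (exists P, [/\ is_prime S P, P <> maxideal S & nonzero P])).
    move=> [P [HP ne nP]]; right; split; first exact: (dim_two reg qt hv HP ne nP).
    have [N hN] := nonmax_index reg qt HP ne.
    have [t [t0 mt ht]] := P_dvr reg HQ qt HP hN nP (nonmax_height1 reg qt hv HP ne nP).
    exact: (value_group reg HQ qt hv HP nP hN t0 mt ht).
  move=> nE; left; apply: (dim_one reg qt) => P HP ne nP; apply: nE; by exists P.
- case=> [|[hd [G [w [[G0 _] [wM ws _ wV]]]]]]; first exact: (dim1_finite reg qt).
  exact: (value_group_finite reg HQ qt wM ws G0 wV hd).
Qed.
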